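(* Let $\Gamma_{1,1}$ be the fundamental group of $\Sigma_{1,1}$, a compact oriented surface of genus $1$ with one boundary component. If $\rho:\Gamma_{1,1}\to\mathrm{PSL}_2(\mathbb C)$ is non-elementary, then there exist simple loops $a$ and $b$ generating $\Gamma_{1,1}$ such that $\rho(a)$ and $\rho(b)$ are loxodromic.
   Context: $\mathrm{PSL}_2(\mathbb C)$ is the group of orientation-preserving isometries of hyperbolic space $\mathbb H^3$, acting also on $\partial\mathbb H^3\simeq\mathbb{CP}^1$ by Möbius transformations. A homomorphism $\rho:G\to \mathrm{PSL}_2(\mathbb C)$ is elementary if there is $z\in\mathbb H^3\cup\partial\mathbb H^3$ whose orbit $\rho(G)\cdot z$ is finite; otherwise it is non-elementary. ''Loxodromic'' includes hyperbolic: an element with exactly two fixed points in $\mathbb{CP}^1$, one attracting and one repelling. The base point of the fundamental group is taken in the interior of the surface; simple loops are based at it. *)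

(* Defs.v *)
From HB Require Import structures.
From mathcomp Require Import all_boot all_order all_algebra generic_quotient.
From mathcomp Require Import all_classical all_reals topology normedtype homotopy.
From mathcomp Require Import complex.
From mathcomp Require Import ring lra.
Set Implicit Arguments.
Unset Strict Implicit.
Unset Printing Implicit Defensive.
Import Order.TTheory GRing.Theory Num.Theory.
Import numFieldNormedType.Exports.

Local Open Scope classical_set_scope.
Local Open Scope ring_scope.
Local Open Scope quotient_scope.

Definition unit_interval (R : realType) : Type :=
  set_type (`[0, 1]%classic : set R).

Section UnitInterval.
Variable R : realType.
Local Notation I := (unit_interval R).

HB.instance Definition _ := Topological.copy I (set_type (`[0, 1]%classic : set R)).

Definition clamp_real (r : R) : R := Num.max 0 (Num.min 1 r).

Lemma clamp_subproof r : clamp_real r \in (`[0, 1]%classic : set R).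
Proof.
rewrite inE /= in_itv /= /clamp_real.
by rewrite le_max lexx /= ge_max ler01 ge_min lexx.
Qed.

Definition clamp (r : R) : I := SigSub (clamp_subproof r).

Definition ucoord (t : I) : R := set_val t.

Lemma ucoord_ge0 t : 0 <= ucoord t.
Proof. by have := set_valP t; rewrite /= in_itv /= => /andP[]. Qed.

Lemma ucoord_le1 t : ucoord t <= 1.
Proof. by have := set_valP t; rewrite /= in_itv /= => /andP[]. Qed.

Lemma ucoord_inj : injective ucoord.
Proof. by move=> s t; rewrite /ucoord set_valE => /val_inj. Qed.

Lemma ucoord_clamp r : ucoord (clamp r) = Num.max 0 (Num.min 1 r).
Proof. by []. Qed.

Lemma ucoordK : cancel ucoord clamp.
Proof.
move=> t; apply: ucoord_inj; rewrite ucoord_clamp.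
by rewrite (min_idPr (ucoord_le1 t)) (max_idPr (ucoord_ge0 t)).
Qed.

Lemma unit_interval_neq : clamp 0 != clamp 1.
Proof.
apply/eqP => /(congr1 ucoord); rewrite !ucoord_clamp.
rewrite minxx (min_idPr ler01) maxxx (max_idPr ler01).
by apply/eqP; rewrite eq_sym oner_eq0.
Qed.

HB.instance Definition _ := isBiPointed.Build I unit_interval_neq.

Lemma ucoord0 : ucoord zero = 0.
Proof. by rewrite ucoord_clamp (min_idPr ler01) maxxx. Qed.

Lemma ucoord1 : ucoord one = 1.
Proof. by rewrite ucoord_clamp minxx (max_idPr ler01). Qed.

Lemma clamp_le0 r : r <= 0 -> clamp r = zero.
Proof.
move=> r0; apply: ucoord_inj; rewrite ucoord0 ucoord_clamp.
by rewrite (min_idPr (le_trans r0 ler01)) (max_idPl r0).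
Qed.

Lemma clamp_ge1 r : 1 <= r -> clamp r = one.
Proof.
move=> r1; apply: ucoord_inj; rewrite ucoord1 ucoord_clamp.
by rewrite (min_idPl r1) (max_idPr ler01).
Qed.

Lemma continuous_ucoord : continuous ucoord.
Proof. exact: initial_continuous. Qed.

Lemma continuous_clamp : continuous clamp.
Proof.
apply/continuousP => A [B oB <-].
rewrite -comp_preimage.
have /continuousP : continuous (set_val \o clamp : R -> R); last exact.
move=> r; rewrite /= -[_ \o _]/clamp_real /clamp_real.
apply: continuous_max; first exact: cvg_cst.
by apply: continuous_min; [exact: cvg_cst | exact: cvg_id].
Qed.

End UnitInterval.

Lemma paste_continuous (R : realType) (X S : topologicalType) (u : X -> R)
    (c : R) (F G : X -> S) :
  continuous u -> continuous F -> continuous G ->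
  (forall x, u x = c -> F x = G x) ->
  continuous (fun x => if u x <= c then F x else G x).
Proof.
move=> cu cF cG FG x U UFG.
change (\forall y \near x, U (if u y <= c then F y else G y)).
have UF : u x <= c -> \forall y \near x, U (F y).
  by move=> uxc; apply: cF; move: UFG; rewrite uxc.
have UG : c <= u x -> \forall y \near x, U (G y).
  move=> cux; apply: cG; move: UFG; case: ifP => // uxc.
  by rewrite FG //; apply/eqP; rewrite eq_le uxc cux.
have [ux|ux|ux] := ltgtP (u x) c.
- have ul : \forall y \near x, u y < c by exact: (cu x _ (lt_nbhsl ux)).
  apply: filterS2 ul (UF (ltW ux)) => y ul Uy.
  by rewrite (ltW ul).
- have ul : \forall y \near x, c < u y by exact: (cu x _ (lt_nbhsr ux)).
  apply: filterS2 ul (UG (ltW ux)) => y ul Uy.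
  by rewrite leNgt ul.
- have uF : u x <= c by rewrite ux.
  have uG : c <= u x by rewrite ux.
  by apply: filterS2 (UF uF) (UG uG) => y Fy Gy; case: ifP.
Qed.

Notation loop R p := {path (unit_interval R) from p to p}.

Section Loops.
Variables (R : realType) (S : topologicalType) (p : S).
Local Notation I := (unit_interval R).
Implicit Types f g h : loop R p.

Definition loop_homotopic f g : Prop :=
  exists H : I * I -> S,
    [/\ continuous H,
        forall t, H (t, zero) = f t,
        forall t, H (t, one) = g t,
        forall s, H (zero, s) = p &
        forall s, H (one, s) = p].

(* the extension of a loop to the real line that is constant outside [0, 1] *)
Definition loop_ext f : R -> S := f \o @clamp R.

Lemma loop_extE f t : loop_ext f (ucoord t) = f t.
Proof. by rewrite /loop_ext /= ucoordK. Qed.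

Lemma loop_ext_le0 f r : r <= 0 -> loop_ext f r = p.
Proof. by move=> r0; rewrite /loop_ext /= clamp_le0 // path_zero. Qed.

Lemma loop_ext_ge1 f r : 1 <= r -> loop_ext f r = p.
Proof. by move=> r1; rewrite /loop_ext /= clamp_ge1 // path_one. Qed.

Lemma continuous_loop_ext f : continuous (loop_ext f).
Proof.
move=> r; apply: continuous_comp; first exact: continuous_clamp.
exact: cts_fun.
Qed.

Lemma continuous_affine_comp (X : topologicalType) (u : X -> R) (a b : R) :
  continuous u -> continuous (fun x => a * u x + b).
Proof.
move=> cu x; apply: cvgD; last exact: cvg_cst.
by apply: cvgM; [exact: cvg_cst | exact: cu].
Qed.

Lemma continuous_min_comp (X : topologicalType) (u v : X -> R) :
  continuous u -> continuous v -> continuous (fun x => Num.min (u x) (v x)).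
Proof. by move=> cu cv x; apply: continuous_min; [exact: cu | exact: cv]. Qed.

Lemma continuous_max_comp (X : topologicalType) (u v : X -> R) :
  continuous u -> continuous v -> continuous (fun x => Num.max (u x) (v x)).
Proof. by move=> cu cv x; apply: continuous_max; [exact: cu | exact: cv]. Qed.

Definition concat_fun f g (t : I) : S :=
  if ucoord t <= 2^-1 then loop_ext f (2 * ucoord t)
  else loop_ext g (2 * ucoord t - 1).

Lemma continuous_affine_ucoord (a b : R) :
  continuous (fun t : I => a * ucoord t + b).
Proof.
by apply: continuous_affine_comp; exact: continuous_ucoord.
Qed.

Lemma concat_cts f g : continuous (concat_fun f g).
Proof.
apply: paste_continuous; first exact: continuous_ucoord.
- move=> t; have -> : (fun t : I => loop_ext f (2 * ucoord t)) =
      loop_ext f \o (fun t => 2 * ucoord t + 0).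
    by apply/funext => s /=; rewrite addr0.
  apply: continuous_comp; first exact: continuous_affine_ucoord.
  exact: continuous_loop_ext.
- move=> t; apply: (@continuous_comp _ _ _ (fun t : I => 2 * ucoord t - 1)).
    exact: continuous_affine_ucoord.
  exact: continuous_loop_ext.
- move=> t ->; rewrite mulfV ?pnatr_eq0 // subrr.
  by rewrite loop_ext_ge1 // loop_ext_le0.
Qed.

Lemma concat_zero f g : concat_fun f g zero = p.
Proof.
by rewrite /concat_fun ucoord0 invr_ge0 ler0n mulr0 loop_ext_le0.
Qed.

Lemma concat_one f g : concat_fun f g one = p.
Proof.
rewrite /concat_fun ucoord1 ifF; last by apply/negbTE; rewrite -ltNge; lra.
by rewrite loop_ext_ge1 //; lra.
Qed.

Definition concat f g : loop R p :=
  mk_path (@concat_cts f g) (concat_zero f g) (concat_one f g).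

Definition rev_fun f (t : I) : S := loop_ext f (1 - ucoord t).

Lemma rev_cts f : continuous (rev_fun f).
Proof.
move=> t; have -> : rev_fun f = loop_ext f \o (fun t => -1 * ucoord t + 1).
  by apply/funext => s /=; rewrite mulN1r addrC.
apply: continuous_comp; first exact: continuous_affine_ucoord.
exact: continuous_loop_ext.
Qed.

Lemma rev_zero f : rev_fun f zero = p.
Proof. by rewrite /rev_fun ucoord0 loop_ext_ge1 // subr0. Qed.

Lemma rev_one f : rev_fun f one = p.
Proof. by rewrite /rev_fun ucoord1 loop_ext_le0 // subrr. Qed.

Definition rev_loop f : loop R p := mk_path (@rev_cts f) (rev_zero f) (rev_one f).

Definition const_loop : loop R p := (cst p : I -> S).

Lemma concatE f g t : concat f g t =
  if ucoord t <= 2^-1 then loop_ext f (2 * ucoord t)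
  else loop_ext g (2 * ucoord t - 1).
Proof. by []. Qed.

Lemma rev_loopE f t : rev_loop f t = loop_ext f (1 - ucoord t).
Proof. by []. Qed.

Lemma loop_ext_concat f g r : loop_ext (concat f g) r =
  if r <= 2^-1 then loop_ext f (2 * r) else loop_ext g (2 * r - 1).
Proof.
have [r0|r0] := leP r 0.
  rewrite loop_ext_le0 // ifT; last by lra.
  by rewrite loop_ext_le0 //; lra.
have [r1|r1] := leP 1 r.
  rewrite loop_ext_ge1 // ifF; last by apply/negbTE; rewrite -ltNge; lra.
  by rewrite loop_ext_ge1 //; lra.
rewrite {1}/loop_ext /= concatE ucoord_clamp.
by rewrite (min_idPr (ltW r1)) (max_idPr (ltW r0)).
Qed.

Lemma loop_homotopic_refl f : loop_homotopic f f.
Proof.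
exists (f \o fst); split=> //= [x|s|s]; rewrite ?path_zero ?path_one //.
by apply: continuous_comp; [exact: cvg_fst | exact: cts_fun].
Qed.

Lemma continuous_slice (H : I * I -> S) (X : topologicalType) (u v : X -> R) :
  continuous H -> continuous u -> continuous v ->
  continuous (fun x => H (clamp (u x), clamp (v x))).
Proof.
move=> cH cu cv x.
apply: (@continuous_comp _ _ _ (fun x => (clamp (u x), clamp (v x))) H);
  last exact: cH.
apply: (@cvg_pair _ _ _ _ (nbhs (clamp (u x))) (nbhs (clamp (v x)))).
  by apply: (@continuous_comp _ _ _ u); [exact: cu|exact: continuous_clamp].
by apply: (@continuous_comp _ _ _ v); [exact: cv|exact: continuous_clamp].
Qed.

Lemma continuous_ufst : continuous (fun x : I * I => ucoord x.1).
Proof.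
move=> x; apply: (@continuous_comp _ _ _ fst (@ucoord R)).
  exact: cvg_fst.
exact: continuous_ucoord.
Qed.

Lemma continuous_usnd : continuous (fun x : I * I => ucoord x.2).
Proof.
move=> x; apply: (@continuous_comp _ _ _ snd (@ucoord R)).
  exact: cvg_snd.
exact: continuous_ucoord.
Qed.

Lemma loop_homotopic_sym f g : loop_homotopic f g -> loop_homotopic g f.
Proof.
move=> [H [cH H0 H1 Hz Ho]].
exists (fun x => H (clamp (1 * ucoord x.1 + 0), clamp (-1 * ucoord x.2 + 1))).
split=> [|t|t|s|s] /=.
- by apply: continuous_slice => //; apply: continuous_affine_comp;
    [exact: continuous_ufst | exact: continuous_usnd].
- by rewrite mul1r addr0 ucoordK ucoord0 mulr0 add0r H1.
- by rewrite mul1r addr0 ucoordK ucoord1 mulr1 addNr H0.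
- by rewrite mul1r addr0 ucoordK.
- by rewrite mul1r addr0 ucoordK.
Qed.

Lemma loop_homotopic_trans f g h :
  loop_homotopic f g -> loop_homotopic g h -> loop_homotopic f h.
Proof.
move=> [H [cH H0 H1 Hz Ho]] [K [cK K0 K1 Kz Ko]].
exists (fun x => if ucoord x.2 <= 2^-1
  then H (clamp (1 * ucoord x.1 + 0), clamp (2 * ucoord x.2 + 0))
  else K (clamp (1 * ucoord x.1 + 0), clamp (2 * ucoord x.2 + (-1)))).
split=> [|t|t|s|s] /=; rewrite ?mul1r ?addr0 ?ucoordK ?Hz ?Ho ?Kz ?Ko ?if_same //.
- by apply: paste_continuous; [exact: continuous_usnd|
    apply: continuous_slice => //; apply: continuous_affine_comp;
      [exact: continuous_ufst | exact: continuous_usnd]..|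
    move=> x ->; rewrite mul1r !addr0 !ucoordK mulfV ?pnatr_eq0 // subrr;
    rewrite clamp_ge1 // clamp_le0 // H1 K0].
- by rewrite ucoord0 mulr0 ifT ?invr_ge0 ?ler0n // H0.
- rewrite ucoord1 ifF; last by apply/negbTE; rewrite -ltNge; lra.
  by rewrite clamp_ge1 ?K1 //; lra.
Qed.

Definition loop_homotopicb f g : bool := `[< loop_homotopic f g >].

Lemma loop_homotopicb_refl : reflexive loop_homotopicb.
Proof. by move=> f; apply/asboolP; exact: loop_homotopic_refl. Qed.

Lemma loop_homotopicb_sym : symmetric loop_homotopicb.
Proof.
by move=> f g; apply/asboolP/asboolP; exact: loop_homotopic_sym.
Qed.

Lemma loop_homotopicb_trans : transitive loop_homotopicb.
Proof.
move=> g f h /asboolP fg /asboolP gh; apply/asboolP.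
exact: loop_homotopic_trans fg gh.
Qed.

Canonical loop_homotopy_equiv := EquivRel loop_homotopicb
  loop_homotopicb_refl loop_homotopicb_sym loop_homotopicb_trans.

Lemma concat_homotopic f f' g g' : loop_homotopic f f' ->
  loop_homotopic g g' -> loop_homotopic (concat f g) (concat f' g').
Proof.
move=> [H [cH H0 H1 Hz Ho]] [K [cK K0 K1 Kz Ko]].
exists (fun x => if ucoord x.1 <= 2^-1
  then H (clamp (2 * ucoord x.1 + 0), clamp (1 * ucoord x.2 + 0))
  else K (clamp (2 * ucoord x.1 + (-1)), clamp (1 * ucoord x.2 + 0))).
split=> [|t|t|s|s] /=; rewrite ?mul1r ?addr0 ?ucoordK.
- by apply: paste_continuous; [exact: continuous_ufst|
    apply: continuous_slice => //; apply: continuous_affine_comp;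
      [exact: continuous_ufst | exact: continuous_usnd]..|
    move=> x ->; rewrite mul1r !addr0 !ucoordK mulfV ?pnatr_eq0 // subrr;
    rewrite clamp_ge1 // clamp_le0 // Ho Kz].
- by rewrite concatE /loop_ext /= -H0 -K0.
- by rewrite concatE /loop_ext /= -H1 -K1.
- by rewrite ucoord0 mulr0 ifT ?invr_ge0 ?ler0n // Hz.
- rewrite ucoord1 ifF; last by apply/negbTE; rewrite -ltNge; lra.
  by rewrite clamp_ge1 ?Ko //; lra.
Qed.

Lemma rev_homotopic f g :
  loop_homotopic f g -> loop_homotopic (rev_loop f) (rev_loop g).
Proof.
move=> [H [cH H0 H1 Hz Ho]].
exists (fun x => H (clamp (-1 * ucoord x.1 + 1), clamp (1 * ucoord x.2 + 0))).
split=> [|t|t|s|s] /=; rewrite ?mul1r ?addr0 ?ucoordK ?mulN1r.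
- by apply: continuous_slice => //; apply: continuous_affine_comp;
    [exact: continuous_ufst | exact: continuous_usnd].
- by rewrite H0 rev_loopE addrC.
- by rewrite H1 rev_loopE addrC.
- by rewrite ucoord0 oppr0 add0r.
- by rewrite ucoord1 addNr.
Qed.

Lemma reparam_homotopic f g h (u v : I -> R) :
  continuous u -> continuous v ->
  (forall t, g t = loop_ext f (u t)) -> (forall t, h t = loop_ext f (v t)) ->
  (forall s, 0 <= s -> s <= 1 ->
    loop_ext f (u zero + s * (v zero - u zero)) = p) ->
  (forall s, 0 <= s -> s <= 1 ->
    loop_ext f (u one + s * (v one - u one)) = p) ->
  loop_homotopic g h.
Proof.
move=> cu cv gE hE fz fo.
exists (fun x => loop_ext f (u x.1 + ucoord x.2 * (v x.1 - u x.1))).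
split=> [|t|t|s|s] /=.
- have ctsu (w : I -> R) : continuous w -> continuous (fun x : I * I => w x.1).
    move=> cw x; apply: (@continuous_comp _ _ _ fst w); first exact: cvg_fst.
    exact: cw.
  move=> x; apply: (@continuous_comp _ _ _
    (fun x : I * I => u x.1 + ucoord x.2 * (v x.1 - u x.1)));
    last exact: continuous_loop_ext.
  apply: cvgD; first exact: ctsu.
  apply: cvgM; first exact: continuous_usnd.
  by apply: cvgB; exact: ctsu.
- by rewrite ucoord0 mul0r addr0 gE.
- by rewrite ucoord1 mul1r addrC subrK hE.
- by apply: fz; [exact: ucoord_ge0 | exact: ucoord_le1].
- by apply: fo; [exact: ucoord_ge0 | exact: ucoord_le1].
Qed.

Lemma concatA f g h :
  loop_homotopic (concat f (concat g h)) (concat (concat f g) h).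
Proof.
pose v (t : I) := Num.min (2 * ucoord t + 0)
  (Num.min (1 * ucoord t + 4^-1) (2^-1 * ucoord t + 2^-1)).
have vE t : v t = if ucoord t <= 4^-1 then 2 * ucoord t else
    if ucoord t <= 2^-1 then ucoord t + 4^-1 else (ucoord t + 1) / 2.
  rewrite /v /Num.min; do ?case: ifPn; rewrite -?leNgt -?ltNge; lra.
apply: (@reparam_homotopic (concat f (concat g h)) _ _ (@ucoord R) v).
- exact: continuous_ucoord.
- apply: continuous_min_comp; first exact: continuous_affine_ucoord.
  by apply: continuous_min_comp; exact: continuous_affine_ucoord.
- by move=> t; rewrite loop_extE.
- move=> t; rewrite vE concatE !loop_ext_concat.
  do ?case: ifPn; rewrite -?leNgt -?ltNge; move=> *;
    by [exfalso; lra | congr (loop_ext _ _); lra].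
- by move=> s *; rewrite vE ucoord0 loop_ext_le0 // ifT; lra.
- move=> s s0 s1; rewrite loop_ext_ge1 // vE ucoord1.
  by do ?case: ifPn; rewrite -?leNgt -?ltNge => *; nra.
Qed.

Lemma concat1l f : loop_homotopic (concat const_loop f) f.
Proof.
apply: (@reparam_homotopic f _ _ (fun t => 2 * ucoord t + (-1)) (@ucoord R)).
- exact: continuous_affine_ucoord.
- exact: continuous_ucoord.
- move=> t; rewrite concatE; case: ifPn => // t2.
  by rewrite [RHS]loop_ext_le0 //; lra.
- by move=> t; rewrite loop_extE.
- by move=> s *; rewrite ucoord0 loop_ext_le0 //; lra.
- by move=> s *; rewrite ucoord1 loop_ext_ge1 //; lra.
Qed.

Lemma concat1r f : loop_homotopic (concat f const_loop) f.
Proof.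
apply: (@reparam_homotopic f _ _ (fun t => 2 * ucoord t + 0) (@ucoord R)).
- exact: continuous_affine_ucoord.
- exact: continuous_ucoord.
- move=> t; rewrite concatE addr0; case: ifPn => //; rewrite -ltNge => t2.
  by rewrite [RHS]loop_ext_ge1 //; lra.
- by move=> t; rewrite loop_extE.
- by move=> s *; rewrite ucoord0 loop_ext_le0 //; lra.
- by move=> s *; rewrite ucoord1 loop_ext_ge1 //; lra.
Qed.

Lemma loop_ext_rev f r : loop_ext (rev_loop f) r = loop_ext f (1 - r).
Proof.
have [r0|r0] := leP r 0.
  by rewrite loop_ext_le0 // loop_ext_ge1 //; lra.
have [r1|r1] := leP 1 r.
  by rewrite loop_ext_ge1 // loop_ext_le0 //; lra.
rewrite {1}/loop_ext /= rev_loopE ucoord_clamp.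
by rewrite (min_idPr (ltW r1)) (max_idPr (ltW r0)).
Qed.

Lemma concatV f : loop_homotopic (concat f (rev_loop f)) const_loop.
Proof.
apply: (@reparam_homotopic f _ _
  (fun t => Num.min (2 * ucoord t + 0) (-2 * ucoord t + 2)) (fun=> 0)).
- by apply: continuous_min_comp; exact: continuous_affine_ucoord.
- by move=> t; exact: cst_continuous.
- move=> t; rewrite concatE loop_ext_rev /Num.min.
  by do ?case: ifPn; rewrite -?leNgt -?ltNge => *; congr (loop_ext _ _); lra.
- by move=> t; rewrite loop_ext_le0.
- by move=> s *; rewrite ucoord0 /Num.min ifT ?loop_ext_le0 //; lra.
- move=> s *; rewrite ucoord1 /Num.min ifF ?loop_ext_le0 //; first lra.
  by apply/negbTE; rewrite -leNgt; lra.
Qed.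

Lemma concatVl f : loop_homotopic (concat (rev_loop f) f) const_loop.
Proof.
apply: (@reparam_homotopic f _ _
  (fun t => Num.max (2 * ucoord t + (-1)) (-2 * ucoord t + 1)) (fun=> 1)).
- by apply: continuous_max_comp; exact: continuous_affine_ucoord.
- by move=> t; exact: cst_continuous.
- move=> t; rewrite concatE loop_ext_rev /Num.max.
  by do ?case: ifPn; rewrite -?leNgt -?ltNge => *; congr (loop_ext _ _); lra.
- by move=> t; rewrite loop_ext_ge1.
- move=> s *; rewrite ucoord0 /Num.max ifT ?loop_ext_ge1 //; lra.
- move=> s *; rewrite ucoord1 /Num.max ifF ?loop_ext_ge1 //; first lra.
  by apply/negbTE; rewrite -leNgt; lra.
Qed.

End Loops.

Definition pi1 (R : realType) (S : topologicalType) (p : S) : Type :=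
  {eq_quot (@loop_homotopy_equiv R S p)}.

Section FundamentalGroup.
Variables (R : realType) (S : topologicalType) (p : S).
Local Notation G := (@pi1 R S p).
Implicit Types f g : loop R p.

HB.instance Definition _ :=
  EqQuotient.copy G {eq_quot (@loop_homotopy_equiv R S p)}.
HB.instance Definition _ := Choice.copy G {eq_quot (@loop_homotopy_equiv R S p)}.

Definition loop_class f : G := \pi_G f.

Lemma loop_classP f g : loop_class f = loop_class g <-> loop_homotopic f g.
Proof.
split=> [/eqP|fg]; first by rewrite /loop_class eqmodE => /asboolP.
by apply/eqP; rewrite /loop_class eqmodE; apply/asboolP.
Qed.

Lemma loop_class_repr (x : G) : loop_class (repr x) = x.
Proof. exact: reprK. Qed.

Definition pi1_one : G := loop_class (const_loop R p).
Definition pi1_mul (x y : G) : G := loop_class (concat (repr x) (repr y)).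
Definition pi1_inv (x : G) : G := loop_class (rev_loop (repr x)).

Lemma pi1_mulE f g :
  pi1_mul (loop_class f) (loop_class g) = loop_class (concat f g).
Proof.
by apply/loop_classP/concat_homotopic; apply/loop_classP;
  exact: loop_class_repr.
Qed.

Lemma pi1_invE f : pi1_inv (loop_class f) = loop_class (rev_loop f).
Proof.
by apply/loop_classP/rev_homotopic; apply/loop_classP; exact: loop_class_repr.
Qed.

Lemma pi1_mulA : associative pi1_mul.
Proof.
move=> x y z; rewrite -(loop_class_repr x) -(loop_class_repr y).
by rewrite -(loop_class_repr z) !pi1_mulE; apply/loop_classP/concatA.
Qed.

Lemma pi1_mul1 : left_id pi1_one pi1_mul.
Proof.
by move=> x; rewrite -(loop_class_repr x) pi1_mulE; apply/loop_classP/concat1l.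
Qed.

Lemma pi1_mulr1 : right_id pi1_one pi1_mul.
Proof.
by move=> x; rewrite -(loop_class_repr x) pi1_mulE; apply/loop_classP/concat1r.
Qed.

Lemma pi1_mulV : left_inverse pi1_one pi1_inv pi1_mul.
Proof.
move=> x; rewrite -(loop_class_repr x) pi1_invE pi1_mulE.
exact/loop_classP/concatVl.
Qed.

Lemma pi1_mulrV : right_inverse pi1_one pi1_inv pi1_mul.
Proof.
move=> x; rewrite -(loop_class_repr x) pi1_invE pi1_mulE.
exact/loop_classP/concatV.
Qed.

HB.instance Definition _ :=
  isGroup.Build G pi1_mulA pi1_mul1 pi1_mulr1 pi1_mulV pi1_mulrV.

Definition simple_path f : Prop :=
  forall s t, ucoord s < ucoord t -> f s = f t -> s = zero /\ t = one.

Definition simple_loop (x : G) : Prop :=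
  exists2 f, simple_path f & loop_class f = x.

End FundamentalGroup.

Arguments loop_class {R S p} f.

Definition generates (G : groupType) (a b : G) : Prop :=
  forall H : {pred G}, group_closed H -> a \in H -> b \in H ->
  forall x, x \in H.

Section Surface.
Variable R : realType.

Definition circle : set (R * R) := [set u | u.1 ^+ 2 + u.2 ^+ 2 = 1].

Definition torus : set ((R * R) * (R * R)) := circle `*` circle.

(* The points (u, v) of the torus outside the product of open arcs
   {Re u < 0} x {Re v < 0}, which is an open disc. By the classification of
   surfaces this is, up to homeomorphism, the compact orientable surface of
   genus 1 with one boundary component. *)
Definition holed_torus_set : set ((R * R) * (R * R)) :=
  torus `&` [set x | 0 <= x.1.1 \/ 0 <= x.2.1].

Definition holed_torus : Type := set_type holed_torus_set.

HB.instance Definition _ := Topological.copy holed_torus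
  (set_type holed_torus_set).

(* Interior as a surface with boundary: the complement of the frontier of the
   removed disc. *)
Definition holed_torus_interior : set holed_torus :=
  [set x | 0 < (set_val x).1.1 \/ 0 < (set_val x).2.1].

End Surface.

Record homeomorphism (T U : topologicalType) := Homeomorphism {
  homeo_fun :> T -> U;
  homeo_inv : U -> T;
  homeo_cts : continuous homeo_fun;
  homeo_inv_cts : continuous homeo_inv;
  homeoK : cancel homeo_fun homeo_inv;
  homeo_invK : cancel homeo_inv homeo_fun }.

Lemma det_mx22 (F : comNzRingType) (A : 'M[F]_2) :
  \det A = A 0 0 * A 1 1 - A 0 1 * A 1 0.
Proof.
rewrite (expand_det_row _ 0) !big_ord_recl big_ord0 addr0 /cofactor /=.
rewrite !det_mx11 !mxE /= expr0 expr1 mul1r mulN1r mulrN.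
by congr (_ * A _ _ - A _ _ * A _ _); apply/val_inj.
Qed.

Section SL2.
Variable F : fieldType.

Record SL2 : Type := MkSL2 { SL2mx :> 'M[F]_2; SL2_det : \det SL2mx == 1 }.

HB.instance Definition _ := [isSub for SL2mx].
HB.instance Definition _ := [Choice of SL2 by <:].

Implicit Types A B : SL2.

Lemma SL2_one_subproof : \det (1%:M : 'M[F]_2) == 1.
Proof. by rewrite det1. Qed.
Lemma SL2_mul_subproof A B : \det ((A : 'M_2) *m B) == 1.
Proof. by rewrite det_mulmx (eqP (SL2_det A)) (eqP (SL2_det B)) mul1r. Qed.
Lemma SL2_inv_subproof A : \det (invmx A) == 1.
Proof. by rewrite det_inv (eqP (SL2_det A)) invr1. Qed.
Lemma SL2_opp_subproof A : \det (- (A : 'M_2)) == 1.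
Proof. by rewrite -scaleN1r detZ sqrrN expr1n mul1r (eqP (SL2_det A)). Qed.

Definition SL2_one : SL2 := MkSL2 SL2_one_subproof.
Definition SL2_mul A B : SL2 := MkSL2 (SL2_mul_subproof A B).
Definition SL2_inv A : SL2 := MkSL2 (SL2_inv_subproof A).
Definition SL2_opp A : SL2 := MkSL2 (SL2_opp_subproof A).

Lemma SL2_unitmx A : (A : 'M_2) \in unitmx.
Proof. by rewrite unitmxE (eqP (SL2_det A)) unitr1. Qed.

Lemma SL2_mulA : associative SL2_mul.
Proof. by move=> A B C; apply: val_inj; rewrite /= mulmxA. Qed.
Lemma SL2_mul1 : left_id SL2_one SL2_mul.
Proof. by move=> A; apply: val_inj; rewrite /= mul1mx. Qed.
Lemma SL2_mulr1 : right_id SL2_one SL2_mul.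
Proof. by move=> A; apply: val_inj; rewrite /= mulmx1. Qed.
Lemma SL2_mulV : left_inverse SL2_one SL2_inv SL2_mul.
Proof. by move=> A; apply: val_inj; rewrite /= mulVmx ?SL2_unitmx. Qed.
Lemma SL2_mulrV : right_inverse SL2_one SL2_inv SL2_mul.
Proof. by move=> A; apply: val_inj; rewrite /= mulmxV ?SL2_unitmx. Qed.

HB.instance Definition _ :=
  isGroup.Build SL2 SL2_mulA SL2_mul1 SL2_mulr1 SL2_mulV SL2_mulrV.

Definition SL2_eqpm A B : bool := (A == B) || (A == SL2_opp B).

Lemma SL2_oppK : involutive SL2_opp.
Proof. by move=> A; apply: val_inj; rewrite /= opprK. Qed.

Lemma SL2_eqpm_refl : reflexive SL2_eqpm.
Proof. by move=> A; rewrite /SL2_eqpm eqxx. Qed.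

Lemma SL2_eqpm_sym : symmetric SL2_eqpm.
Proof.
move=> A B; rewrite /SL2_eqpm [B == A]eq_sym; congr (_ || _).
by apply/eqP/eqP => ->; rewrite SL2_oppK.
Qed.

Lemma SL2_eqpm_trans : transitive SL2_eqpm.
Proof.
move=> B A C; rewrite /SL2_eqpm => /orP[/eqP->//|/eqP->] /orP[] /eqP ->.
  by rewrite eqxx orbT.
by rewrite SL2_oppK eqxx.
Qed.

Canonical SL2_eqpm_equiv :=
  EquivRel SL2_eqpm SL2_eqpm_refl SL2_eqpm_sym SL2_eqpm_trans.

Definition PSL2 : Type := {eq_quot SL2_eqpm_equiv}.

HB.instance Definition _ := EqQuotient.copy PSL2 {eq_quot SL2_eqpm_equiv}.
HB.instance Definition _ := Choice.copy PSL2 {eq_quot SL2_eqpm_equiv}.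

Definition PSL2_class A : PSL2 := \pi_PSL2 A.

Lemma PSL2_classP A B :
  PSL2_class A = PSL2_class B <-> A = B \/ A = SL2_opp B.
Proof.
split=> [/eqP|AB]; last apply/eqP; rewrite /PSL2_class eqmodE /= /SL2_eqpm.
  by case/orP => /eqP; [left | right].
by case: AB => ->; rewrite eqxx ?orbT.
Qed.

Lemma PSL2_class_repr (x : PSL2) : PSL2_class (repr x) = x.
Proof. exact: reprK. Qed.

Definition PSL2_one : PSL2 := PSL2_class 1%g.
Definition PSL2_mul (x y : PSL2) : PSL2 := PSL2_class (repr x * repr y)%g.
Definition PSL2_inv (x : PSL2) : PSL2 := PSL2_class (repr x)^-1%g.

Lemma PSL2_mulE A B : PSL2_mul (PSL2_class A) (PSL2_class B) = PSL2_class (A * B)%g.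
Proof.
apply/PSL2_classP.
have /PSL2_classP[->|->] := PSL2_class_repr (PSL2_class A);
  have /PSL2_classP[->|->] := PSL2_class_repr (PSL2_class B); [left|right|right|left];
  by apply: val_inj; rewrite /= ?mulmxN ?mulNmx ?opprK.
Qed.

Lemma PSL2_invE A : PSL2_inv (PSL2_class A) = PSL2_class A^-1%g.
Proof.
apply/PSL2_classP.
have /PSL2_classP[->|->] := PSL2_class_repr (PSL2_class A); [left|right] => //.
apply: val_inj => /=; rewrite -scaleN1r invmxZ ?invrN1 ?scaleN1r //.
exact: (SL2_unitmx (SL2_opp A)).
Qed.

Lemma PSL2_mulA : associative PSL2_mul.
Proof.
move=> x y z; rewrite -(PSL2_class_repr x) -(PSL2_class_repr y).
by rewrite -(PSL2_class_repr z) !PSL2_mulE mulgA.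
Qed.
Lemma PSL2_mul1 : left_id PSL2_one PSL2_mul.
Proof. by move=> x; rewrite -(PSL2_class_repr x) PSL2_mulE mul1g. Qed.
Lemma PSL2_mulr1 : right_id PSL2_one PSL2_mul.
Proof. by move=> x; rewrite -(PSL2_class_repr x) PSL2_mulE mulg1. Qed.
Lemma PSL2_mulV : left_inverse PSL2_one PSL2_inv PSL2_mul.
Proof.
by move=> x; rewrite -(PSL2_class_repr x) PSL2_invE PSL2_mulE mulVg.
Qed.
Lemma PSL2_mulrV : right_inverse PSL2_one PSL2_inv PSL2_mul.
Proof.
by move=> x; rewrite -(PSL2_class_repr x) PSL2_invE PSL2_mulE mulgV.
Qed.

HB.instance Definition _ :=
  isGroup.Build PSL2 PSL2_mulA PSL2_mul1 PSL2_mulr1 PSL2_mulV PSL2_mulrV.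

End SL2.

Section Hyperbolic.
Variable R : realType.
Local Notation C := R[i].
Local Open Scope complex_scope.

(* The Riemann sphere: None is the point at infinity, and C^o carries the
   topology of the complex modulus. *)
Local Notation CP1 := (one_point_compactification C^o).

Definition mobius_mx (A : 'M[C]_2) (z : CP1) : CP1 :=
  let: (a, b, c, d) := (A 0 0, A 0 1, A 1 0, A 1 1) in
  if z is Some z' then
    if c * z' + d == 0 then None else Some ((a * z' + b) / (c * z' + d))
  else if c == 0 then None else Some (a / c).

Definition mobius (g : PSL2 C) (z : CP1) : CP1 := mobius_mx (SL2mx (repr g)) z.

Lemma mobiusE (A : SL2 C) z : mobius (PSL2_class A) z = mobius_mx A z.
Proof.
have /PSL2_classP[AE|AE] := PSL2_class_repr (PSL2_class A).
  by rewrite /mobius AE.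
rewrite /mobius AE /= /mobius_mx !mxE.
case: z => [z|]; rewrite ?oppr_eq0 ?mulNr -?opprD ?oppr_eq0;
  by case: eqP => // _; rewrite invrN ?mulrN ?mulNr opprK.
Qed.

Definition csqnorm (z : C) : R := complex.Re z ^+ 2 + complex.Im z ^+ 2.

(* The upper half-space model of H^3: the point (z, t) stands for z + t j. *)
Definition H3 : set (C * R) := [set x | 0 < x.2].

(* The Poincare extension of the Mobius transformation given by A (for \det A = 1),
   i.e. P |-> (a P + b) (c P + d)^-1 computed in the quaternions, P = z + t j. *)
Definition poincare_mx (A : 'M[C]_2) (x : C * R) : C * R :=
  let: (a, b, c, d) := (A 0 0, A 0 1, A 1 0, A 1 1) in
  let: (z, t) := x in
  let D := csqnorm (c * z + d) + csqnorm c * t ^+ 2 in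
  (((a * z + b) * conjc (c * z + d) + a * conjc c * (t ^+ 2)%:C) / D%:C, t / D).

Definition poincare (g : PSL2 C) (x : C * R) : C * R :=
  poincare_mx (SL2mx (repr g)) x.

Lemma csqnormN z : csqnorm (- z) = csqnorm z.
Proof. by case: z => a b; rewrite /csqnorm /= !sqrrN. Qed.

Lemma csqnorm_ge0 z : 0 <= csqnorm z.
Proof. by rewrite addr_ge0 ?sqr_ge0. Qed.

Lemma csqnorm_eq0 z : (csqnorm z == 0) = (z == 0).
Proof. by rewrite paddr_eq0 ?sqr_ge0 // !sqrf_eq0 eq_complex. Qed.

Lemma poincareE (A : SL2 C) x : poincare (PSL2_class A) x = poincare_mx A x.
Proof.
have /PSL2_classP[AE|AE] := PSL2_class_repr (PSL2_class A).
  by rewrite /poincare AE.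
rewrite /poincare AE /= /poincare_mx !mxE; case: x => z t.
by rewrite !mulNr -!opprD !csqnormN !rmorphN /= mulrNN mulrN mulNr opprK.
Qed.

Lemma poincare_H3 (g : PSL2 C) x : H3 x -> H3 (poincare g x).
Proof.
case: x => z t; rewrite -(PSL2_class_repr g) poincareE /H3 /= => t0.
set A := repr g; apply: divr_gt0 => //.
have D0 (u v : C) : 0 <= csqnorm u + csqnorm v * t ^+ 2.
  exact: addr_ge0 (csqnorm_ge0 _) (mulr_ge0 (csqnorm_ge0 _) (sqr_ge0 _)).
rewrite lt_neqAle D0 andbT eq_sym paddr_eq0 ?csqnorm_ge0 //; last first.
  exact: mulr_ge0 (csqnorm_ge0 _) (sqr_ge0 _).
rewrite mulf_eq0 !csqnorm_eq0 sqrf_eq0 (gt_eqF t0) orbF.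
apply/negP => /andP[/eqP + /eqP cE]; rewrite cE mul0r add0r => dE.
have := SL2_det A; rewrite det_mx22 cE dE !mulr0 subr0.
by rewrite eq_sym oner_eq0.
Qed.

Definition elementary (G : groupType) (rho : {multiplicative G -> PSL2 C}) : Prop :=
  (exists2 x, H3 x & finite_set (range (fun g => poincare (rho g) x)))
  \/ (exists z, finite_set (range (fun g => mobius (rho g) z))).

Definition attracting (g : PSL2 C) (p : CP1) : Prop :=
  mobius g p = p /\ \forall z \near p, iter n (mobius g) z @[n --> \oo] --> p.

Definition repelling (g : PSL2 C) (p : CP1) : Prop := attracting g^-1%g p.

Definition loxodromic (g : PSL2 C) : Prop :=
  exists p q, [/\ p <> q, forall z, mobius g z = z <-> z = p \/ z = q,
    attracting g p & repelling g q].

End Hyperbolic.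

(* Main.v *)
(** The pairs of simple loops obtained from the two standard circles by homeomorphisms of
    the surface generate the fundamental group, and are closed under the Nielsen moves
    (a, b) -> (b, a), (a^-1, b), (b a, b).

    If rho b is loxodromic, then tr rho (b^n a) is unbounded in n unless rho a swaps the
    fixed points of rho b, in which case rho has an orbit of two points. So it suffices to
    find one loxodromic element. If there is none, all traces x = tr rho a, y = tr rho b,
    z = tr rho (a b) lie in [-2, 2]. When kappa = x^2 + y^2 + z^2 - x y z - 2 <= 2, rho has a
    fixed point on the sphere (kappa = 2) or preserves a Hermitian form, hence a point of H^3
    (kappa < 2). When kappa > 2, the Markov move replacing the smallest trace z by x y - z
    increases its absolute value by at least (kappa - 2) / 4, so that iterating it leaves
    [-2, 2]. *)
Require Import Defs.
From HB Require Import structures.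
From mathcomp Require Import all_boot all_order all_algebra.
From mathcomp Require Import all_classical all_reals topology normedtype homotopy.
From mathcomp Require Import sequences trigo complex.
From mathcomp Require Import ring lra.
Set Implicit Arguments.
Unset Strict Implicit.
Unset Printing Implicit Defensive.
Import Order.TTheory GRing.Theory Num.Theory.
Import numFieldNormedType.Exports.
Import Normc.

Local Open Scope classical_set_scope.
Local Open Scope ring_scope.

(** * Moebius transformations and loxodromic elements *)

(** Defining the pairs as homeomorphic images of the two circles makes simplicity of both loops
    automatic, and reduces each Nielsen move to one explicit homeomorphism of the model that fixes
    the base point. That every such pair generates is what transfers the hypothesis on rho to the
    pair: a point pair or a Hermitian form preserved by rho a and rho b is preserved by the whole
    image.

    Topology and algebra meet only at the end: the trace argument is run for an abstract relation on
    pairs of matrices that is closed under the moves and excludes common invariants. Signs of lifts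
    from PSL2 to SL2 need no control, because [-2, 2] is symmetric and kappa, as the trace of a
    commutator, does not see them. The Nielsen moves conjugate or invert the commutator up to
    conjugacy, so kappa is constant along them; hence the increment of the Markov moves is uniform
    and finitely many moves suffice. *)

Lemma cvg_affine0 (K : numFieldType) (e : nat -> K) (a b : K) :
  e n @[n --> \oo] --> 0 -> a + e n * b @[n --> \oo] --> a.
Proof.
move=> e0; rewrite -[X in _ --> X]addr0 -(mul0r b).
by apply: cvgD; [exact: cvg_cst|exact: cvgMr_tmp].
Qed.

Lemma cvg_affine_div (K : numFieldType) (e : nat -> K) (a b c d : K) : c != 0 ->
  e n @[n --> \oo] --> 0 ->
  (a + e n * b) / (c + e n * d) @[n --> \oo] --> a / c.
Proof.
move=> c0 e0; apply: cvgM; first exact: cvg_affine0.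
by apply: cvgV => //; exact: cvg_affine0.
Qed.

Lemma near_affine_neq0 (K : numFieldType) (e : nat -> K) (a b : K) : a != 0 ->
  e n @[n --> \oo] --> 0 -> \forall n \near \oo, a + e n * b != 0.
Proof.
move=> a0 e0; have := cvg_affine0 (a := a) b e0.
move=> /cvgrPdist_lt/(_ `|a|); rewrite normr_gt0 => /(_ a0).
by apply: filterS => n; apply: contraTneq => ->; rewrite subr0 ltxx.
Qed.

Section Mobius.
Variable R : realType.
Local Notation C := R[i].
Local Notation CP1 := (one_point_compactification C^o).

(** Homogeneous coordinates, on which matrices act linearly: they spare a case distinction at
    infinity in every later computation. *)
Definition proj_point (x y : C) : CP1 := if y == 0 then None else Some (x / y).

Lemma proj_pointZ (k x y : C) : k != 0 -> proj_point (k * x) (k * y) = proj_point x y.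
Proof.
move=> k0; rewrite /proj_point mulf_eq0 (negbTE k0) /=; case: eqP => // /eqP y0.
by congr Some; field; rewrite k0 y0.
Qed.

Lemma proj_point_eq (x y x' y' : C) : (x, y) != (0, 0) -> (x', y') != (0, 0) ->
  (proj_point x y = proj_point x' y') <-> x * y' = x' * y.
Proof.
rewrite !xpair_eqE !negb_and /proj_point => xy xy'.
have [y0|y0] := eqVneq y 0; have [y0'|y0'] := eqVneq y' 0.
- by rewrite y0 y0' !mulr0.
- rewrite y0 eqxx orbF in xy; rewrite y0 mulr0; split => // /eqP.
  by rewrite mulf_eq0 (negbTE xy) (negbTE y0').
- rewrite y0' eqxx orbF in xy'; rewrite y0' mulr0; split => // /esym/eqP.
  by rewrite mulf_eq0 (negbTE xy') (negbTE y0).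
- split=> [[]|] H.
  + have -> : x * y' = x / y * (y * y') by field.
    by rewrite H; field.
  + congr Some; apply: (@mulIf _ (y * y')); first by rewrite mulf_neq0.
    have -> : x / y * (y * y') = x * y' by field.
    by rewrite H; field.
Qed.

Lemma proj_point_surj (z : CP1) : exists x y, (x, y) != (0, 0) /\ z = proj_point x y.
Proof.
case: z => [z|].
  exists z, 1; rewrite xpair_eqE oner_eq0 andbF; split=> //.
  by rewrite /proj_point oner_eq0 divr1.
by exists 1, 0; rewrite xpair_eqE oner_eq0; split=> //; rewrite /proj_point eqxx.
Qed.

Lemma mobius_mx_proj (A : 'M[C]_2) (x y : C) : \det A != 0 -> (x, y) != (0, 0) ->
  mobius_mx A (proj_point x y) =
    proj_point (A 0 0 * x + A 0 1 * y) (A 1 0 * x + A 1 1 * y).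
Proof.
rewrite det_mx22 xpair_eqE negb_and /mobius_mx.
move: (A 0 0) (A 0 1) (A 1 0) (A 1 1) => a b c d D xy.
rewrite /proj_point; have [y0|y0] := eqVneq y 0.
  rewrite y0 eqxx orbF in xy; rewrite y0 !mulr0 !addr0 mulf_eq0 (negbTE xy) orbF.
  by case: eqP => // /eqP c0; congr Some; field; rewrite c0 xy.
have -> : c * x + d * y = (c * (x / y) + d) * y by field.
rewrite mulf_eq0 (negbTE y0) orbF; case: eqP => // /eqP N0; congr Some.
by field; rewrite y0 -[c * x + d * y]/(c * x + d * y); apply/andP; split=> //;
  apply: contra N0 => /eqP N0; apply/eqP; apply: (mulIf y0);
  rewrite mul0r -N0; field.
Qed.

Lemma proj_point_neq0 (A : 'M[C]_2) (x y : C) : \det A != 0 -> (x, y) != (0, 0) ->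
  (A 0 0 * x + A 0 1 * y, A 1 0 * x + A 1 1 * y) != (0, 0).
Proof.
rewrite det_mx22 !xpair_eqE.
move: (A 0 0) (A 0 1) (A 1 0) (A 1 1) => a b c d D.
apply: contra => /andP[/eqP E /eqP F].
(* Cramer's rule: D x and D y are combinations of the two vanishing coordinates. *)
rewrite -(mulrI_eq0 x (mulfI D)) -(mulrI_eq0 y (mulfI D)).
have -> : (a * d - b * c) * x = d * (a * x + b * y) - b * (c * x + d * y) by ring.
have -> : (a * d - b * c) * y = a * (c * x + d * y) - c * (a * x + b * y) by ring.
by rewrite E F !mulr0 subrr eqxx.
Qed.

Lemma mobius_mxM (A B : 'M[C]_2) z : \det A != 0 -> \det B != 0 ->
  mobius_mx (A *m B) z = mobius_mx A (mobius_mx B z).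
Proof.
move=> A0 B0; have [x [y [xy ->]]] := proj_point_surj z.
rewrite (mobius_mx_proj B0 xy) (mobius_mx_proj A0 (proj_point_neq0 B0 xy)).
rewrite mobius_mx_proj ?det_mulmx ?mulf_neq0 // !mxE !big_ord_recl !big_ord0 /=.
have -> : lift ord0 ord0 = 1 :> 'I_2 by apply/val_inj.
by congr proj_point; ring.
Qed.

Lemma SL2_det_neq0 (A : SL2 C) : \det (A : 'M_2) != 0.
Proof. by rewrite (eqP (SL2_det A)) oner_eq0. Qed.

Lemma PSL2_surj (g : PSL2 C) : exists A, g = PSL2_class A.
Proof. by exists (repr g); rewrite PSL2_class_repr. Qed.

Lemma mobiusM (g h : PSL2 C) z : mobius (g * h)%g z = mobius g (mobius h z).
Proof.
have [A ->] := PSL2_surj g; have [B ->] := PSL2_surj h.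
rewrite -[(_ * _)%g]/(PSL2_mul _ _) PSL2_mulE !mobiusE.
by rewrite mobius_mxM ?SL2_det_neq0.
Qed.

Lemma mobius1 z : mobius (1%g : PSL2 C) z = z.
Proof.
have [x [y [xy ->]]] := proj_point_surj z.
rewrite -[1%g]/(PSL2_class 1%g) mobiusE mobius_mx_proj ?SL2_det_neq0 //.
by rewrite !mxE /= mul1r !mul0r mul1r addr0 add0r.
Qed.

Lemma mobius_invK (g : PSL2 C) : cancel (mobius g) (mobius g^-1%g).
Proof. by move=> z; rewrite -mobiusM mulVg mobius1. Qed.

Definition eigenpair (A : 'M[C]_2) (mu : C) (v : C * C) : Prop :=
  A 0 0 * v.1 + A 0 1 * v.2 = mu * v.1 /\ A 1 0 * v.1 + A 1 1 * v.2 = mu * v.2.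

(** The determinant of v and w: for nonzero vectors it vanishes exactly when they define the same
    point of the sphere. *)
Definition cross (v w : C * C) : C := v.1 * w.2 - v.2 * w.1.

Lemma cross_neq0 v w : cross v w != 0 -> v != (0, 0) /\ w != (0, 0).
Proof.
rewrite /cross; case: v w => [a b] [c d] /= H; rewrite !xpair_eqE !negb_and.
by split; apply: contraNT H; rewrite negb_or !negbK => /andP[/eqP-> /eqP->];
  rewrite ?mulr0 ?mul0r subrr.
Qed.

Lemma eigenpair_fixed (A : SL2 C) mu v : mu != 0 -> (v.1, v.2) != (0, 0) ->
  eigenpair A mu v -> mobius (PSL2_class A) (proj_point v.1 v.2) = proj_point v.1 v.2.
Proof.
move=> mu0; case: v => [x y] /= v0 [/= E F].
by rewrite mobiusE mobius_mx_proj ?SL2_det_neq0 // E F proj_pointZ.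
Qed.

Lemma eigenpair_inv (A : SL2 C) mu v : mu != 0 ->
  eigenpair A mu v -> eigenpair (A^-1)%g mu^-1 v.
Proof.
move=> mu0 [E F]; have /matrixP M := mulVmx (SL2_unitmx A).
have o1 : lift ord0 ord0 = 1 :> 'I_2 by apply/val_inj.
have /= := M 0 0; have /= := M 0 1; have /= := M 1 0; have /= := M 1 1.
rewrite !mxE !big_ord_recl !big_ord0 /= !o1 -!/(SL2mx (A^-1)%g).
set B := invmx A => M11 M10 M01 M00.
split; apply: (mulfI mu0);
  rewrite mulrA mulfV // mul1r mulrDr !mulrA ![mu * _]mulrC -!mulrA.
  rewrite -E -F; transitivity ((B 0 0 * A 0 0 + (B 0 1 * A 1 0 + 0)) * v.1 + (B 0 0 * A
    0 1 + (B 0 1 * A 1 1 + 0)) * v.2); first ring.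
  by rewrite M00 M01 /= mulr1n mulr0n mul1r mul0r addr0.
rewrite -E -F; transitivity ((B 1 0 * A 0 0 + (B 1 1 * A 1 0 + 0)) * v.1 + (B 1 0 * A 0
  1 + (B 1 1 * A 1 1 + 0)) * v.2); first ring.
by rewrite M10 M11 /= mulr1n mulr0n mul1r mul0r add0r.
Qed.

(** Cramer's rule. The explicit coefficients serve later as the matrix entries of B in an eigenbasis
    of A. *)
Lemma cross_decomp (v w u : C * C) : cross v w != 0 ->
  u.1 = cross u w / cross v w * v.1 + cross v u / cross v w * w.1 /\
  u.2 = cross u w / cross v w * v.2 + cross v u / cross v w * w.2.
Proof. by rewrite /cross => D; split; field. Qed.

Lemma cross_coord (v w u : C * C) : cross v w != 0 ->
  exists a b, u.1 = a * v.1 + b * w.1 /\ u.2 = a * v.2 + b * w.2.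
Proof. by move=> D; do 2 eexists; exact: cross_decomp. Qed.

Lemma normrc (z : C) : `|z| = (normc z)%:C%C.
Proof. by []. Qed.

Lemma normc_ge0 (z : C) : 0 <= normc z.
Proof. by case: z => a b; exact: sqrtr_ge0. Qed.

Lemma cvg_expc (z : C) : `|z| < 1 -> ((z ^+ n : C^o) @[n --> \oo] --> (0 : C^o)).
Proof.
rewrite normrc -[1]/((1 : R)%:C%C) ltcR => z1.
apply/cvgr0Pnorm_lt => -[e e']; rewrite ltcE /= => /andP[/eqP-> e0].
have /cvgr0Pnorm_lt/(_ e e0) : (normc z) ^+ n @[n --> \oo] --> (0 : R).
  by apply: cvg_expr; rewrite ger0_norm ?normc_ge0.
apply: filterS => n; rewrite ger0_norm ?exprn_ge0 ?normc_ge0 //.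
by rewrite normrX [`|z|]normrc -rmorphXn /= ltcR.
Qed.

Lemma continuous_normc : continuous (@normc R : C^o -> R).
Proof.
move=> x; have FF := @nbhs_filter C^o x; apply/(@cvgrPdist_lt R R C^o (nbhs x)) => e e0.
have e0' : 0 < (e%:C)%C :> C by rewrite ltcR.
apply: filterS (@nbhsx_ballx C C^o x _ e0') => y.
rewrite -ball_normE /= normrc ltcR => H; apply: le_lt_trans H.
have := @le_normcD R (x - y) y; have := @le_normcD R (y - x) x.
rewrite !subrK -[y - x]opprB normcN => h1 h2; rewrite ler_norml; lra.
Qed.

(** Neighbourhoods of infinity are complements of compact sets, so convergence to infinity is tested
    against such a bound M. *)
Lemma compact_normc (K : set C^o) : compact K ->
  exists M, forall x, K x -> normc x <= M.
Proof.
move=> cK; have /compact_bounded : compact (@normc R @` K).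
  by apply: continuous_compact => //; apply/continuous_subspaceT/continuous_normc.
move=> [M [Mr HM]]; exists (M + 1) => x Kx.
have /= := HM (M + 1); rewrite ltrDl ltr01 => /(_ isT (normc x)) H.
by apply: le_trans (H _); [exact: ler_norm|exists x].
Qed.

(** If v is the point at infinity, the inverse quotient tends to 0 and so the modulus leaves every
    compact set; otherwise the quotients converge in the plane. *)
Lemma proj_point_cvg (v w : C * C) (e : nat -> C^o) : cross v w != 0 ->
  e n @[n --> \oo] --> (0 : C^o) ->
  proj_point (v.1 + e n * w.1) (v.2 + e n * w.2) @[n --> \oo] --> proj_point v.1 v.2.
Proof.
case: v w => [v0 v1] [w0 w1]; rewrite /cross /= => D e0.
have [v10|v10] := eqVneq v1 0.
  rewrite v10 mul0r subr0 mulf_eq0 negb_or in D; case/andP: D => v00 w10.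
  rewrite v10 {2}/proj_point eqxx => U [K [cK _] KU].
  have [M HM] := compact_normc cK.
  have M0 : 0 < Num.max M 0 + 1 by rewrite ltr_pwDr // le_max lexx orbT.
  have M1 : (0 : C) < (Num.max M 0 + 1)%:C%C^-1 by rewrite invr_gt0 ltcR.
  have v0n : \forall n \near \oo, v0 + e n * w0 != 0.
    exact: (@near_affine_neq0 C).
  have : (0 + e n * w1) / (v0 + e n * w0) @[n --> \oo] --> (0 / v0 : C^o).
    exact: (@cvg_affine_div C).
  rewrite mul0r => /(@cvgr0Pnorm_lt C C^o)/(_ _ M1); apply: filterS2 v0n => n v0n Hn.
  apply: KU; rewrite /proj_point add0r; case: eqP => [|/eqP N]; [by right|left].
  exists ((v0 + e n * w0) / (e n * w1)) => // /HM.
  apply/negP; rewrite -ltNge; move: Hn.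
  rewrite add0r -[X in `|X|]invrK invf_div normfV ltf_pV2 ?posrE ?ltcR //; last first.
    by rewrite -ltcR -normrc normr_gt0 mulf_neq0 // invr_eq0.
  by apply: le_lt_trans; rewrite ler_wpDr // le_max lexx.
rewrite {2}/proj_point (negbTE v10).
have : Some ((v0 + e n * w0) / (v1 + e n * w1) : C^o) @[n --> \oo] --> (Some (v0 / v1 :
  C^o) : CP1).
  apply: (@cvg_comp _ _ _ (fun n => (v0 + e n * w0) / (v1 + e n * w1) : C^o) Some);
    last first.
    exact: one_point_compactification_some_continuous.
  exact: (@cvg_affine_div C).
apply: cvg_trans; apply: near_eq_cvg.
have : \forall n \near \oo, v1 + e n * w1 != 0 by exact: (@near_affine_neq0 C).
by apply: filterS => n N; rewrite /proj_point (negbTE N).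
Qed.

(** In the basis v, w the transformation multiplies the affine coordinate k by mu / la, the common
    factor la being projectively invisible. *)
Lemma iter_mobius (A : SL2 C) la mu v w (k : C) n : la != 0 -> cross v w != 0 ->
  eigenpair A la v -> eigenpair A mu w ->
  iter n (mobius (PSL2_class A)) (proj_point (v.1 + k * w.1) (v.2 + k * w.2)) =
  proj_point (v.1 + k * (mu / la) ^+ n * w.1) (v.2 + k * (mu / la) ^+ n * w.2).
Proof.
case: v w => [v0 v1] [w0 w1]; rewrite /cross /eigenpair /= => la0 D [E1 E2] [F1 F2].
elim: n => [|n IH]; first by rewrite mulr1.
rewrite iterS IH mobiusE exprSr; set r := (mu / la) ^+ n.
rewrite mobius_mx_proj ?SL2_det_neq0 //; last first.
  rewrite xpair_eqE; apply: contra D => /andP[/eqP H1 /eqP H2]; apply/eqP.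
  have -> : v0 * w1 - v1 * w0 = (v0 + k * r * w0) * w1 - (v1 + k * r * w1) * w0 by ring.
  by rewrite H1 H2; ring.
rewrite -[RHS](proj_pointZ _ _ la0); congr proj_point.
  transitivity ((A 0 0 * v0 + A 0 1 * v1) + k * r * (A 0 0 * w0 + A 0 1 * w1));
    first ring.
  by rewrite E1 F1; field.
transitivity ((A 1 0 * v0 + A 1 1 * v1) + k * r * (A 1 0 * w0 + A 1 1 * w1)); first ring.
by rewrite E2 F2; field.
Qed.

Lemma near_neq (p q : CP1) : p <> q -> \forall z \near p, z <> q.
Proof.
case: p => [x|]; case: q => [y|] //= pq.
- have /filterS : nbhs (x : C^o) [set~ (y : C^o)].
    apply: open_nbhs_nbhs; split; last by move=> /= xy; apply: pq; rewrite xy.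
    by apply: closed_openC; apply: accessible_closed_set1; apply: hausdorff_accessible;
      exact: norm_hausdorff.
  by apply=> z /= zy [].
- by apply: (@filterS _ (nbhs (x : C^o))) filterT.
- exists [set (y : C^o)]; first split.
  + exact: compact_set1.
  + by apply: accessible_closed_set1; apply: hausdorff_accessible; exact: norm_hausdorff.
  + by move=> z [[u /= uy <-] [//]|->].
Qed.

(* The basin of attraction is the complement of the other fixed point. *)
Lemma attracting_eigen (A : SL2 C) la mu v w : la != 0 -> cross v w != 0 ->
  eigenpair A la v -> eigenpair A mu w -> normc mu < normc la ->
  attracting (PSL2_class A) (proj_point v.1 v.2).
Proof.
move=> la0 D E F lamu; have [] := cross_neq0 D;
  rewrite {1}[v]surjective_pairing {1}[w]surjective_pairing => v0 w0.
split; first exact: eigenpair_fixed E.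
have : \forall z \near proj_point v.1 v.2, z <> proj_point w.1 w.2.
  apply: near_neq => /(proj_point_eq v0 w0) H; move/eqP: D; apply.
  by rewrite /cross H; ring.
apply: filterS => z zw; have [x [y [xy zE]]] := proj_point_surj z.
have [a [b [/= xE yE]]] := @cross_coord v w (x, y) D.
have a0 : a != 0.
  apply: contra_notN zw => /eqP a0; rewrite zE; apply/(proj_point_eq xy w0).
  by rewrite xE yE a0; ring.
rewrite zE xE yE -(proj_pointZ _ _ (invr_neq0 a0)).
have -> : a^-1 * (a * v.1 + b * w.1) = v.1 + (b / a) * w.1 by field.
have -> : a^-1 * (a * v.2 + b * w.2) = v.2 + (b / a) * w.2 by field.
under eq_cvg do rewrite (iter_mobius _ _ la0 D E F).
apply: proj_point_cvg => //.
rewrite -(mulr0 (b / a)); apply: (@cvgMl_tmp C); apply: cvg_expc.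
rewrite normrc -[1]/((1 : R)%:C%C) ltcR normcM normcV ltr_pdivrMr ?mul1r //.
by apply: le_lt_trans lamu; exact: normc_ge0.
Qed.

Lemma loxodromic_eigen (A : SL2 C) la v w : 1 < normc la -> cross v w != 0 ->
  eigenpair A la v -> eigenpair A la^-1 w -> loxodromic (PSL2_class A).
Proof.
move=> la1 D E F; have [] := cross_neq0 D;
  rewrite {1}[v]surjective_pairing {1}[w]surjective_pairing => v0 w0.
have la0 : la != 0 by apply: contraTneq la1 => ->; rewrite normc0 ltr10.
have V1 : normc la^-1 < normc la.
  by rewrite normcV; apply: lt_trans (la1); rewrite invf_lt1 // (lt_trans ltr01 la1).
exists (proj_point v.1 v.2), (proj_point w.1 w.2); split.
- by move/(proj_point_eq v0 w0) => H; move/eqP: D; apply; rewrite /cross H; ring.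
- move=> z; split=> [|[]->]; last 2 first.
  + exact: eigenpair_fixed E.
  + by apply: eigenpair_fixed F; rewrite ?invr_eq0.
  (* A fixed point with coordinate k = b / a satisfies k = k la^-2 with la^-2 different from 1, so k
     = 0 and the point is v; for a = 0 it is w. *)
  move=> zfix; have [x [y [xy zE]]] := proj_point_surj z.
  have [a [b [/= xE yE]]] := @cross_coord v w (x, y) D.
  have [a0|a0] := eqVneq a 0.
    right; rewrite zE; apply/(proj_point_eq xy w0).
    by rewrite xE yE a0; ring.
  left; rewrite zE; apply/(proj_point_eq xy v0).
  have aV0 := invr_neq0 a0.
  have H (k : C) : (v.1 + k * w.1, v.2 + k * w.2) != (0, 0).
    rewrite xpair_eqE; apply: contra D => /andP[/eqP H1 /eqP H2]; apply/eqP.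
    have -> : cross v w = (v.1 + k * w.1) * w.2 - (v.2 + k * w.2) * w.1.
      by rewrite /cross; ring.
    by rewrite H1 H2; ring.
  move: zfix; rewrite zE xE yE -(proj_pointZ _ _ aV0).
  have -> : a^-1 * (a * v.1 + b * w.1) = v.1 + (b / a) * w.1 by field.
  have -> : a^-1 * (a * v.2 + b * w.2) = v.2 + (b / a) * w.2 by field.
  have /= -> := @iter_mobius A la la^-1 v w (b / a) 1 la0 D E F.
  move/(proj_point_eq (H _) (H _)) => G.
  have {}G : (b / a) * (1 - la^-1 / la) * cross v w = 0.
    move/eqP: G; rewrite -subr_eq0 => /eqP <-; rewrite /cross; ring.
  have l2 : la^-1 / la != 1.
    apply: contraTneq V1 => r1; rewrite -leNgt.
    by rewrite (_ : la^-1 = la) //; apply: (mulIf (invr_neq0 la0)); rewrite r1 mulfV.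
  move/eqP: G; rewrite mulf_eq0 (negbTE D) orbF mulf_eq0 subr_eq0 [1 == _]eq_sym
    (negbTE l2) orbF.
  by rewrite mulf_eq0 (negbTE aV0) orbF => /eqP ->; ring.
- exact: attracting_eigen D E F V1.
(* The inverse has eigenvalue la on w and la^-1 on v, so w attracts for it. *)
- rewrite /repelling -[(_ ^-1)%g]/(PSL2_inv _) PSL2_invE.
  have D' : cross w v != 0 by rewrite /cross -oppr_eq0; apply: contra D => /eqP D;
    apply/eqP; rewrite -D /cross; ring.
  apply: (attracting_eigen la0 D' _ (eigenpair_inv la0 E) V1).
  by rewrite -[la]invrK; apply: eigenpair_inv => //; rewrite invr_eq0.
Qed.
End Mobius.

(** * Elementary representations *)

Section Elementary.
Variable R : realType.
Local Notation C := R[i].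
Local Notation CP1 := (one_point_compactification C^o).
Implicit Types A B : SL2 C.

(** The case p = q is included and stands for a common fixed point. *)
Definition preserves_pair (p q : CP1) (g : PSL2 C) : Prop :=
  (mobius g p = p /\ mobius g q = q) \/ (mobius g p = q /\ mobius g q = p).

Lemma multiplicative1 (G H : groupType) (f : {multiplicative G -> H}) : f 1%g = 1%g.
Proof. by apply: (mulgI (f 1%g)); rewrite -gmulfM !mulg1. Qed.

Lemma multiplicativeV (G H : groupType) (f : {multiplicative G -> H}) x :
  f x^-1%g = (f x)^-1%g.
Proof. by apply: (mulgI (f x)); rewrite -gmulfM !mulgV multiplicative1. Qed.

(** The elements g with [P (rho g)] form a subgroup. Since [generates] quantifies over boolean
    predicates, [P] is passed through its reflection. *)
Lemma generates_ind (G H : groupType) (rho : {multiplicative G -> H}) (a b : G)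
    (P : H -> Prop) : generates a b -> P 1%g -> (forall x y, P x -> P y -> P (x / y)%g) ->
  P (rho a) -> P (rho b) -> forall g, P (rho g).
Proof.
move=> gen P1 PV Pa Pb g.
suff : g \in [pred g | `[< P (rho g) >]] by move/asboolP.
apply: gen; [|exact/asboolP..].
split=> [|x y]; first by apply/asboolP; rewrite multiplicative1.
by move=> /asboolP Px /asboolP Py; apply/asboolP; rewrite gmulfM multiplicativeV;
  exact: PV.
Qed.

Lemma preserves_pair_elementary (G : groupType) (rho : {multiplicative G -> PSL2 C})
    (a b : G) p q : generates a b ->
  preserves_pair p q (rho a) -> preserves_pair p q (rho b) -> elementary rho.
Proof.
move=> gen Ha Hb; right; exists p.
suff H g : preserves_pair p q (rho g).
  apply: (@sub_finite_set _ _ [set p; q]); last exact: finite_set2.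
  by move=> _ [g _ <-]; case: (H g) => -[-> _]; [left|right].
apply: (generates_ind gen) => //; first by left; rewrite !mobius1.
have inv f u v : mobius f u = v -> mobius f^-1%g v = u.
  by move=> <-; rewrite mobius_invK.
by move=> x y [] [x1 x2] [] [/inv y1 /inv y2]; [left|right|right|left];
  rewrite !mobiusM ?y1 ?y2.
Qed.

(* A positive definite Hermitian form stands for the point of H^3 fixed by its unitary
   group: Q = (|z|^2 + t^2, z; z^*, 1) corresponds to z + t j. *)
Definition adjointmx (A : 'M[C]_2) : 'M[C]_2 := map_mx conjc A^T.

Definition posdef (Q : 'M[C]_2) : Prop :=
  [/\ adjointmx Q = Q, 0 < Q 1 1 & 0 < \det Q].

(** One lift is enough: the sign of A cancels between A and its adjoint. *)
Definition preserves_form (Q : 'M[C]_2) (g : PSL2 C) : Prop :=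
  exists2 A : SL2 C, g = PSL2_class A & A *m Q *m adjointmx A = Q.

Lemma adjointmxM (A B : 'M[C]_2) : adjointmx (A *m B) = adjointmx B *m adjointmx A.
Proof. by rewrite /adjointmx trmx_mul map_mxM. Qed.

Lemma ord2_1 : lift ord0 ord0 = 1 :> 'I_2.
Proof. exact/val_inj. Qed.

(** After division by [Q 1 1] the off-diagonal entry is z and the determinant is d, the squared
    height of the point. Entry (1, 1) of the invariance equation says that the denominator of the
    Poincare extension is 1, entry (0, 1) that its numerator is z. *)
Lemma posdef_fixed (Q : 'M[C]_2) : posdef Q ->
  exists2 x, H3 x & forall g, preserves_form Q g -> poincare g x = x.
Proof.
move=> [Qh Q1 Qd].
have Q10 : Q 1 1 != 0 by rewrite gt_eqF.
have Qc i j : conjc (Q i j) = Q j i.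
  by move/matrixP: Qh => /(_ j i); rewrite !mxE.
set z := Q 0 1 / Q 1 1.
have [d [d0 dE]] : exists d : R, 0 < d /\ \det Q / Q 1 1 ^+ 2 = (d%:C)%C.
  have : 0 < \det Q / Q 1 1 ^+ 2 by rewrite divr_gt0 ?exprn_gt0.
  by case: (_ / _) => d d'; rewrite ltcE /= => /andP[/eqP -> ?]; exists d.
exists (z, Num.sqrt d); first by rewrite /H3 /= sqrtr_gt0.
move=> _ [A -> AQ]; rewrite poincareE.
have /matrixP AQ' := AQ.
have := AQ' 0 1; have := AQ' 1 1.
rewrite !mxE !big_ord_recl !big_ord0 /= !mxE !big_ord_recl !big_ord0 /= !ord2_1 !addr0.
rewrite /poincare_mx sqr_sqrtr ?ltW //.
move: (A 0 0) (A 0 1) (A 1 0) (A 1 1) => a b c e E11 E01.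
have zc : (z^*)%C = Q 1 0 / Q 1 1 by rewrite /z rmorphM /= conjc_inv !Qc.
have Q00 : Q 0 0 / Q 1 1 = z * (z^*)%C + (d%:C)%C.
  by rewrite zc -dE det_mx22 /z; field.
have csqE (u : C) : ((csqnorm u)%:C)%C = u * (u^*)%C.
  case: u => x y; apply/eqP; rewrite eq_complex /csqnorm /=; apply/andP; split;
    apply/eqP; ring.
have Q01' : Q 0 1 = z * Q 1 1 by rewrite /z; field.
have Q10' : Q 1 0 = (z^*)%C * Q 1 1 by rewrite zc; field.
have Q00' : Q 0 0 = (z * (z^*)%C + (d%:C)%C) * Q 1 1 by rewrite -Q00; field.
have D1 : csqnorm (c * z + e) + csqnorm c * d = 1.
  apply: (@complexI R); rewrite rmorphD rmorphM /= !csqE rmorphD rmorphM /=.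
  apply: (mulIf Q10); rewrite rmorph1 mul1r -[RHS]E11.
  by rewrite -!/(Q 0 _) Q00' Q01' Q10'; ring.
rewrite D1 rmorph1 !divr1; congr pair.
rewrite rmorphD rmorphM /=.
apply: (mulIf Q10); rewrite -Q01' -[RHS]E01 Q00' Q01' Q10'; ring.
Qed.

Lemma preserves_form_elementary (G : groupType) (rho : {multiplicative G -> PSL2 C})
    (a b : G) Q : generates a b -> posdef Q ->
  preserves_form Q (rho a) -> preserves_form Q (rho b) -> elementary rho.
Proof.
move=> gen Qp Ha Hb; left; have [x x0 Hx] := posdef_fixed Qp; exists x => //.
apply: (@sub_finite_set _ _ [set x]); last exact: finite_set1.
move=> _ [g _ <-] /=; apply: Hx.
apply: (generates_ind gen) => //.
  exists 1%g => //=; rewrite mul1mx.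
  by rewrite /adjointmx trmx1 map_mx1 mulmx1.
move=> _ _ [A -> QA] [B -> QB]; exists (A / B)%g.
  by rewrite -[(_ / _)%g]/(PSL2_mul _ (PSL2_inv _)) PSL2_invE PSL2_mulE.
(* Writing the inner Q as B Q adj(B) lets both inverses of B cancel. *)
rewrite -[SL2mx (A / B)%g]/(SL2mx A *m invmx B) adjointmxM -!mulmxA -{1}QB !mulmxA
  mulmxKV ?SL2_unitmx //.
rewrite -[in LHS](mulmxA (A *m Q)) -adjointmxM mulVmx ?SL2_unitmx //.
by rewrite [adjointmx 1%:M]/adjointmx trmx1 map_mx1 mulmx1.
Qed.
End Elementary.

(** * Traces *)

Section Traces.
Variable R : realType.
Local Notation C := R[i].
Implicit Types A B : SL2 C.

(** The complement of the loxodromic elements: elliptic, parabolic and plus or minus the identity.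
    It does not depend on the lift. *)
Definition small_trace A : Prop :=
  exists2 t : R, \tr (A : 'M_2) = (t%:C)%C & -2 <= t <= 2.

Lemma mxtrace2 (A : 'M[C]_2) : \tr A = A 0 0 + A 1 1.
Proof. by rewrite /mxtrace !big_ord_recl big_ord0 addr0 ord2_1. Qed.

Lemma mxtrace2M (A B : 'M[C]_2) : \tr (A *m B) =
  A 0 0 * B 0 0 + A 0 1 * B 1 0 + (A 1 0 * B 0 1 + A 1 1 * B 1 1).
Proof. by rewrite mxtrace2 !mxE !big_ord_recl !big_ord0 !addr0 !ord2_1. Qed.

Lemma SL2_det22 A : A 0 0 * A 1 1 - A 0 1 * A 1 0 = 1.
Proof. by rewrite -det_mx22 (eqP (SL2_det A)). Qed.

Lemma mx2P (A B : 'M[C]_2) : A 0 0 = B 0 0 -> A 0 1 = B 0 1 -> A 1 0 = B 1 0 ->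
  A 1 1 = B 1 1 -> A = B.
Proof.
move=> h1 h2 h3 h4; apply/matrixP => i j.
have E (k : 'I_2) : k = 0 \/ k = 1.
  by case: k => [[|[|//]] H]; [left|right]; exact/val_inj.
by case: (E i) => ->; case: (E j) => ->.
Qed.

(** Cayley-Hamilton for determinant 1. *)
Lemma SL2_invE A : (A^-1)%g = (\tr (A : 'M_2))%:M - (A : 'M_2) :> 'M_2.
Proof.
rewrite -[LHS]mulmx1.
suff -> : 1%:M = A *m ((\tr (A : 'M_2))%:M - (A : 'M_2)) by rewrite mulmxA mulVmx
  ?SL2_unitmx ?mul1mx.
have := SL2_det22 A; rewrite mxtrace2 => D.
apply: mx2P; rewrite !mxE !big_ord_recl !big_ord0 !mxE /= ?ord2_1 -?D /=; ring.
Qed.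

Lemma trace_invM A B : \tr ((A^-1)%g *m B) =
  \tr (A : 'M_2) * \tr (B : 'M_2) - \tr ((A : 'M_2) *m B).
Proof. by rewrite SL2_invE mulmxBl mul_scalar_mx linearB /= mxtraceZ. Qed.

Lemma trace_BAB A B : \tr ((B : 'M_2) *m A *m B) =
  \tr ((A : 'M_2) *m B) * \tr (B : 'M_2) - \tr (A : 'M_2).
Proof.
have := SL2_det22 B; rewrite -mulmxA mxtrace_mulC -mulmxA !mxtrace2M !mxtrace2 !mxE.
rewrite !big_ord_recl !big_ord0 !ord2_1 /=; move: (B 0 0) (B 0 1) (B 1 0) (B 1 1) =>
  a b c d D.
move: (A 0 0) (A 0 1) (A 1 0) (A 1 1) => p q r s.
rewrite -[p + s]mul1r -D; ring.
Qed.

(** The vectors (b, mu - a) and (mu - d, c) are annihilated by the first and the second row of A -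
    mu, and by the other row since mu is a root. If both are zero, A is the scalar mu. *)
Lemma eigenvector_exists (A : SL2 C) mu : mu ^+ 2 - \tr (A : 'M_2) * mu + 1 = 0 ->
  exists2 u, u != (0, 0) & eigenpair A mu u.
Proof.
rewrite mxtrace2 /eigenpair; have := SL2_det22 A.
move: (A 0 0) (A 0 1) (A 1 0) (A 1 1) => a b c d D ch.
have {}ch : (mu - a) * (mu - d) = b * c.
  by apply/eqP; rewrite -subr_eq0 -ch -D; apply/eqP; ring.
have [/eqP|H] := boolP ((b, mu - a) == (0, 0)); last first.
  by exists (b, mu - a) => //=; split; rewrite ?[c * b]mulrC -?ch; ring.
case=> b0 /eqP; rewrite subr_eq0 => /eqP mua.
have [/eqP|H] := boolP ((mu - d, c) == (0, 0)); last first.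
  by exists (mu - d, c) => //=; split; rewrite ?b0 ?mua; ring.
case=> /eqP; rewrite subr_eq0 => /eqP mud c0.
exists (1, 0); first by rewrite xpair_eqE oner_eq0.
by rewrite /= b0 c0 mua; split; ring.
Qed.

(** If v and w were proportional, the tensors of Av with w and of v with Aw would agree, giving (la
    - mu) v_i w_j = 0 for all i and j. *)
Lemma eigenvectors_free (A : SL2 C) (la mu : C) (v w : C * C) :
  la != mu -> v != (0, 0) -> w != (0, 0) ->
  eigenpair A la v -> eigenpair A mu w -> cross v w != 0.
Proof.
case: v w => [v1 v2] [w1 w2]; rewrite /eigenpair /cross !xpair_eqE !negb_and /=.
move: (A 0 0) (A 0 1) (A 1 0) (A 1 1) => a b c d lamu v0 w0 [E1 E2] [F1 F2].
apply/negP; rewrite subr_eq0 => /eqP W.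
have lm : la - mu != 0 by rewrite subr_eq0.
have H1 : v1 * w1 = 0.
  apply: (mulfI lm); rewrite mulr0 mulrBl [la * _]mulrA -E1 [mu * _]mulrCA -F1.
  by transitivity (b * (v2 * w1 - v1 * w2)); [ring|rewrite W; ring].
have H2 : v2 * w2 = 0.
  apply: (mulfI lm); rewrite mulr0 mulrBl [la * _]mulrA -E2 [mu * _]mulrCA -F2.
  by transitivity (c * (v1 * w2 - v2 * w1)); [ring|rewrite W; ring].
have H3 : v1 * w2 = 0.
  apply: (mulfI lm); rewrite mulr0 mulrBl [la * _]mulrA -E1 W [mu * _]mulrCA -F1.
  by transitivity (a * (v1 * w2 - v2 * w1)); [ring|rewrite W; ring].
have H4 : v2 * w1 = 0 by rewrite -W H3.
have nz (x y : C) : x != 0 -> y != 0 -> x * y = 0 -> False.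
  by move=> x0 y0 /eqP; rewrite mulf_eq0 (negbTE x0) (negbTE y0).
case/orP: v0 => n1; case/orP: w0 => n2;
  [exact: nz H1|exact: nz H3|exact: nz H4|exact: nz H2].
Qed.

Lemma trace_root (A : SL2 C) (mu : C) : mu ^+ 2 - \tr (A : 'M_2) * mu + 1 = 0 ->
  mu != 0 /\ \tr (A : 'M_2) = mu + mu^-1.
Proof.
move: (\tr _) => t H; have m0 : mu != 0.
  by apply: contra_eq_neq H => ->; rewrite expr0n mulr0 subrr add0r oner_neq0.
split=> //; apply: (mulfI m0); rewrite mulrDr mulfV //.
by apply/eqP; rewrite -subr_eq0 -oppr_eq0 -[X in _ == X]H; apply/eqP; ring.
Qed.

Lemma trace_root_exists (A : SL2 C) : exists mu, mu ^+ 2 - \tr (A : 'M_2) * mu + 1 = 0.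
Proof.
move: (\tr _) => t; exists ((t + sqrtc (t ^+ 2 - 4)) / 2).
have := sqr_sqrtc (t ^+ 2 - 4); move: (sqrtc _) => u uE.
by transitivity ((u ^+ 2 - (t ^+ 2 - 4)) / 4); [field|rewrite uE subrr mul0r].
Qed.

(** The eigenvalues are mu and its inverse. Off the unit circle one of them has modulus above 1; on
    it the inverse is the conjugate, and the trace is twice the real part of mu. *)
Lemma trace_dichotomy (A : SL2 C) : small_trace A \/
  exists la v w, [/\ 1 < normc la, cross v w != 0, eigenpair A la v & eigenpair A la^-1
    w].
Proof.
have [mu H] := trace_root_exists A; have [m0 tE] := trace_root H.
have H' : mu^-1 ^+ 2 - \tr (A : 'M_2) * mu^-1 + 1 = 0.
  by rewrite tE; field.
have [v v0 Ev] := eigenvector_exists H; have [w w0 Ew] := eigenvector_exists H'.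
have n0 : 0 < normc mu by rewrite -ltcR -normrc normr_gt0.
have ne (x : C) : normc x != normc x^-1 -> x != x^-1 by apply: contraNneq => <-.
have [n1|n1|n1] := ltgtP (normc mu) 1.
- right; exists mu^-1, w, v; rewrite invrK normcV invf_gt1 //; split=> //.
  apply: (@eigenvectors_free A mu^-1 mu) => //; rewrite eq_sym; apply: ne.
  by rewrite normcV lt_eqF // (lt_trans n1) // invf_gt1.
- right; exists mu, v, w; split=> //.
  apply: (@eigenvectors_free A mu mu^-1) => //; apply: ne.
  by rewrite normcV gt_eqF // (lt_trans _ n1) // invf_lt1.
- left; exists (complex.Re mu *+ 2).
    rewrite tE invc_norm normrc n1 rmorph1 expr1n invr1 mul1r.
    by case: (mu) => x y; apply/eqP; rewrite eq_complex /= mulr2n subrr !eqxx.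
  have := normc_ge_Re mu; rewrite normrc n1 lecR ler_norml => /andP[]; lra.
Qed.

Lemma lox_of_large_trace (A : SL2 C) : ~ small_trace A -> loxodromic (PSL2_class A).
Proof.
by case: (trace_dichotomy A) => // -[la [v [w [H1 H2 H3 H4]]]] _;
  exact: loxodromic_eigen H3 H4.
Qed.

End Traces.

(** * Traces of [B^n A], and the Markov moves on triples of traces *)

Section Nielsen.
Variable R : realType.
Local Notation C := R[i].
Implicit Types A B : SL2 C.

Definition apply2 (A : 'M[C]_2) (u : C * C) : C * C :=
  (A 0 0 * u.1 + A 0 1 * u.2, A 1 0 * u.1 + A 1 1 * u.2).

Lemma apply2M (A B : 'M[C]_2) u : apply2 (A *m B) u = apply2 A (apply2 B u).
Proof.
by rewrite /apply2 !mxE !big_ord_recl !big_ord0 !ord2_1 /=; congr pair; ring.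
Qed.

Lemma cross_apply2 A u w : cross (apply2 A u) (apply2 A w) = cross u w.
Proof.
have := SL2_det22 A; rewrite /cross /apply2 /=.
move: (A 0 0) (A 0 1) (A 1 0) (A 1 1) => a b c d D.
by rewrite -[RHS]mul1r -D; ring.
Qed.

(** A acts as a derivation on the exterior square by its trace. This reads off a trace in any basis
    v, w. *)
Lemma cross_trace (A : 'M[C]_2) v w :
  cross (apply2 A v) w + cross v (apply2 A w) = \tr A * cross v w.
Proof. by rewrite mxtrace2 /cross /apply2 /=; ring. Qed.

Lemma eigenpair_apply2 (A : 'M[C]_2) la v : eigenpair A la v ->
  apply2 A v = (la * v.1, la * v.2).
Proof. by case=> E F; rewrite /apply2 E F. Qed.

(** B preserves [cross] and scales w by la^-1. *)
Lemma cross_eigenr B (la : C) w u : la != 0 -> eigenpair B la^-1 w ->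
  cross (apply2 B u) w = la * cross u w.
Proof.
move=> la0 F; have := cross_apply2 B u w; rewrite (eigenpair_apply2 F) => <-.
by rewrite /cross /=; field.
Qed.

Lemma cross_eigenl B (la : C) v u : la != 0 -> eigenpair B la v ->
  cross v (apply2 B u) = la^-1 * cross v u.
Proof.
move=> la0 E; have := cross_apply2 B v u; rewrite (eigenpair_apply2 E) => <-.
by rewrite /cross /=; field.
Qed.

(** In an eigenbasis of B this is tr (B^n A) = la^n a + la^-n d, with a and d the diagonal entries
    of A, multiplied by [cross v w] to avoid quotients. *)
Lemma trace_powM (A B : SL2 C) (la : C) v w n : la != 0 ->
  eigenpair B la v -> eigenpair B la^-1 w ->
  \tr ((B ^+ n)%g *m A) * cross v w =
  la ^+ n * cross (apply2 A v) w + la ^- n * cross v (apply2 A w).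
Proof.
move=> la0 E F.
have Hv u := cross_eigenr u la0 F; have Hw u := cross_eigenl u la0 E.
rewrite -cross_trace; congr (_ + _); elim: n => [|n IH].
- by rewrite expg0 expr0 mul1r mul1mx.
- by rewrite expgS /= -mulmxA apply2M Hv IH exprS mulrA.
- by rewrite expg0 expr0 invr1 mul1r mul1mx.
- by rewrite expgS /= -mulmxA apply2M Hw IH exprS invfM mulrA.
Qed.

Lemma expr_unbounded (x M : R) : 1 < x -> exists n, M < x ^+ n.
Proof.
move=> x1; have x0 : 0 < x by exact: lt_trans x1.
have : x^-1 ^+ n @[n --> \oo] --> (0 : R).
  by apply: cvg_expr; rewrite ger0_norm ?invr_ge0 ?ltW // invf_lt1.
have M1 : 0 < (Num.max M 1)^-1 by rewrite invr_gt0 lt_max ltr01 orbT.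
move=> /cvgr0Pnorm_lt/(_ _ M1) [n _ /(_ n (leqnn n))] /=.
rewrite ger0_norm ?exprn_ge0 ?invr_ge0 ?ltW // exprVn ltf_pV2 ?posrE ?exprn_gt0 //.
  by rewrite gt_max => /andP[Mn _]; exists n.
by rewrite lt_max ltr01 orbT.
Qed.

Lemma normcX (x : C) n : normc (x ^+ n) = normc x ^+ n.
Proof. by elim: n => [|n IH]; rewrite ?normc1 // !exprS normcM IH. Qed.

Lemma large_trace_powM (A B : SL2 C) (la : C) v w : 1 < normc la -> cross v w != 0 ->
  eigenpair B la v -> eigenpair B la^-1 w -> cross (apply2 A v) w != 0 ->
  exists n, ~ small_trace (B ^+ n * A)%g.
Proof.
move=> la1 D E F N.
have la0 : la != 0 by apply: contraTneq la1 => ->; rewrite normc0 ltr10.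
set W := normc (cross v w); set a := normc (cross (apply2 A v) w).
set d := normc (cross v (apply2 A w)).
have a0 : 0 < a by rewrite -ltcR -normrc normr_gt0.
(* A trace t in [-2, 2] would give |la|^n a <= |t| W + d <= 2 W + d, because |la^-n| <= 1; n is
   chosen to violate this. *)
have [n Hn] := expr_unbounded ((2 * W + d) / a) la1; exists n => -[t tE tb].
have := trace_powM A n la0 E F; rewrite -[_ *m _]/(SL2mx (B ^+ n * A)%g) tE.
set x := la ^+ n * _; set y := la ^- n * _ => H.
have nx : normc x = normc la ^+ n * a by rewrite /x normcM normcX.
have ny : normc y <= d.
  rewrite /y normcM; apply: ler_piMl; first exact: normc_ge0.
  rewrite normcV normcX -exprVn; apply: exprn_ile1; first by rewrite invr_ge0 normc_ge0.
  by rewrite invf_le1 ?ltW // (lt_trans _ la1).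
have : normc x <= normc ((t%:C)%C * cross v w) + normc y.
  by rewrite H -{1}[x](addrK y) -(normcN y); exact: le_normcD.
rewrite nx normcM -/W => H2.
have : normc ((t%:C)%C) <= 2.
  by rewrite /= expr0n addr0 sqrtr_sqr ler_norml; lra.
move=> t2; move: Hn; rewrite ltr_pdivrMr // ltNge => /negP; apply.
apply: (le_trans H2); apply: lerD => //; apply: ler_wpM2r t2; exact: normc_ge0.
Qed.


(* In terms of x = tr A, y = tr B, z = tr AB this is the trace of the commutator. *)
Definition markov (x y z : R) : R := x ^+ 2 + y ^+ 2 + z ^+ 2 - x * y * z - 2.

(* For |x| >= |y| >= |z| the product of y - z and y - (x y - z), with the sign of
   y chosen such that x y >= 0, is y^2 (2 - |x|) - (kappa + 2 - x^2) <= - d. *)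
Lemma markov_step_sorted (x y z d : R) : 0 < d -> `|x| <= 2 -> `|y| <= `|x| ->
  `|z| <= `|y| ->
  2 + d <= markov x y z -> `|z| + d / 4 <= `|x * y - z|.
Proof.
rewrite /markov => d0 x2 yx zy k.
(* Changing the signs of two variables preserves [markov] and all absolute values. *)
wlog x0 : x y z x2 yx zy k / 0 <= x => [H|].
  have [x0|x0] := leP 0 x; first exact: H.
  have -> : `|x * y - z| = `|- x * y - - z| by rewrite -normrN; congr `|_|; ring.
  rewrite -(normrN z); apply: H; rewrite ?normrN ?oppr_ge0 //; [lra|exact: ltW].
wlog y0 : y z yx zy k / 0 <= y => [H|].
  have [y0|y0] := leP 0 y; first exact: H.
  have -> : `|x * y - z| = `|x * - y - - z| by rewrite -normrN; congr `|_|; ring.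
  rewrite -(normrN z); apply: H; rewrite ?normrN ?oppr_ge0 //; [lra|exact: ltW].
rewrite (ger0_norm x0) (ger0_norm y0) in x2 yx zy *.
move: zy; rewrite ler_norml => /andP[z1 z2].
have P : (y - z) * (x * y - z - y) >= d.
  have -> : (y - z) * (x * y - z - y) = (x ^+ 2 + y ^+ 2 + z ^+ 2 - x * y * z - 4) + (4
    - x ^+ 2) - y ^+ 2 * (2 - x) by ring.
  have : y ^+ 2 * (2 - x) <= x ^+ 2 * (2 - x).
    by apply: ler_wpM2r; [lra|rewrite !expr2; apply: ler_pM].
  (* The polynomial is 4 - x^2 - x^2 (2 - x), what remains after y^2 is bounded by x^2. *)
  have : 0 <= (2 - x) * ((2 - x) * (x + 1)) by apply: mulr_ge0; [lra|apply: mulr_ge0;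
    lra].
  lra.
have yz : 0 <= y - z by lra.
have yz4 : y - z <= 4 by lra.
(* The factor y - z lies in [0, 4], so the other factor of a product of at least d is at least d /
   4. *)
have Q : d / 4 <= x * y - z - y.
  rewrite leNgt; apply/negP => Q.
  have yz0 : 0 < y - z by rewrite lt_neqAle yz andbT; apply: contraTneq P => <-;
    rewrite mul0r -ltNge.
  have : (y - z) * (x * y - z - y) < (y - z) * (d / 4) by rewrite ltr_pM2l.
  have : (y - z) * (d / 4) <= 4 * (d / 4) by apply: ler_wpM2r => //; lra.
  lra.
have := ler_norm (x * y - z); have : `|z| <= y by rewrite ler_norml z1.
lra.
Qed.

(** By the symmetry of [markov], the variable of smallest absolute value can take the last place of
    the sorted case. *)
Lemma markov_step (x y z d : R) : 0 < d -> `|x| <= 2 -> `|y| <= 2 -> `|z| <= 2 ->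
  2 + d <= markov x y z ->
  [\/ `|z| + d / 4 <= `|x * y - z|, `|y| + d / 4 <= `|x * z - y| |
      `|x| + d / 4 <= `|y * z - x| ].
Proof.
move=> d0 x2 y2 z2 k.
have s u v w : `|u| <= 2 -> markov u v w = markov x y z -> `|v| <= `|u| -> `|w| <= `|v| ->
  `|w| + d / 4 <= `|u * v - w|.
  by move=> u2 E vu wv; apply: markov_step_sorted => //; rewrite E.
have e1 : markov x z y = markov x y z by rewrite /markov; ring.
have e2 : markov y x z = markov x y z by rewrite /markov; ring.
have e3 : markov y z x = markov x y z by rewrite /markov; ring.
have e4 : markov z x y = markov x y z by rewrite /markov; ring.
have e5 : markov z y x = markov x y z by rewrite /markov; ring.
have [yx|/ltW yx] := leP `|y| `|x|; have [zy|/ltW zy] := leP `|z| `|y|;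
  have [zx|/ltW zx] := leP `|z| `|x|.
- by constructor 1; apply: s.
- by constructor 1; apply: s.
- by constructor 2; apply: s.
- by constructor 2; rewrite [x * z]mulrC; apply: s.
- by constructor 1; rewrite [x * y]mulrC; apply: s.
- by constructor 3; apply: s.
- by constructor 3; rewrite [y * z]mulrC; apply: s.
- by constructor 3; rewrite [y * z]mulrC; apply: s.
Qed.

End Nielsen.

(** * Characters with values in [-2, 2] *)

Section SmallCharacters.
Variable R : realType.
Local Notation C := R[i].
Implicit Types A B : SL2 C.

Definition common_pair A B : Prop :=
  exists p q, preserves_pair p q (PSL2_class A) /\ preserves_pair p q (PSL2_class B).

Definition common_form A B : Prop :=
  exists2 Q, posdef Q & preserves_form Q (PSL2_class A) /\ preserves_form Q (PSL2_class
    B).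

Lemma mobius_cross A (u w : C * C) : u != (0, 0) -> w != (0, 0) ->
  cross w (apply2 A u) = 0 ->
  mobius (PSL2_class A) (proj_point u.1 u.2) = proj_point w.1 w.2.
Proof.
case: u w => [u1 u2] [w1 w2] u0 w0 /eqP; rewrite /cross subr_eq0 => /eqP W.
rewrite mobiusE mobius_mx_proj ?SL2_det_neq0 //; apply/proj_point_eq => //.
  by apply: proj_point_neq0 => //; exact: SL2_det_neq0.
by move: W; rewrite /apply2 /= => W; rewrite [RHS]W mulrC.
Qed.

Lemma common_eigenvector A B (u : C * C) : u != (0, 0) ->
  cross u (apply2 A u) = 0 -> cross u (apply2 B u) = 0 -> common_pair A B.
Proof.
move=> u0 UA UB; exists (proj_point u.1 u.2), (proj_point u.1 u.2).
by split; left; split; exact: mobius_cross.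
Qed.

(** The two vanishing terms are the diagonal entries of A in an eigenbasis of B, so A exchanges the
    two lines that B fixes. *)
Lemma common_pair_swap A B (la : C) v w : la != 0 -> cross v w != 0 ->
  eigenpair B la v -> eigenpair B la^-1 w ->
  cross (apply2 A v) w = 0 -> cross v (apply2 A w) = 0 -> common_pair A B.
Proof.
move=> la0 D E F Av Aw; have [v0 w0] := cross_neq0 D.
exists (proj_point v.1 v.2), (proj_point w.1 w.2); split; [right|left]; split.
- apply: mobius_cross => //; move/eqP: Av; rewrite /cross subr_eq0 => /eqP Av.
  by rewrite mulrC -Av; ring.
- by apply: mobius_cross.
- by apply: mobius_cross => //; rewrite (eigenpair_apply2 E) /cross /=; ring.
- by apply: mobius_cross => //; rewrite (eigenpair_apply2 F) /cross /=; ring.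
Qed.

(** Here A = m + N with N^2 = 0 and tr (N B) = 0. If N is nonzero, its image equals its kernel, and
    tr (N B) = 0 says that B preserves this line; if N = 0, any eigenvector of B is common. *)
Lemma common_pair_parabolic A B (m : C) : m ^+ 2 = 1 -> \tr (A : 'M_2) = m *+ 2 ->
  \tr ((A : 'M_2) *m B) = m * \tr (B : 'M_2) -> common_pair A B.
Proof.
move=> m2 tA tAB; have m0 : m != 0 by apply: contra_eq_neq m2 => ->;
  rewrite expr0n eq_sym oner_neq0.
have [[a10 a01 n0]|N] := pselect [/\ A 1 0 = 0, A 0 1 = 0 & A 0 0 - m = 0].
  have [mu /eigenvector_exists[u u0 Bu]] := trace_root_exists B.
  apply: (common_eigenvector u0); last by rewrite (eigenpair_apply2 Bu) /cross /=; ring.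
  move: tA; rewrite mxtrace2 /cross /apply2 a10 a01 /= => tA.
  have a00 : A 0 0 = m by apply/eqP; rewrite -subr_eq0 n0.
  have -> : A 1 1 = (A 0 0 + A 1 1) - A 0 0 by ring.
  by rewrite tA a00; ring.
have := SL2_det22 A; move: tA tAB N; rewrite mxtrace2M !mxtrace2 /common_pair.
set n := A 0 0 - m => tA tAB N D.
have aE : A 0 0 = m + n by rewrite /n; ring.
have dE : A 1 1 = m - n.
  have -> : A 1 1 = (A 0 0 + A 1 1) - A 0 0 by ring.
  by rewrite tA aE; ring.
have N2 : n ^+ 2 + A 0 1 * A 1 0 = 0.
  transitivity (m ^+ 2 - (A 0 0 * A 1 1 - A 0 1 * A 1 0)); last by rewrite m2 D subrr.
  by rewrite aE dE; ring.
have T : n * B 0 0 + A 0 1 * B 1 0 + A 1 0 * B 0 1 - n * B 1 1 = 0.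
  transitivity (A 0 0 * B 0 0 + A 0 1 * B 1 0 + (A 1 0 * B 0 1 + A 1 1 * B 1 1)
    - m * (B 0 0 + B 1 1)); last by rewrite tAB subrr.
  by rewrite aE dE; ring.
(* The first column of N spans the image of N unless it vanishes; then (1, 0) does. *)
have [/eqP|u0] := boolP ((n, A 1 0) == (0, 0)); last first.
  apply: (common_eigenvector u0); rewrite /cross /apply2 /=.
    rewrite aE dE; transitivity (- A 1 0 * (n ^+ 2 + A 0 1 * A 1 0)); first ring.
    by rewrite N2 mulr0.
  transitivity (B 1 0 * (n ^+ 2 + A 0 1 * A 1 0) - A 1 0 * (n * B 0 0 + A 0 1 * B 1 0 +
    A 1 0 * B 0 1 - n * B 1 1)).
    by ring.
  by rewrite N2 T !mulr0 subrr.
case=> n0 c0; apply: (@common_eigenvector _ _ (1, 0)).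
- by rewrite xpair_eqE oner_eq0.
- by rewrite /cross /apply2 /= c0; ring.
- have b0 : A 0 1 != 0 by apply/eqP => b0; apply: N.
  apply: (mulfI b0); rewrite mulr0 -[RHS]T n0 c0 /cross /apply2 /=; ring.
Qed.

Definition mx2 (a b c d : C) : 'M[C]_2 :=
  \matrix_(i, j) if i == 0 then (if j == 0 then a else b) else (if j == 0 then c else d).

Lemma mulmx_mx2 (a b c d p q r s : C) : mx2 a b c d *m mx2 p q r s =
  mx2 (a * p + b * r) (a * q + b * s) (c * p + d * r) (c * q + d * s).
Proof. by apply: mx2P; rewrite !mxE !big_ord_recl !big_ord0 !ord2_1 !mxE /= addr0. Qed.

Lemma mx2E (A : 'M[C]_2) : A = mx2 (A 0 0) (A 0 1) (A 1 0) (A 1 1).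
Proof. by apply: mx2P; rewrite !mxE. Qed.

Lemma adjointmx_mx2 (a b c d : C) :
  adjointmx (mx2 a b c d) = mx2 (conjc a) (conjc c) (conjc b) (conjc d).
Proof. by apply: mx2P; rewrite !mxE. Qed.

Lemma adjointmxK (A : 'M[C]_2) : adjointmx (adjointmx A) = A.
Proof. by apply/matrixP => i j; rewrite !mxE conjcK. Qed.

Lemma det_mx2 (a b c d : C) : \det (mx2 a b c d) = a * d - b * c.
Proof. by rewrite det_mx22 !mxE. Qed.

Lemma conj_form (P D : 'M[C]_2) : adjointmx D = D ->
  forall A B' : 'M[C]_2, A *m P = P *m B' -> B' *m D *m adjointmx B' = D ->
  A *m (P *m D *m adjointmx P) *m adjointmx A = P *m D *m adjointmx P.
Proof.
move=> Dh A B' AP BD.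
transitivity ((A *m P) *m D *m adjointmx (A *m P)).
  by rewrite (adjointmxM A P) !mulmxA.
by rewrite AP (adjointmxM P B') -[in RHS]BD !mulmxA.
Qed.

Lemma posdef_conj (P : 'M[C]_2) (al de : C) : \det P != 0 -> 0 < al -> 0 < de ->
  posdef (P *m mx2 al 0 0 de *m adjointmx P).
Proof.
move=> P0 al0 de0.
have cr (u : C) : 0 < u -> conjc u = u.
  by case: u => x y; rewrite ltcE /= => /andP[/eqP-> _]; rewrite oppr0.
have Dh : adjointmx (mx2 al 0 0 de) = mx2 al 0 0 de.
  by rewrite adjointmx_mx2 conjc0 !cr.
split.
- by rewrite !adjointmxM adjointmxK Dh mulmxA.
- rewrite [P]mx2E adjointmx_mx2 !mulmx_mx2 mxE /= !mulr0 addr0 add0r.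
  rewrite ![_ * al]mulrC ![_ * de]mulrC -!mulrA -!sqr_normc.
  have [p0|p0] := eqVneq (P 1 0) 0.
    apply: ltr_wpDl; first by rewrite mulr_ge0 // ?exprn_ge0 // ltW.
    rewrite mulr_gt0 // exprn_gt0 // normr_gt0; apply: contra P0 => /eqP p1.
    by rewrite det_mx22 p0 p1 !mulr0 subrr.
  apply: ltr_wpDr; first by rewrite mulr_ge0 // ?exprn_ge0 // ltW.
  by rewrite mulr_gt0 // exprn_gt0 // normr_gt0.
- rewrite !det_mulmx det_mx2 mulr0 subr0.
  have -> : \det (adjointmx P) = conjc (\det P).
    by rewrite /adjointmx det_map_mx det_tr.
  rewrite mulrAC -sqr_normc; apply: mulr_gt0; last exact: mulr_gt0.
  by rewrite exprn_gt0 // normr_gt0.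
Qed.

(* In a basis diagonalizing A, the matrix of B is (p q; r s) with s = conj p, and
   diag (|q|^2, - q r) is preserved. *)
Lemma common_form_elliptic A B (x y z : R) : `|x| < 2 ->
  \tr (A : 'M_2) = (x%:C)%C -> \tr (B : 'M_2) = (y%:C)%C ->
  \tr ((A : 'M_2) *m B) = (z%:C)%C -> markov x y z <= 2 ->
  common_pair A B \/ common_form A B.
Proof.
move=> x2 tA tB tAB k.
(* The eigenvalues of A are x / 2 + i e and its conjugate, on the unit circle and not real. *)
pose e := Num.sqrt (4 - x ^+ 2) / 2.
have x4 : 0 < 4 - x ^+ 2.
  by have := x2; rewrite ltr_norml => /andP[? ?]; nra.
have e0 : 0 < e by rewrite divr_gt0 // sqrtr_gt0.
have e2 : e ^+ 2 = (4 - x ^+ 2) / 4 by rewrite expr_div_n sqr_sqrtr ?ltW //; field.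
pose la : C := Complex (x / 2) e.
have laM : la * conjc la = 1.
  apply/eqP; rewrite eq_complex /=; apply/andP; split; apply/eqP; last by ring.
  have -> : x / 2 * (x / 2) - e * - e = x ^+ 2 / 4 + e ^+ 2 by field.
  by rewrite e2; field.
have la0 : la != 0 by apply: contra_eq_neq laM => ->; rewrite mul0r eq_sym oner_neq0.
have laV : la^-1 = conjc la by apply: (mulfI la0); rewrite laM mulfV.
have laD : la + conjc la = (x%:C)%C.
  by apply/eqP; rewrite eq_complex /= subrr eqxx andbT; apply/eqP; field.
have lane : la != la^-1.
  by rewrite laV eq_complex /= eqxx /= -subr_eq0 opprK gt_eqF // addr_gt0.
clearbody la.
have root : la ^+ 2 - \tr (A : 'M_2) * la + 1 = 0.
  by rewrite tA -laD -laM; ring.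
have root' : la^-1 ^+ 2 - \tr (A : 'M_2) * la^-1 + 1 = 0.
  by rewrite tA -laD laV -laM; ring.
have [v v0 Ev] := eigenvector_exists root; have [w w0 Ew] := eigenvector_exists root'.
have W := eigenvectors_free lane v0 w0 Ev Ew.
have Av := eigenpair_apply2 Ev; have Aw := eigenpair_apply2 Ew.
have Avv : cross v (apply2 A v) = 0 by rewrite Av /cross /=; ring.
have Aww : cross w (apply2 A w) = 0 by rewrite Aw /cross /=; ring.
have [Bv|Bv] := eqVneq (cross v (apply2 B v)) 0.
  by left; exact: (common_eigenvector v0).
have [Bw|Bw] := eqVneq (cross w (apply2 B w)) 0.
  by left; exact: (common_eigenvector w0).
right.
pose p := cross (apply2 B v) w / cross v w; pose q := - cross w (apply2 B w) / cross v w.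
pose r := cross v (apply2 B v) / cross v w; pose s := cross v (apply2 B w) / cross v w.
have q0 : q != 0 by apply: mulf_neq0; rewrite ?oppr_eq0 ?invr_eq0.
have r0 : r != 0 by apply: mulf_neq0; rewrite ?invr_eq0.
have psy : p + s = (y%:C)%C.
  by rewrite -tB -mulrDl cross_trace mulfK.
have psz : la * p + conjc la * s = (z%:C)%C.
  rewrite -tAB -laV; apply: (mulIf W); rewrite -cross_trace !apply2M.
  rewrite (cross_eigenr _ la0 Ew) (cross_eigenl _ la0 Ev) mulrDl.
  by rewrite -[la * p * _]mulrA -[la^-1 * s * _]mulrA !divfK.
pose P := mx2 v.1 w.1 v.2 w.2; pose B' := mx2 p q r s.
have detP : \det P = cross v w by rewrite det_mx2 [w.1 * _]mulrC.
have BP : B *m P = P *m B'.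
  have [v1 v2] := cross_decomp (apply2 B v) W;
    have [w1 w2] := cross_decomp (apply2 B w) W.
  have qE : q = cross (apply2 B w) w / cross v w.
    by rewrite /q; congr (_ / _); rewrite /cross; ring.
  rewrite [SL2mx B]mx2E !mulmx_mx2; congr mx2.
  - by rewrite -[LHS]/(apply2 B v).1 v1 -/p -/r; ring.
  - by rewrite -[LHS]/(apply2 B w).1 w1 -qE -/s; ring.
  - by rewrite -[LHS]/(apply2 B v).2 v2 -/p -/r; ring.
  - by rewrite -[LHS]/(apply2 B w).2 w2 -qE -/s; ring.
have AP : A *m P = P *m mx2 la 0 0 la^-1.
  rewrite [SL2mx A]mx2E !mulmx_mx2; case: Ev Ew => [E1 E2] [F1 F2].
  by rewrite E1 E2 F1 F2; congr mx2; ring.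
have psqr : p * s - q * r = 1.
  have /(congr1 determinant) := BP;
    rewrite !det_mulmx (eqP (SL2_det B)) mul1r detP det_mx2.
  by move/esym; rewrite -[RHS]mulr1 => /(mulfI W).
(* Both p + s and la p + conj(la) s are real; comparison with their conjugates gives (la - conj la)
   (s - conj p) = 0. *)
have sp : s = conjc p.
  have E1 : conjc p + conjc s = p + s by rewrite -rmorphD /= psy conjc_real.
  have E2 : conjc la * conjc p + la * conjc s = la * p + conjc la * s.
    by have := congr1 conjc psz; rewrite conjc_real rmorphD !rmorphM /= conjcK psz.
  have cs : conjc s = p + s - conjc p by rewrite -E1; ring.
  have : (la - la^-1) * (s - conjc p) = 0.
    rewrite laV -[RHS](subrr (la * p + conjc la * s)) -{1}E2 cs; ring.
  move/eqP; rewrite mulf_eq0 subr_eq0 (negbTE lane) /= subr_eq0.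
  by move/eqP.
(* The trace of the commutator in the eigenbasis of A, with 4 - x^2 = - (la - la^-1)^2. Since q r is
   not 0, kappa <= 2 makes it negative, which is what makes the invariant form definite. *)
have k2 : q * r * (4 - x ^+ 2)%:C%C = (markov x y z - 2)%:C%C.
  have -> : q * r = p * s - 1 by rewrite -psqr; ring.
  have xE : (x%:C)%C = la + la^-1 by rewrite -laD laV.
  have yE : (y%:C)%C = p + s by rewrite psy.
  have zE : (z%:C)%C = la * p + la^-1 * s by rewrite -psz laV.
  rewrite /markov !(rmorph_nat, rmorphB, rmorphD, rmorphM, rmorphXn) /= xE yE zE.
  by field.
have qr0 : 0 < - (q * r).
  have qr : q * r != 0 by rewrite mulf_neq0.
  have qrE : q * r = ((markov x y z - 2) / (4 - x ^+ 2))%:C%C.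
    have x4C : (4 - x ^+ 2)%:C%C != 0 :> C by rewrite eq_complex /= eqxx andbT gt_eqF.
    by apply: (mulIf x4C); rewrite k2 -rmorphM /= divfK ?gt_eqF.
  move: qr; rewrite qrE -rmorphN /= eq_complex /= eqxx andbT => qr.
  rewrite ltcE /= eqxx /= oppr_gt0 lt_neqAle qr.
  by rewrite pmulr_lle0 ?invr_gt0 // subr_le0.
pose al := q * conjc q; pose de := - (q * r).
have sqr : conjc (q * r) = q * r.
  have -> : q * r = p * s - 1 by rewrite -psqr; ring.
  by rewrite rmorphB rmorphM rmorph1 /= sp conjcK mulrC.
have Dh : adjointmx (mx2 al 0 0 de) = mx2 al 0 0 de.
  by rewrite adjointmx_mx2 conjc0 /al /de rmorphN /= sqr rmorphM /= conjcK mulrC.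
exists (P *m mx2 al 0 0 de *m adjointmx P).
  apply: posdef_conj => //; first by rewrite detP.
  by rewrite /al -sqr_normc exprn_gt0 // normr_gt0.
have lD : mx2 la 0 0 la^-1 *m mx2 al 0 0 de *m adjointmx (mx2 la 0 0 la^-1) =
    mx2 al 0 0 de.
  rewrite adjointmx_mx2 !mulmx_mx2 conjc0 laV conjcK; congr mx2; try ring.
    by rewrite -[RHS]mul1r -laM; ring.
  by rewrite -[RHS]mul1r -laM; ring.
have BD : B' *m mx2 al 0 0 de *m adjointmx B' = mx2 al 0 0 de.
  have ps : p * conjc p = 1 + q * r by rewrite -sp -psqr; ring.
  have rq : conjc q * conjc r = q * r by rewrite -rmorphM.
  rewrite adjointmx_mx2 !mulmx_mx2 sp conjcK /al /de; congr mx2.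
  - transitivity (q * conjc q * (p * conjc p - q * r)); first ring.
    by rewrite ps; ring.
  - transitivity (p * q * (conjc q * conjc r - q * r)); first ring.
    by rewrite rq; ring.
  - transitivity (conjc p * conjc q * (q * r) - conjc p * conjc q * (q * r)); first ring.
    by rewrite subrr.
  - transitivity ((q * r) * (conjc q * conjc r) - (q * r) * (p * conjc p)); first ring.
    by rewrite rq ps; ring.
by split; [exact: (ex_intro2 _ _ A erefl (conj_form Dh AP lD))|
  exact: (ex_intro2 _ _ B erefl (conj_form Dh BP BD))].
Qed.
End SmallCharacters.

(** * Loxodromic pairs in a class of matrix pairs closed under Nielsen moves *)

Section NielsenMoves.
Variable R : realType.
Local Notation C := R[i].
Implicit Types A B : SL2 C.

Lemma crossC (v w : C * C) : cross v w = - cross w v.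
Proof. by rewrite /cross; ring. Qed.

Lemma small_character A B (x y z : R) : `|x| <= 2 ->
  \tr (A : 'M_2) = (x%:C)%C -> \tr (B : 'M_2) = (y%:C)%C ->
  \tr ((A : 'M_2) *m B) = (z%:C)%C -> markov x y z <= 2 ->
  common_pair A B \/ common_form A B.
Proof.
move=> x2 tA tB tAB k; have [xlt|xge] := ltP `|x| 2;
  first exact: common_form_elliptic tAB k.
left; have [m [m2 xE]] : exists m : R, m ^+ 2 = 1 /\ x = m *+ 2.
  have : `|x| = 2 by apply/le_anti; rewrite x2.
  by have [x0|x0] := leP 0 x; rewrite ?(ger0_norm x0) ?(ltr0_norm x0) => h;
    [exists 1|exists (-1)];
    split; rewrite ?sqrrN ?expr1n // mulr2n; lra.
(* For x = 2 m with m^2 = 1, kappa - 2 is the square (z - m y)^2, so kappa <= 2 makes it vanish. *)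
have zE : z = m * y.
  apply/eqP; rewrite -subr_eq0 -sqrf_eq0; apply/eqP/le_anti; rewrite sqr_ge0 andbT.
  have -> : (z - m * y) ^+ 2 = markov x y z - 2 - (m ^+ 2 - 1) * (4 - y ^+ 2).
    by rewrite /markov xE; ring.
  by rewrite m2 subrr mul0r subr0 subr_le0.
apply: (@common_pair_parabolic _ A B (m%:C)%C).
- by rewrite -rmorphXn /= m2.
- by rewrite tA xE rmorphMn.
- by rewrite tAB zE tB rmorphM.
Qed.

Section Moves.
(** In the application, [P A B] says that A and B lift the images under rho of some marked pair. *)
Variable P : SL2 C -> SL2 C -> Prop.
Hypothesis P_swap : forall A B, P A B -> P B A.
Hypothesis P_inv : forall A B, P A B -> P A^-1%g B.
Hypothesis P_mul : forall A B, P A B -> P (B * A)%g B.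
Hypothesis P_ne : forall A B, P A B -> ~ common_pair A B /\ ~ common_form A B.

Lemma P_mulV A B : P A B -> P (B^-1 * A)%g B.
Proof. by move=> /P_swap/P_inv/P_swap/P_mul/P_swap/P_inv/P_swap; rewrite invgK. Qed.

Lemma P_mulX A B n : P A B -> P (B ^+ n * A)%g B.
Proof. by move=> AB; elim: n => [|n IH]; rewrite ?expg0 ?mul1g // expgS -mulgA;
  exact: P_mul. Qed.

Lemma P_mulVX A B n : P A B -> P (B^-1 ^+ n * A)%g B.
Proof. by move=> AB; elim: n => [|n IH]; rewrite ?expg0 ?mul1g // expgS -mulgA;
  exact: P_mulV. Qed.

Lemma loxodromic_pair_of_one A B : P A B -> ~ small_trace B ->
  exists A' B', [/\ P A' B', ~ small_trace A' & ~ small_trace B'].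
Proof.
move=> AB nB; have [//|[la [v [w [la1 D E F]]]]] := trace_dichotomy B.
have la0 : la != 0 by apply: contraTneq la1 => ->; rewrite normc0 ltr10.
have [Av|Av] := eqVneq (cross (apply2 A v) w) 0; last first.
  have [n Hn] := large_trace_powM la1 D E F Av.
  by exists (B ^+ n * A)%g, B; split=> //; exact: P_mulX.
have [Aw|Aw] := eqVneq (cross v (apply2 A w)) 0.
  by have [np _] := P_ne AB; case: np; exact: (common_pair_swap la0 D E F Av Aw).
(* Only the coefficient of la^-n is nonzero: pass to the inverse of B, which exchanges the roles of
   v and w. *)
have D' : cross w v != 0.
  by rewrite crossC oppr_eq0.
have E' : eigenpair (B^-1)%g la w.
  by rewrite -[la]invrK; apply: eigenpair_inv => //; exact: invr_neq0.
have F' := eigenpair_inv la0 E.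
have Aw' : cross (apply2 A w) v != 0.
  by rewrite crossC oppr_eq0.
have [n Hn] := large_trace_powM la1 D' E' F' Aw'.
by exists (B^-1 ^+ n * A)%g, B; split=> //; exact: P_mulVX.
Qed.

Lemma small_triple A B : (forall A B, P A B -> small_trace B) -> P A B ->
  exists x y z : R, [/\ \tr (A : 'M_2) = (x%:C)%C, \tr (B : 'M_2) = (y%:C)%C,
    \tr ((A : 'M_2) *m B) = (z%:C)%C & [/\ `|x| <= 2, `|y| <= 2 & `|z| <= 2]].
Proof.
move=> small AB; have [x xE xb] := small _ _ (P_swap AB).
have [y yE yb] := small _ _ AB; have [z zE zb] := small _ _ (P_swap (P_mul AB)).
exists x, y, z; split=> //; first by rewrite mxtrace_mulC.
by rewrite !ler_norml.
Qed.

Theorem loxodromic_pair_exists A0 B0 : P A0 B0 ->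
  exists A B, [/\ P A B, ~ small_trace A & ~ small_trace B].
Proof.
move=> AB0; have [small|] := pselect (forall A B, P A B -> small_trace B); last first.
  move=> /existsNP[A /existsNP[B /not_implyP[AB nB]]].
  exact: loxodromic_pair_of_one AB nB.
exfalso; have [x0 [y0 [z0 [tA0 tB0 tAB0 [x02 y02 z02]]]]] := small_triple small AB0.
have [k|k] := leP (markov x0 y0 z0) 2.
  by have [n1 n2] := P_ne AB0; case: (small_character x02 tA0 tB0 tAB0 k).
pose d := markov x0 y0 z0 - 2; have d0 : 0 < d by rewrite subr_gt0.
(* Every Markov move comes from a Nielsen move and adds at least d / 4 to |x| + |y| + |z|, a sum
   that is at most 6 as long as all traces are small. *)
have : forall n, exists A B (x y z : R), [/\ P A B, \tr (A : 'M_2) = (x%:C)%C,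
    \tr (B : 'M_2) = (y%:C)%C, \tr ((A : 'M_2) *m B) = (z%:C)%C &
    markov x y z = markov x0 y0 z0 /\ d / 4 *+ n <= `|x| + `|y| + `|z| ].
  elim=> [|n [A [B [x [y [z [AB tA tB tAB [k' H]]]]]]]].
    by exists A0, B0, x0, y0, z0; split=> //; split=> //; rewrite mulr0n !addr_ge0.
  have [x' [y' [z' [tA' tB' tAB' [x2 y2 z2]]]]] := small_triple small AB.
  have ? : x' = x by apply: (@complexI R); rewrite -tA'.
  have ? : y' = y by apply: (@complexI R); rewrite -tB'.
  have ? : z' = z by apply: (@complexI R); rewrite -tAB'.
  subst x' y' z'.
  have dk : 2 + d <= markov x y z by rewrite k' /d; lra.
  have [S|S|S] := markov_step d0 x2 y2 z2 dk; rewrite mulrS.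
  (* The three replacements are tr (A^-1 B) = x y - z, tr (A B A) = x z - y and tr (B A B) = y z -
     x. *)
  - exists (A^-1)%g, B, x, y, (x * y - z); split; [exact: P_inv| |by []| |].
    + by rewrite SL2_invE linearB /= mxtrace_scalar tA mulr2n addrK.
    + by rewrite trace_invM tA tB tAB rmorphB rmorphM.
    + by split; [rewrite -k' /markov; ring|lra].
  - exists (A * B)%g, A, z, x, (x * z - y); split; [exact/P_mul/P_swap|by []|by []| |].
    + by rewrite /= trace_BAB mxtrace_mulC tAB tA tB rmorphB rmorphM /= mulrC.
    + by split; [rewrite -k' /markov; ring|lra].
  - exists (B * A)%g, B, z, y, (y * z - x); split;
    [exact/P_mul|by rewrite mxtrace_mulC|by []| |].
    + by rewrite /= trace_BAB tAB tA tB rmorphB rmorphM /= mulrC.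
    + by split; [rewrite -k' /markov; ring|lra].
move=> H; have [n Hn] : exists n : nat, 6 / (d / 4) < n%:R.
  by eexists; apply: archi_boundP; rewrite !divr_ge0 // ltW.
have [A [B [x [y [z [AB tA tB tAB [_ Hs]]]]]]] := H n.
have [x' [y' [z' [tA' tB' tAB' [x2 y2 z2]]]]] := small_triple small AB.
have ? : x' = x by apply: (@complexI R); rewrite -tA'.
have ? : y' = y by apply: (@complexI R); rewrite -tB'.
have ? : z' = z by apply: (@complexI R); rewrite -tAB'.
subst x' y' z'.
move: Hn; rewrite ltr_pdivrMr ?divr_gt0 // mulrC mulr_natr; lra.
Qed.
End Moves.
End NielsenMoves.

(** * The circle in turns *)

Section Circle.
Variable R : realType.
Implicit Types x y : R.

(* Angles are measured in turns, so that the covering group of the circle is Z. *)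
Definition turn x : R * R := (cos (2 * pi * x), sin (2 * pi * x)).

Lemma turn_circle x : circle (turn x).
Proof. exact: cos2Dsin2. Qed.

Lemma turn0 : turn 0 = (1, 0).
Proof. by rewrite /turn mulr0 cos0 sin0. Qed.

Lemma turnN x : turn (- x) = ((turn x).1, - (turn x).2).
Proof. by rewrite /turn mulrN cosN sinN. Qed.

Definition cmul (u v : R * R) : R * R :=
  (u.1 * v.1 - u.2 * v.2, u.1 * v.2 + u.2 * v.1).

Lemma cmulr1 u : cmul u (1, 0) = u.
Proof. by case: u => a b; rewrite /cmul /= !mulr1 !mulr0 subr0 add0r. Qed.

Lemma turnD x y : turn (x + y) = cmul (turn x) (turn y).
Proof. by rewrite /turn /cmul mulrDr cosD sinD /=; congr pair; exact: addrC. Qed.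

Lemma turn1 : turn 1 = (1, 0).
Proof. by rewrite /turn mulr1 mulr_natl cos2pi sin2pi. Qed.

Lemma turnDn x (n : nat) : turn (x + n%:R) = turn x.
Proof.
elim: n => [|n IH]; first by rewrite addr0.
by rewrite -natr1 addrA turnD turn1 cmulr1.
Qed.

Lemma turnDz x (k : int) : turn (x + k%:~R) = turn x.
Proof.
case: k => n; first exact: turnDn.
by rewrite NegzE mulrNz -(turnDn (x - _) n.+1) subrK.
Qed.

Lemma cos_turn_ge0 x (k : int) : `|x - k%:~R| <= 4^-1 -> 0 <= (turn x).1.
Proof.
rewrite -(turnDz x (- k)) mulrNz; move: (x - _) => y.
rewrite ler_norml /turn /= => /andP[y1 y2]; apply: cos_ge0_pihalf.
have := pi_gt0 R => p0; apply/andP; split; nra.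
Qed.

Lemma cos_turn_le0 x : 4^-1 <= x <= 3 / 4 -> (turn x).1 <= 0.
Proof.
move=> /andP[x1 x2]; rewrite -oppr_ge0 /turn /= -cosDpi.
have -> : 2 * pi * x + pi = 2 * pi * (x + 2^-1) by field.
by apply: (@cos_turn_ge0 _ 1); rewrite ler_norml; apply/andP; split; lra.
Qed.

Lemma sin_turn_ge0 x : 0 <= x <= 2^-1 -> 0 <= (turn x).2.
Proof.
move=> /andP[x1 x2]; rewrite /turn /=; apply: sin_ge0_pi.
have := pi_gt0 R => p0; apply/andP; split; nra.
Qed.

Lemma sin_turn_le0 x : 2^-1 <= x <= 1 -> (turn x).2 <= 0.
Proof.
move=> /andP[x1 x2]; rewrite -(turnDz x (-1)).
have -> : x + (-1)%:~R = - (1 - x) by rewrite mulrNz; lra.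
rewrite turnN /= oppr_le0; apply: sin_turn_ge0; apply/andP; split; lra.
Qed.

Lemma turn_near x : 0 <= (turn x).1 -> exists k : int, `|x - k%:~R| <= 4^-1.
Proof.
move=> c0; pose k := Num.floor (x + 2^-1).
have /andP[k1 k2] : k%:~R <= x + 2^-1 < k%:~R + 1.
  by have := floor_itv (x + 2^-1); rewrite intrD.
exists k; rewrite leNgt; apply/negP => K; move: c0; apply/negP; rewrite -ltNge.
rewrite -(turnDz x (- k)) mulrNz.
have : `|x - k%:~R| <= 2^-1 by rewrite ler_norml; apply/andP; split; lra.
move: (x - k%:~R) K => y y4 y2.
rewrite /turn /= -cos_norm normrM ger0_norm ?mulr_ge0 ?pi_ge0 //.
rewrite -(cos_pihalf R) ltr_cos ?in_itv /=; have := pi_gt0 R => p0.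
- nra.
- by apply/andP; split; nra.
- by apply/andP; split; nra.
Qed.

Lemma unif_continuous_segment (f : R -> R) (a b e : R) : continuous f -> 0 < e ->
  exists2 d, 0 < d & forall s t, a <= s <= b -> `|s - t| < d -> `|f s - f t| < e.
Proof.
move=> cf e0.
have := @segment_compact R a b => /compact_near_coveringP.
move=> /(_ R (0^'+) (fun d s => forall t, `|s - t| < d -> `|f s - f t| < e) _) H.
have {H}/H [d /= d0 Hd] : forall x, (`[a, b]%classic : set R) x ->
  \forall x' \near x & i \near 0^'+,
    forall t, `|x' - t| < i -> `|f x' - f t| < e.
  move=> x _; have e2 : 0 < e / 2 by rewrite divr_gt0.
  have /cvgrPdist_lt/(_ _ e2) := cf x.
  move=> /nbhs_ballP[r /= r0 Hr].
  have r2 : 0 < r / 2 by rewrite divr_gt0.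
  near=> x' i => t /= xt.
  have h1 : `|x - x'| < r / 2 by near: x'; exact: (@nbhsx_ballx R R^o).
  have h2 : i < r / 2 by near: i; exact: nbhs_right_lt.
  have := Hr x'; have := Hr t; rewrite /ball /= => Ht Hx'.
  have {}Hx' := Hx' (lt_trans h1 _); have {}Ht := Ht _.
  rewrite -(subrKA (f x)) (splitr e); apply: (le_lt_trans (ler_normD _ _)).
  rewrite distrC ltrD // ?Hx' ?Ht //; first lra.
  rewrite -(subrKA x'); apply: (le_lt_trans (ler_normD _ _)); lra.
exists (d / 2); first by rewrite divr_gt0.
move=> s t sab st; apply: (Hd (d / 2)) => //.
- by rewrite /= sub0r normrN ger0_norm ?divr_ge0 ?ltW //; lra.
- by rewrite divr_gt0.
Unshelve. all: by end_near. Qed.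

Definition cconj (u : R * R) : R * R := (u.1, - u.2).

Lemma circle_cmul u v : circle u -> circle v -> circle (cmul u v).
Proof.
case: u v => [a b] [c d]; rewrite /circle /cmul /= => u1 v1.
by transitivity ((a ^+ 2 + b ^+ 2) * (c ^+ 2 + d ^+ 2)); [ring|rewrite u1 v1 mulr1].
Qed.

Lemma circle_cconj u : circle u -> circle (cconj u).
Proof. by rewrite /circle /= sqrrN. Qed.

Lemma cmulA u v w : cmul u (cmul v w) = cmul (cmul u v) w.
Proof. by rewrite /cmul /=; congr pair; ring. Qed.

Lemma cmulC u v : cmul u v = cmul v u.
Proof. by rewrite /cmul /=; congr pair; ring. Qed.

Lemma cmulV u : circle u -> cmul (cconj u) u = (1, 0).
Proof. by case: u => a b; rewrite /circle /cmul /= => <-; congr pair; ring. Qed.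

Lemma cmulKV u v : circle u -> cmul (cmul v (cconj u)) u = v.
Proof. by move=> cu; rewrite -cmulA cmulV // cmulr1. Qed.

(** The branch of the argument, in turns, on the open right half circle, where the sine alone
    determines the angle. *)
Definition arg (z : R * R) : R := asin z.2 / (2 * pi).

Lemma turn_arg z : circle z -> 0 < z.1 -> turn (arg z) = z.
Proof.
case: z => a b; rewrite /circle /turn /arg /= => ab a0.
have -> : 2 * pi * (asin b / (2 * pi)) = asin b.
  by rewrite mulrC divfK // mulf_neq0 ?pnatr_eq0 // gt_eqF // pi_gt0.
have b1 : -1 <= b <= 1 by apply/andP; split; nra.
rewrite cos_asin // asinK ?in_itv //=.
by rewrite (_ : 1 - b ^+ 2 = a ^+ 2) ?sqrtr_sqr ?gtr0_norm // -ab; ring.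
Qed.

Lemma continuous_arg (T : topologicalType) (f g : T -> R) :
  continuous g -> (forall t, circle (f t, g t)) -> (forall t, 0 < f t) ->
  continuous (fun t => arg (f t, g t)).
Proof.
move=> cg cfg f0 t; apply: cvgMr_tmp; apply: (@continuous_comp _ _ _ g (@asin R)).
  exact: cg.
apply: continuous_asin; have := cfg t; rewrite /circle /= => E; have := f0 t.
by move=> ?; apply/andP; split; nra.
Qed.

Lemma continuous_clamp_real : continuous (@clamp_real R).
Proof.
move=> r; apply: continuous_max; first exact: cvg_cst.
by apply: continuous_min; [exact: cvg_cst | exact: cvg_id].
Qed.

(** The curve is cut so finely that the quotient of consecutive values lies in the right half
    circle; the lift is the sum of the arguments of these quotients, which telescope. *)
Lemma circle_lift (f g : R -> R) : continuous f -> continuous g ->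
  (forall t, circle (f t, g t)) -> (f 0, g 0) = (1, 0) ->
  exists2 th : R -> R, continuous th & th 0 = 0 /\
    forall t, 0 <= t <= 1 -> turn (th t) = (f t, g t).
Proof.
move=> cf cg cfg fg0.
have [d1 d10 H1] := unif_continuous_segment 0 1 cf ltr01.
have [d2 d20 H2] := unif_continuous_segment 0 1 cg ltr01.
have [N HN] : exists N : nat, (Num.min d1 d2)^-1 < N%:R.
  by eexists; apply: archi_boundP; rewrite invr_ge0 le_min !ltW.
have N0 : 0 < N%:R :> R by apply: lt_trans HN; rewrite invr_gt0 lt_min d10.
have {HN} [HN1 HN2] : N%:R^-1 < d1 /\ N%:R^-1 < d2.
  apply/andP; rewrite -lt_min -[X in _ < X]invrK ltf_pV2 ?posrE // invr_gt0 lt_min d10 //.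
(* Time stopped at i / N: [m 0] is 0, and [m N] is the identity on [0, 1]. *)
pose m (i : nat) (t : R) := Num.min (clamp_real t) (i%:R / N%:R).
have cm i : continuous (m i).
  apply: continuous_min_comp; first exact: continuous_clamp_real.
  by move=> ?; exact: cvg_cst.
have m01 i t : 0 <= m i t <= 1.
  rewrite /m /clamp_real le_min le_max lexx /= divr_ge0 ?ler0n //=.
  by rewrite ge_min ge_max ler01 ge_min lexx.
have mm i t : `|m i.+1 t - m i t| <= N%:R^-1.
  have E : i.+1%:R / N%:R = i%:R / N%:R + N%:R^-1 :> R.
    by rewrite -[i.+1%:R]natr1 mulrDl mul1r.
  have N0' : 0 <= N%:R^-1 :> R by rewrite invr_ge0 ltW.
  rewrite /m E ler_norml /Num.min; do 2 case: ifPn; rewrite -?leNgt => *; lra.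
pose F i t := f (m i.+1 t) * f (m i t) + g (m i.+1 t) * g (m i t).
pose G i t := g (m i.+1 t) * f (m i t) - f (m i.+1 t) * g (m i t).
have FG i t : (F i t, G i t) = cmul (f (m i.+1 t), g (m i.+1 t)) (cconj (f (m i t), g
  (m i t))).
  by rewrite /cmul /F /G /=; congr pair; ring.
have cFG i t : circle (F i t, G i t).
  by rewrite FG; apply: circle_cmul => //; exact: circle_cconj.
(* F is 1 minus half the squared chord, and both coordinates of the chord are below 1 in absolute
   value. *)
have F0 i t : 0 < F i t.
  have := cfg (m i.+1 t); have := cfg (m i t); rewrite /circle /= => E1 E2.
  have h1 := H1 _ (m i t) (m01 i.+1 t) (le_lt_trans (mm i t) HN1).
  have h2 := H2 _ (m i t) (m01 i.+1 t) (le_lt_trans (mm i t) HN2).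
  rewrite /F; move: h1 h2 E1 E2; move: (f _) (f _) (g _) (g _) => a b c d.
  rewrite !ltr_norml => /andP[? ?] /andP[? ?] *; nra.
have cG i : continuous (G i).
  have cc (h : R -> R) j : continuous h -> continuous (h \o m j).
    by move=> ch t; apply: continuous_comp; [exact: cm|exact: ch].
  by move=> t; apply: cvgB; apply: cvgM; apply: (cc _ _ _ t).
pose th n t := \sum_(i < n) arg (F i t, G i t).
have thE n t : turn (th n t) = (f (m n t), g (m n t)).
  elim: n => [|n IH].
    rewrite /th big_ord0 turn0 /m mul0r (min_idPr _) ?fg0 //.
    by rewrite /clamp_real le_max lexx.
  rewrite /th big_ord_recr /= turnD -/(th n t) IH (turn_arg (cFG n t) (F0 n t)) FG cmulC.
  exact: cmulKV.
exists (th N).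
  elim: (N) => [|n IH] t.
    have -> : th 0%N = fun=> 0 by apply/funext => s; rewrite /th big_ord0.
    exact: cvg_cst.
  have -> : th n.+1 = fun s => th n s + arg (F n s, G n s).
    by apply/funext => s; rewrite /th big_ord_recr.
  by apply: cvgD; [exact: IH|exact: (continuous_arg (cG n) (cFG n) (F0 n))].
split.
  rewrite /th big1 // => i _; rewrite /arg /G /m /=.
  have -> : clamp_real (0 : R) = 0 by rewrite /clamp_real (min_idPr ler01) maxxx.
  have q0 (j : nat) : 0 <= j%:R / N%:R :> R by rewrite divr_ge0.
  by rewrite !(min_idPl (q0 _)) [g 0 * _]mulrC subrr -[X in asin X](sin0 R) sinK ?mul0r
    // in_itv /= oppr_le0 divr_ge0 ?pi_ge0.
move=> t /andP[t0 t1]; rewrite thE /m divff ?gt_eqF //.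
by rewrite /clamp_real (min_idPr t1) (max_idPr t0) (min_idPl t1).
Qed.

End Circle.

(** * Loops in the holed torus *)

Section PathHomotopy.
Variables (R : realType).
Local Notation I := (unit_interval R).

Lemma loop_homotopic_eq (S : topologicalType) (p : S) (f g : loop R p) :
  (forall t, f t = g t) -> loop_homotopic f g.
Proof.
move=> fg; have [H [cH H0 H1 Hz Ho]] := loop_homotopic_refl f.
by exists H; split=> // t; rewrite H1.
Qed.

Lemma loop_map_exists (S T : topologicalType) (p : S) (q : T) (k : S ->
  T) (f : loop R p) :
  continuous k -> k p = q -> exists g : loop R q, forall t, g t = k (f t).
Proof.
move=> ck kp.
have cg : continuous (k \o f).
  by move=> t; apply: continuous_comp; [exact: cts_fun|exact: ck].
have g0 : (k \o f) zero = q by rewrite /= path_zero.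
have g1 : (k \o f) one = q by rewrite /= path_one.
by exists (mk_path cg g0 g1).
Qed.

Lemma loop_map_homotopic (S T : topologicalType) (p : S) (q : T) (k : S -> T)
    (f f' : loop R p) (g g' : loop R q) : continuous k -> k p = q ->
  (forall t, g t = k (f t)) -> (forall t, g' t = k (f' t)) ->
  loop_homotopic f f' -> loop_homotopic g g'.
Proof.
move=> ck kp gE g'E [H [cH H0 H1 Hz Ho]]; exists (k \o H); split=> /= [|t|t|t|t].
- by move=> t; apply: continuous_comp; [exact: cH|exact: ck].
- by rewrite H0 gE.
- by rewrite H1 g'E.
- by rewrite Hz.
- by rewrite Ho.
Qed.

Lemma loop_map_ext (S T : topologicalType) (p : S) (q : T) (k : S -> T)
    (f : loop R p) (g : loop R q) : (forall t, g t = k (f t)) ->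
  forall r, loop_ext g r = k (loop_ext f r).
Proof. by move=> gE r; rewrite /loop_ext /= gE. Qed.

Lemma loop_map_concat (S T : topologicalType) (p : S) (q : T) (k : S -> T)
    (f f' : loop R p) (g g' : loop R q) :
  (forall t, g t = k (f t)) -> (forall t, g' t = k (f' t)) ->
  forall t, concat g g' t = k (concat f f' t).
Proof.
move=> gE g'E t; rewrite !concatE; case: ifP => _.
  exact: loop_map_ext.
exact: loop_map_ext.
Qed.

Lemma loop_map_rev (S T : topologicalType) (p : S) (q : T) (k : S -> T)
    (f : loop R p) (g : loop R q) :
  (forall t, g t = k (f t)) -> forall t, rev_loop g t = k (rev_loop f t).
Proof. by move=> gE t; rewrite !rev_loopE; exact: loop_map_ext. Qed.

End PathHomotopy.

Section HoledTorus.
Variable R : realType.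
Local Notation I := (unit_interval R).
Local Notation HT := (holed_torus R).
Local Notation P4 := ((R * R) * (R * R))%type.

Lemma base_subproof : (((1, 0), (1, 0)) : P4) \in @holed_torus_set R.
Proof.
rewrite inE; split; first by split; rewrite /circle /= expr1n expr0n addr0.
by left; rewrite /= ler01.
Qed.

Definition base : HT := SigSub base_subproof.

(* Outside of the holed torus, [to_ht] has the junk value [base]. *)
Definition to_ht (x : P4) : HT := insubd base x.

Lemma to_htK (x : P4) : holed_torus_set x -> set_val (to_ht x) = x.
Proof. by move=> Hx; rewrite set_valE /to_ht /= insubdK //; exact/mem_set. Qed.

Lemma set_valK (x : HT) : to_ht (set_val x) = x.
Proof. by apply/val_inj; rewrite -!set_valE to_htK //; exact: set_valP. Qed.

Lemma ht_inj (x y : HT) : set_val x = set_val y -> x = y.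
Proof. by rewrite set_valE => /val_inj. Qed.

Lemma continuous_ht_val : continuous (set_val : HT -> P4).
Proof. exact: initial_continuous. Qed.

Lemma continuous_to_ht (X : topologicalType) (F : X -> P4) :
  (forall x, holed_torus_set (F x)) -> continuous F -> continuous (fun x => to_ht (F x)).
Proof.
move=> HF cF; apply/continuousP => A [B oB <-].
rewrite -comp_preimage.
have -> : (set_val \o (fun x => to_ht (F x)) : X -> P4) = F.
  by apply/funext => x /=; rewrite to_htK.
by move/continuousP: cF; apply.
Qed.

(* [chart] restricts to a covering of the holed torus by the complement [good] of a
   lattice of open squares in the plane. *)
Definition good (x y : R) : Prop := 0 <= (turn x).1 \/ 0 <= (turn y).1.

Definition chart (x y : R) : HT := to_ht (turn x, turn y).

Lemma chart_set x y : good x y -> holed_torus_set (turn x, turn y).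
Proof. by move=> xy; split=> //; split; exact: turn_circle. Qed.

Lemma chart_val x y : good x y -> set_val (chart x y) = (turn x, turn y).
Proof. by move=> xy; rewrite /chart to_htK //; exact: chart_set. Qed.

Lemma chart00 : chart 0 0 = base.
Proof.
by apply: ht_inj; rewrite chart_val ?turn0 //; left; rewrite turn0 /= ler01.
Qed.

Lemma chartDz x y (m n : int) : chart (x + m%:~R) (y + n%:~R) = chart x y.
Proof. by rewrite /chart !turnDz. Qed.

Lemma chartz (m n : int) : chart m%:~R n%:~R = base.
Proof. by rewrite -chart00 -(chartDz 0 0 m n) !add0r. Qed.

Lemma continuous_turn (X : topologicalType) (u : X -> R) :
  continuous u -> continuous (fun x => turn (u x)).
Proof.
move=> cu x; have cu2 : continuous (fun x => 2 * pi * u x).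
  by move=> z; apply: cvgM; [exact: cvg_cst|exact: cu].
apply: (@cvg_pair _ _ _ _ (nbhs (turn (u x)).1) (nbhs (turn (u x)).2)).
  by apply: (@continuous_comp _ _ _ (fun x => 2 * pi * u x));
    [exact: cu2|exact: continuous_cos].
by apply: (@continuous_comp _ _ _ (fun x => 2 * pi * u x));
  [exact: cu2|exact: continuous_sin].
Qed.

Lemma continuous_pair (X Y Z : topologicalType) (f : X -> Y) (g : X -> Z) :
  continuous f -> continuous g -> continuous (fun x => (f x, g x)).
Proof.
move=> cf cg x.
by apply: (@cvg_pair _ _ _ _ (nbhs (f x)) (nbhs (g x))); [exact: cf|exact: cg].
Qed.

Lemma continuous_fst2 (X Y Z : topologicalType) (f : X -> Y * Z) :
  continuous f -> continuous (fun x => (f x).1).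
Proof.
by move=> ch x; apply: (@continuous_comp _ _ _ f fst); [exact: ch|exact: cvg_fst].
Qed.

Lemma continuous_snd2 (X Y Z : topologicalType) (f : X -> Y * Z) :
  continuous f -> continuous (fun x => (f x).2).
Proof.
by move=> ch x; apply: (@continuous_comp _ _ _ f snd); [exact: ch|exact: cvg_snd].
Qed.

Lemma continuous_chart (X : topologicalType) (u v : X -> R) :
  continuous u -> continuous v -> (forall x, good (u x) (v x)) ->
  continuous (fun x => chart (u x) (v x)).
Proof.
move=> cu cv H; apply: continuous_to_ht; first by move=> x; exact: chart_set.
by apply: continuous_pair; exact: continuous_turn.
Qed.

Lemma chart_loop_exists (u v : I -> R) : continuous u -> continuous v ->
  (forall t, good (u t) (v t)) -> chart (u zero) (v zero) = base ->
  chart (u one) (v one) = base ->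
  exists f : loop R base, forall t, f t = chart (u t) (v t).
Proof.
move=> cu cv H e0 e1.
by exists (mk_path (continuous_chart cu cv H) e0 e1).
Qed.

(** Straight-line homotopy of the lifts in the plane; the last hypothesis keeps it off the removed
    squares. *)
Lemma chart_loop_homotopic (u v u' v' : I -> R) (f g : loop R base) :
  continuous u -> continuous v -> continuous u' -> continuous v' ->
  (forall t, f t = chart (u t) (v t)) -> (forall t, g t = chart (u' t) (v' t)) ->
  u zero = u' zero -> v zero = v' zero -> u one = u' one -> v one = v' one ->
  (forall s t, 0 <= s <= 1 -> good (u t + s * (u' t - u t)) (v t + s * (v' t - v t))) ->
  loop_homotopic f g.
Proof.
move=> cu cv cu' cv' fE gE u0 v0 u1 v1 H.
pose h (w w' : I -> R) (x : I * I) := w x.1 + ucoord x.2 * (w' x.1 - w x.1).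
have ch w w' : continuous w -> continuous w' -> continuous (h w w').
  move=> cw cw'.
  have c1 (z : I -> R) : continuous z -> continuous (fun x : I * I => z x.1).
    move=> cz x; apply: (@continuous_comp _ _ _ fst z); first exact: cvg_fst.
    exact: cz.
  move=> x; apply: cvgD; first exact: c1.
  apply: cvgM; first exact: continuous_usnd.
  by apply: cvgB; exact: c1.
exists (fun x => chart (h u u' x) (h v v' x)); split=> [|t|t|s|s]; rewrite /h /=.
- apply: continuous_chart; [exact: ch..|] => x.
  by apply: H; rewrite ucoord_ge0 ucoord_le1.
- by rewrite ucoord0 !mul0r !addr0 fE.
- by rewrite ucoord1 !mul1r gE; congr chart; ring.
- by rewrite u0 v0 !subrr !mulr0 !addr0 -gE path_zero.
- by rewrite u1 v1 !subrr !mulr0 !addr0 -gE path_one.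
Qed.
End HoledTorus.

(** * Generation of the fundamental group *)

Section Generation.
Variable R : realType.
Local Notation I := (unit_interval R).
Local Notation HT := (holed_torus R).

Definition nearest (x : R) : int := Num.floor (x + 2^-1).

Lemma nearest_eq (x : R) (k : int) : `|x - k%:~R| < 2^-1 -> nearest x = k.
Proof.
rewrite ltr_norml => /andP[x1 x2]; apply: floor_def.
by rewrite intrD; apply/andP; split; lra.
Qed.

Lemma nearest_dist (x : R) : `|x - (nearest x)%:~R| <= 2^-1.
Proof.
have := floor_itv (x + 2^-1); rewrite -/(nearest x) intrD => /andP[x1 x2].
by rewrite ler_norml; apply/andP; split; lra.
Qed.

Lemma nearest_int (k : int) : nearest k%:~R = k.
Proof. by apply: nearest_eq; rewrite subrr normr0 invr_gt0. Qed.

Lemma clamp_real_le0 (r : R) : r <= 0 -> clamp_real r = 0.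
Proof. by move=> r0; rewrite /clamp_real (min_idPr (le_trans r0 ler01)) (max_idPl r0).
  Qed.

Lemma clamp_real_ge1 (r : R) : 1 <= r -> clamp_real r = 1.
Proof. by move=> r1; rewrite /clamp_real (min_idPl r1) (max_idPr ler01). Qed.

Lemma clamp_real_id (r : R) : 0 <= r <= 1 -> clamp_real r = r.
Proof. by move=> /andP[r0 r1]; rewrite /clamp_real (min_idPr r1) (max_idPr r0). Qed.

(* The polygonal path through X 0, ..., X n at the times 0, ..., n. *)
Definition pl (X : nat -> int) (n : nat) (r : R) : R :=
  (X 0%N)%:~R + \sum_(i < n) (X i.+1 - X i)%:~R * clamp_real (r - i%:R).

Lemma plS X n r : pl X n.+1 r = pl X n r + (X n.+1 - X n)%:~R * clamp_real (r - n%:R).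
Proof. by rewrite /pl big_ord_recr /= addrA. Qed.

Lemma pl_ge X n r : n%:R <= r -> pl X n r = (X n)%:~R.
Proof.
elim: n => [|n IH] nr; first by rewrite /pl big_ord0 addr0.
have nr' : n%:R + 1 <= r by rewrite natr1.
rewrite plS IH ?clamp_real_ge1 ?mulr1 -?intrD; [by rewrite addrC subrK|lra|lra].
Qed.

Lemma plS_le X n r : r <= n%:R -> pl X n.+1 r = pl X n r.
Proof. by move=> rn; rewrite plS clamp_real_le0 ?mulr0 ?addr0 // subr_le0. Qed.

Lemma plS_itv X n r : n%:R <= r <= n%:R + 1 ->
  pl X n.+1 r = (X n)%:~R + (X n.+1 - X n)%:~R * (r - n%:R).
Proof.
move=> /andP[r1 r2]; rewrite plS pl_ge // clamp_real_id //.
by apply/andP; split; lra.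
Qed.

Lemma pl_le0 X n r : r <= 0 -> pl X n r = (X 0%N)%:~R.
Proof.
elim: n => [|n IH] r0; first by rewrite /pl big_ord0 addr0.
by rewrite plS_le ?IH // (le_trans r0).
Qed.

Lemma pl_itv X n r j : (j < n)%N -> j%:R <= r <= j%:R + 1 ->
  pl X n r = (X j)%:~R + (X j.+1 - X j)%:~R * (r - j%:R).
Proof.
elim: n => // n IH; rewrite ltnS leq_eqVlt => /orP[/eqP->|jn] rj; first exact: plS_itv.
rewrite plS_le ?IH //; case/andP: rj => _; move/le_trans; apply.
by rewrite natr1 ler_nat.
Qed.

Lemma itv_nat (n : nat) (r : R) : 0 <= r <= n.+1%:R ->
  exists2 j, (j < n.+1)%N & j%:R <= r <= j%:R + 1.
Proof.
elim: n => [|n IH] /andP[r0 rn]; first by exists 0%N => //; rewrite r0 add0r.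
have [rn1|rn1] := leP r n.+1%:R.
  by have [|j jn rj] := IH; [rewrite r0|exists j => //; exact: ltnW].
by exists n.+1 => //; rewrite ltW //= natr1.
Qed.

Lemma continuous_pl X n : continuous (pl X n).
Proof.
elim: n => [|n IH].
  have -> : pl X 0 = fun=> (X 0%N)%:~R by apply/funext => r; rewrite /pl big_ord0 addr0.
  by move=> ?; exact: cvg_cst.
have -> : pl X n.+1 = fun r => pl X n r + (X n.+1 - X n)%:~R * clamp_real (r - n%:R).
  by apply/funext => r; rewrite plS.
have cc : continuous (fun r : R => clamp_real (r - n%:R)).
  move=> r; apply: (@continuous_comp R R R (fun r : R => r - n%:R) (@clamp_real R)).
    by apply: cvgB; [exact: cvg_id|exact: cvg_cst].
  exact: continuous_clamp_real.
move=> r; apply: cvgD; first exact: IH.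
by apply: cvgM; [exact: cvg_cst|exact: cc].
Qed.

Lemma continuous_lin_comb (X : topologicalType) (u v : X -> R) (a b : R) :
  continuous u -> continuous v -> continuous (fun x => a * u x + b * v x).
Proof.
move=> cu cv x; apply: cvgD; (apply: cvgM; first exact: cvg_cst); [exact: cu|exact: cv].
Qed.

Lemma continuous_cst (X : topologicalType) (a : R) : continuous (fun _ : X => a).
Proof. by move=> x; exact: cvg_cst. Qed.

Lemma loop_ext_chart (u v : R -> R) (F : loop R (base R)) :
  (forall t, F t = chart (u (ucoord t)) (v (ucoord t))) ->
  forall r, 0 <= r <= 1 -> loop_ext F r = chart (u r) (v r).
Proof.
move=> FE r r01; rewrite /loop_ext /= FE ucoord_clamp.
by rewrite -[Num.max _ _]/(clamp_real r) clamp_real_id.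
Qed.

Lemma good_intl (k : int) y : good (k%:~R : R) y.
Proof. by left; rewrite -[k%:~R]add0r turnDz turn0 /= ler01. Qed.

Lemma good_intr x (k : int) : good x (k%:~R : R).
Proof. by right; rewrite -[k%:~R]add0r turnDz turn0 /= ler01. Qed.

(** An edge of the integer grid, or no motion. The grid lies in [good], since on it one coordinate
    is an integer. *)
Definition grid_step (a b a' b' : int) : Prop :=
  (a' = a /\ `|b' - b| <= 1) \/ (b' = b /\ `|a' - a| <= 1).

Lemma good_pl X Y n : (forall i, (i < n)%N -> grid_step (X i) (Y i) (X i.+1) (Y i.+1)) ->
  forall r, good (pl X n r) (pl Y n r).
Proof.
move=> st r; have [r0|r0] := leP r 0; first by rewrite !pl_le0 //; exact: good_intl.
have [rn|rn] := leP n%:R r; first by rewrite !pl_ge //; exact: good_intl.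
case: n st rn => [|n] st rn; first by rewrite ltNge ltW in rn.
have [|j jn rj] := @itv_nat n r; first by rewrite !ltW.
rewrite !(pl_itv _ jn rj); case: (st j jn) => -[-> _]; rewrite subrr mul0r addr0.
  exact: good_intl.
exact: good_intr.
Qed.

Lemma int_norm_le1 (k : int) : `|k| <= 1 -> [\/ k = 0, k = 1 | k = -1].
Proof. by case: k => [[|[|n]]|[|n]] //= _;
  [constructor 1|constructor 2|constructor 3]. Qed.

(** [Q] abstracts membership of the class of a loop in a subgroup that contains the two standard
    circles. *)
Variable Q : loop R (base R) -> Prop.
Variables la lb : loop R (base R).
Hypothesis laE : forall t, la t = chart (ucoord t) 0.
Hypothesis lbE : forall t, lb t = chart 0 (ucoord t).
Hypothesis Q_homotopic : forall f g, loop_homotopic f g -> Q f -> Q g.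
Hypothesis Q_const : Q (const_loop R (base R)).
Hypothesis Q_a : Q la.
Hypothesis Q_b : Q lb.
Hypothesis Q_concat : forall f g, Q f -> Q g -> Q (concat f g).
Hypothesis Q_rev : forall f, Q f -> Q (rev_loop f).

Lemma Q_eq (f g : loop R (base R)) : (forall t, f t = g t) -> Q f -> Q g.
Proof. by move=> fg; apply: Q_homotopic; exact: loop_homotopic_eq. Qed.

(** A lattice translation moves the edge to the origin, where it is a constant loop, a standard
    circle or the reverse of one. *)
Lemma Q_step (a b a' b' : int) (S : loop R (base R)) : grid_step a b a' b' ->
  (forall t, S t = chart (a%:~R + (a' - a)%:~R * ucoord t) (b%:~R + (b' - b)%:~R *
    ucoord t)) ->
  Q S.
Proof.
move=> st SE.
have {}SE t : S t = chart ((a' - a)%:~R * ucoord t) ((b' - b)%:~R * ucoord t).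
  by rewrite SE ![_%:~R + _]addrC chartDz.
have c01 (t : I) : 0 <= 1 - ucoord t <= 1.
  by have := ucoord_ge0 t; have := ucoord_le1 t => *; apply/andP; split; lra.
case: st => -[E /int_norm_le1 H]; move: SE; rewrite E subrr => SE.
- case: H SE => -> SE.
  + by apply: (@Q_eq _ _ _ Q_const) => t; rewrite SE !mul0r chart00.
  + by apply: (@Q_eq _ _ _ Q_b) => t; rewrite SE mul0r mul1r lbE.
  + apply: (@Q_eq _ _ _ (Q_rev Q_b)) => t; rewrite SE rev_loopE mul0r.
    rewrite (@loop_ext_chart (fun=> 0) id) //.
    by rewrite -(chartDz 0 (1 - _) 0 (-1)) addr0; congr chart; rewrite !mulrNz; ring.
- case: H SE => -> SE.
  + by apply: (@Q_eq _ _ _ Q_const) => t; rewrite SE !mul0r chart00.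
  + by apply: (@Q_eq _ _ _ Q_a) => t; rewrite SE mul0r mul1r laE.
  + apply: (@Q_eq _ _ _ (Q_rev Q_a)) => t; rewrite SE rev_loopE mul0r.
    rewrite (@loop_ext_chart id (fun=> 0)) //.
    by rewrite -(chartDz (1 - _) 0 (-1) 0) addr0; congr chart; rewrite !mulrNz; ring.
Qed.

Lemma Q_pl X Y n : (forall i, (i < n)%N -> grid_step (X i) (Y i) (X i.+1) (Y i.+1)) ->
  forall F : loop R (base R),
  (forall t, F t = chart (pl X n (n%:R * ucoord t)) (pl Y n (n%:R * ucoord t))) -> Q F.
Proof.
elim: n => [|n IH] st F FE.
  by apply: (@Q_eq _ _ _ Q_const) => t; rewrite FE mul0r !pl_le0 // chartz.
have stn i : (i < n)%N -> grid_step (X i) (Y i) (X i.+1) (Y i.+1).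
  by move=> /ltnW; exact: st.
have cn m : continuous (fun t : I => m%:R * ucoord t).
  have -> : (fun t : I => m%:R * ucoord t) = (fun t => m%:R * ucoord t + 0).
    by apply/funext => t; rewrite addr0.
  exact: continuous_affine_ucoord.
have cpl Z m : continuous (fun t : I => pl Z m (m%:R * ucoord t)).
  by move=> t; apply: (@continuous_comp _ _ _ (fun t : I => m%:R * ucoord t));
    [exact: cn|exact: continuous_pl].
have [Fn FnE] : exists f : loop R (base R), forall t, f t = chart (pl X n (n%:R *
  ucoord t)) (pl Y n (n%:R * ucoord t)).
  apply: chart_loop_exists => //.
  - by move=> t; exact: good_pl.
  - by rewrite ucoord0 mulr0 !pl_le0 // chartz.
  - by rewrite ucoord1 mulr1 !pl_ge // chartz.
have cS (Z : nat -> int) : continuous (fun t : I =>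
  (Z n)%:~R + (Z n.+1 - Z n)%:~R * ucoord t).
  under eq_fun do rewrite addrC.
  exact: continuous_affine_ucoord.
have [S SE] : exists f : loop R (base R), forall t, f t = chart
    ((X n)%:~R + (X n.+1 - X n)%:~R * ucoord t) ((Y n)%:~R + (Y n.+1 - Y n)%:~R *
      ucoord t).
  apply: chart_loop_exists => //.
  - by move=> t; case: (st n (ltnSn n)) => -[-> _]; rewrite subrr mul0r addr0;
    [exact: good_intl|exact: good_intr].
  - by rewrite ucoord0 !mulr0 !addr0 chartz.
  - by rewrite ucoord1 !mulr1 -!intrD ![_ n + _]addrC !subrK chartz.
have n1 : 0 < n.+1%:R :> R by [].
(* [w] covers the first n pieces during the first half of the time and the last piece during the
   second half, as [concat Fn S] does. *)
pose w (t : I) : R := n%:R / n.+1%:R * Num.min (2 * ucoord t + 0) 1 + n.+1%:R^-1 *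
  Num.max (2 * ucoord t + (-1)) 0.
have wE' t : w t = (n%:R * Num.min (2 * ucoord t + 0) 1 + Num.max (2 * ucoord t + (-1))
  0) / n.+1%:R.
  by rewrite /w; move: (Num.min _ _) (Num.max _ _) => ? ?; ring.
have QC : Q (concat Fn S).
  by apply: Q_concat; [exact: IH FnE|exact: Q_step (st n (ltnSn n)) SE].
apply: (Q_homotopic _ QC); apply: loop_homotopic_sym.
apply: (@reparam_homotopic R _ _ F _ _ (@ucoord R) w).
- exact: continuous_ucoord.
- apply: continuous_lin_comb.
    by apply: continuous_min_comp;
      [exact: continuous_affine_ucoord|exact: continuous_cst].
  by apply: continuous_max_comp; [exact: continuous_affine_ucoord|exact: continuous_cst].
- by move=> t; rewrite loop_extE.
- move=> t; rewrite concatE.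
  have t0 := ucoord_ge0 t; have t1 := ucoord_le1 t.
  have n0 : 0 <= n%:R :> R by [].
  have wE : n.+1%:R * w t = n%:R * Num.min (2 * ucoord t + 0) 1 + Num.max (2 * ucoord t
    + (-1)) 0.
    by rewrite wE' mulrC divfK // gt_eqF.
  have w01 : 0 <= w t <= 1.
    rewrite wE' divr_ge0 ?ler_pdivrMr ?mul1r //=; last first.
      by apply: addr_ge0; [apply: mulr_ge0 => //; rewrite le_min; apply/andP; split;
        lra|rewrite le_max lexx orbT].
    rewrite -[n.+1%:R]natr1; apply: lerD; last by rewrite ge_max; apply/andP; split; lra.
    by apply: ler_piMr => //; rewrite ge_min lexx orbT.
  rewrite (@loop_ext_chart (fun r => pl X n.+1 (n.+1%:R * r)) (fun r =>
    pl Y n.+1 (n.+1%:R * r)) F FE _ w01) wE.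
  case: ifPn => [t2|]; last rewrite -ltNge => t2.
    rewrite (@loop_ext_chart (fun r => pl X n (n%:R * r)) (fun r =>
      pl Y n (n%:R * r)) Fn FnE); last by apply/andP; split; lra.
    have -> : Num.max (2 * ucoord t + -1) 0 = 0 by apply/max_idPr; lra.
    have -> : Num.min (2 * ucoord t + 0) 1 = 2 * ucoord t by rewrite addr0;
      apply/min_idPl; lra.
    by rewrite addr0 !plS_le //; apply: ler_piMr => //; lra.
  rewrite (@loop_ext_chart (fun r => (X n)%:~R + (X n.+1 - X n)%:~R * r) (fun r =>
    (Y n)%:~R + (Y n.+1 - Y n)%:~R * r) S SE); last by apply/andP; split; lra.
  have -> : Num.max (2 * ucoord t + -1) 0 = 2 * ucoord t - 1 by apply/max_idPl; lra.
  have -> : Num.min (2 * ucoord t + 0) 1 = 1 by rewrite addr0; apply/min_idPr; lra.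
  by rewrite mulr1 !plS_itv ?(addrC n%:R) ?addrK //; apply/andP; split; lra.
- move=> s s0 s1; rewrite wE' ucoord0 mulr0 !add0r.
  have -> : Num.min 0 1 = 0 :> R by apply/min_idPl.
  have -> : Num.max (-1) 0 = 0 :> R by apply/max_idPr; lra.
  by rewrite mulr0 add0r mul0r subrr mulr0 loop_ext_le0.
- move=> s s0 s1; rewrite wE' ucoord1 mulr1 addr0.
  have -> : Num.min 2 1 = 1 :> R by apply/min_idPr; lra.
  have -> : Num.max (2 + -1) 0 = 1 :> R by apply/eqP; rewrite /Num.max; case: ifPn =>
    H; lra.
  by rewrite mulr1 natr1 divff ?gt_eqF // subrr mulr0 addr0 loop_ext_ge1.
Qed.

Lemma chart_lift (f : loop R (base R)) : exists x y : R -> R,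
  [/\ continuous x, continuous y, x 0 = 0, y 0 = 0 &
    forall t, 0 <= t <= 1 -> good (x t) (y t) /\ loop_ext f t = chart (x t) (y t)].
Proof.
pose F (t : R) := set_val (loop_ext f t).
have cF : continuous F.
  move=> t; apply: (@continuous_comp _ _ _ (loop_ext f) (@set_val _ _)).
    exact: continuous_loop_ext.
  exact: continuous_ht_val.
have FH t : holed_torus_set (F t) by exact: set_valP.
have F0 : F 0 = ((1, 0), (1, 0)) by rewrite /F loop_ext_le0.
have c1 := continuous_fst2 cF; have c2 := continuous_snd2 cF.
have c11 := continuous_fst2 c1; have c12 := continuous_snd2 c1.
have c21 := continuous_fst2 c2; have c22 := continuous_snd2 c2.
have [||x cx [x0 xE]] := circle_lift c11 c12.
- by move=> t; rewrite -surjective_pairing; case: (FH t) => -[].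
- by rewrite F0.
have [||y cy [y0 yE]] := circle_lift c21 c22.
- by move=> t; rewrite -surjective_pairing; case: (FH t) => -[].
- by rewrite F0.
exists x, y; split=> // t t01.
have {}xE : turn (x t) = (F t).1 by rewrite xE // -surjective_pairing.
have {}yE : turn (y t) = (F t).2 by rewrite yE // -surjective_pairing.
split; first by rewrite /good xE yE; case: (FH t).
by rewrite /chart xE yE -surjective_pairing set_valK.
Qed.

Lemma turn_eq1 (x : R) : turn x = (1, 0) -> exists k : int, x = k%:~R.
Proof.
move=> tx; have [|k Hk] := @turn_near R x; first by rewrite tx ler01.
exists k; apply/eqP; rewrite -subr_eq0; move: tx Hk.
rewrite -(turnDz x (- k)) mulrNz; move: (x - _) => y [_ sy].
rewrite ler_norml => /andP[y1 y2].
have p0 := pi_gt0 R.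
suff /eqP : 2 * pi * y = 0 by rewrite !mulf_eq0 pnatr_eq0 /= gt_eqF.
apply: sin_inj; rewrite ?in_itv /= ?sy ?sin0 //; apply/andP; split; nra.
Qed.

(* A lift of the loop is moved linearly to the polygonal path through the lattice points
   nearest to its values at the times i / N. This stays in [good]: if a coordinate is
   within 1/4 of an integer k at time t, then it rounds to k at both ends of the piece
   containing t, so that this coordinate moves towards k. *)
Theorem loop_generation (f : loop R (base R)) : Q f.
Proof.
have [x [y [cx cy x0 y0 H]]] := chart_lift f.
(* A coordinate within 1/4 of k that moves by less than 1/4 stays strictly within 1/2 of k, and so
   rounds to k. *)
have e4 : 0 < 4^-1 :> R by rewrite invr_gt0.
have [d1 d10 H1] := unif_continuous_segment 0 1 cx e4.
have [d2 d20 H2] := unif_continuous_segment 0 1 cy e4.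
have [N HN] : exists N : nat, (Num.min d1 d2)^-1 < N%:R.
  by eexists; apply: archi_boundP; rewrite invr_ge0 le_min !ltW.
have N0 : 0 < N%:R :> R by apply: lt_trans HN; rewrite invr_gt0 lt_min d10.
have {HN} [HN1 HN2] : N%:R^-1 < d1 /\ N%:R^-1 < d2.
  apply/andP; rewrite -lt_min -[X in _ < X]invrK ltf_pV2 ?posrE // invr_gt0 lt_min d10 //.
pose X (i : nat) := nearest (x (i%:R / N%:R));
  pose Y (i : nat) := nearest (y (i%:R / N%:R)).
have iN (i : nat) : (i <= N)%N -> 0 <= (i%:R / N%:R : R) <= 1.
  by move=> iN; rewrite divr_ge0 //= ler_pdivrMr // mul1r ler_nat.
have iS (i : nat) : i.+1%:R / N%:R = i%:R / N%:R + N%:R^-1 :> R.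
  by rewrite -[i.+1%:R]natr1 mulrDl mul1r.
have NV0 : 0 < N%:R^-1 :> R by rewrite invr_gt0.
have const (z : R -> R) d j t (k : int) : N%:R^-1 < d ->
    (forall s t, 0 <= s <= 1 -> `|s - t| < d -> `|z s - z t| < 4^-1) ->
    0 <= t <= 1 -> j%:R / N%:R <= t <= j%:R / N%:R + N%:R^-1 -> `|z t - k%:~R| <= 4^-1 ->
    nearest (z (j%:R / N%:R)) = k /\ nearest (z (j.+1%:R / N%:R)) = k.
  move=> Nd Hz t01 /andP[t1 t2]; rewrite ler_norml => /andP[z1 z2].
  split; apply: nearest_eq.
    have := Hz t (j%:R / N%:R) t01; rewrite !ltr_norml => /(_ _)/andP[|? ?].
      by apply/andP; split; lra.
    by apply/andP; split; lra.
  have := Hz t (j.+1%:R / N%:R) t01; rewrite iS !ltr_norml => /(_ _)/andP[|? ?].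
    by apply/andP; split; lra.
  by apply/andP; split; lra.
have near1 (z : R -> R) d j : N%:R^-1 < d ->
    (forall s t, 0 <= s <= 1 -> `|s - t| < d -> `|z s - z t| < 4^-1) -> (j < N)%N ->
    `|nearest (z (j.+1%:R / N%:R)) - nearest (z (j%:R / N%:R))| <= 1.
  move=> Nd Hz jN; have := Hz (j%:R / N%:R) (j.+1%:R / N%:R) (iN j (ltnW jN)).
  have := nearest_dist (z (j%:R / N%:R)); have := nearest_dist (z (j.+1%:R / N%:R)).
  move: (nearest _) (nearest _) => a b.
  have -> : `|j%:R / N%:R - j.+1%:R / N%:R| = N%:R^-1 :> R.
    by rewrite iS opprD addrA subrr add0r normrN gtr0_norm.
  move=> h1 h2 /(_ Nd) h3.
  (* The integers differ by less than 1/2 + 1/4 + 1/2, hence by less than 2. *)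
  rewrite -ltzD1 -(ltr_int R) intr_norm intrB intrD.
  move: h1 h2 h3; rewrite !ler_norml !ltr_norml => /andP[? ?] /andP[? ?] /andP[? ?].
  by apply/andP; split; lra.
have step i : (i < N)%N -> grid_step (X i) (Y i) (X i.+1) (Y i.+1).
  move=> iN'; have [G _] := H _ (iN i (ltnW iN')).
  have ii : i%:R / N%:R <= (i%:R / N%:R : R) <= i%:R / N%:R + N%:R^-1.
    by rewrite lexx lerDl ltW.
  case: G => /turn_near[k Hk]; [left|right]; rewrite /X /Y.
    have [-> ->] := const x d1 i _ k HN1 H1 (iN i (ltnW iN')) ii Hk; split=> //.
    exact: near1 HN2 H2 iN'.
  have [-> ->] := const y d2 i _ k HN2 H2 (iN i (ltnW iN')) ii Hk; split=> //.
  exact: near1 HN1 H1 iN'.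
have X0 : X 0%N = 0 by rewrite /X mul0r x0 (nearest_int 0).
have Y0 : Y 0%N = 0 by rewrite /Y mul0r y0 (nearest_int 0).
have i11 : 0 <= (1 : R) <= 1 by rewrite ler01 lexx.
have [G1 E1] := H 1 i11.
(* The lift of a loop ends at a lattice point, so rounding does not move its end. *)
have : set_val (loop_ext f 1) = ((1, 0), (1, 0)) by rewrite loop_ext_ge1.
rewrite E1 chart_val // => E.
have [kx kxE] := turn_eq1 (congr1 fst E); have [ky kyE] := turn_eq1 (congr1 snd E).
have XN : x 1 = (X N)%:~R by rewrite /X divff ?gt_eqF // kxE nearest_int.
have YN : y 1 = (Y N)%:~R by rewrite /Y divff ?gt_eqF // kyE nearest_int.
have cu (z : R -> R) : continuous z -> continuous (z \o @ucoord R).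
  move=> cz t; apply: continuous_comp; [exact: continuous_ucoord|exact: cz].
have cp Z : continuous (fun t : I => pl Z N (N%:R * ucoord t)).
  apply: (cu (fun r => pl Z N (N%:R * r))) => r.
  apply: (@continuous_comp R R R (fun r : R => N%:R * r) (pl Z N));
    last exact: continuous_pl.
  by apply: cvgM; [exact: cvg_cst|exact: cvg_id].
have [F FE] : exists F : loop R (base R), forall t,
    F t = chart (pl X N (N%:R * ucoord t)) (pl Y N (N%:R * ucoord t)).
  apply: chart_loop_exists => //.
  - by move=> t; exact: good_pl.
  - by rewrite ucoord0 mulr0 !pl_le0 // chartz.
  - by rewrite ucoord1 mulr1 !pl_ge // chartz.
apply: (@Q_homotopic F); last exact: Q_pl FE.
apply: loop_homotopic_sym.
apply: (@chart_loop_homotopic R (x \o @ucoord R) (y \o @ucoord R) _ _ f F _ _ _ _ _ FE).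
- exact: cu.
- exact: cu.
- exact: cp.
- exact: cp.
- move=> t; rewrite -loop_extE; apply: (H _ _).2.
  by rewrite ucoord_ge0 ucoord_le1.
- by rewrite /= ucoord0 mulr0 pl_le0 // X0 x0.
- by rewrite /= ucoord0 mulr0 pl_le0 // Y0 y0.
- by rewrite /= ucoord1 mulr1 pl_ge.
- by rewrite /= ucoord1 mulr1 pl_ge.
move=> s t /andP[s0 s1] /=.
have t01 : 0 <= ucoord t <= 1 by rewrite ucoord_ge0 ucoord_le1.
have [G _] := H _ t01.
have [j jN jt] : exists2 j, (j < N)%N & j%:R <= N%:R * ucoord t <= j%:R + 1.
  case: (N) N0 => [|n n0]; first by rewrite ltxx.
  apply: itv_nat; case/andP: t01 => t0 t1.
  by rewrite mulr_ge0 //= ler_piMr.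
have jt' : j%:R / N%:R <= ucoord t <= j%:R / N%:R + N%:R^-1.
  by rewrite -iS ler_pdivrMr // ler_pdivlMr // mulrC -[j.+1%:R]natr1.
have shrink (a : R) (k : int) : `|a - k%:~R| <= 4^-1 ->
  `|a + s * (k%:~R - a) - k%:~R| <= 4^-1.
  move=> ak; have -> : a + s * (k%:~R - a) - k%:~R = (1 - s) * (a - k%:~R) by ring.
  rewrite normrM ger0_norm ?subr_ge0 //; apply: le_trans ak.
  by apply: ler_piMl => //; lra.
rewrite !(pl_itv _ jN jt).
case: G => /turn_near[k Hk]; [left|right].
  have [Xj Xj'] := const x d1 j _ k HN1 H1 t01 jt' Hk.
  by rewrite /X Xj Xj' subrr mul0r addr0; apply: (@cos_turn_ge0 R _ k); exact: shrink.
have [Yj Yj'] := const y d2 j _ k HN2 H2 t01 jt' Hk.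
by rewrite /Y Yj Yj' subrr mul0r addr0; apply: (@cos_turn_ge0 R _ k); exact: shrink.
Qed.

End Generation.

(** * Homeomorphisms of the holed torus *)

Section Homeomorphisms.
Variable R : realType.
Local Notation I := (unit_interval R).
Local Notation HT := (holed_torus R).
Local Notation P4 := ((R * R) * (R * R))%type.

Definition homeo_comp (S T U : topologicalType) (k : homeomorphism T U)
    (m : homeomorphism S T) : homeomorphism S U.
Proof.
apply: (@Homeomorphism S U (k \o m) (homeo_inv m \o homeo_inv k)).
- by move=> x; apply: continuous_comp; exact: homeo_cts.
- by move=> x; apply: continuous_comp; exact: homeo_inv_cts.
- by move=> x /=; rewrite !homeoK.
- by move=> x /=; rewrite !homeo_invK.
Defined.

Lemma ht_homeo_exists (F G : P4 -> P4) : continuous F -> continuous G ->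
  (forall x, holed_torus_set x -> holed_torus_set (F x)) ->
  (forall x, holed_torus_set x -> holed_torus_set (G x)) ->
  (forall x, holed_torus_set x -> G (F x) = x) ->
  (forall x, holed_torus_set x -> F (G x) = x) ->
  exists m : homeomorphism HT HT, forall x, set_val (m x) = F (set_val x).
Proof.
move=> cF cG HF HG GF FG.
have cH (H : P4 -> P4) : continuous H -> (forall x, holed_torus_set x ->
  holed_torus_set (H x)) ->
    continuous (fun x : HT => to_ht (H (set_val x))).
  move=> cH HH; apply: continuous_to_ht; first by move=> x; apply: HH; exact: set_valP.
  move=> x; apply: (@continuous_comp _ _ _ (set_val : HT -> P4) H).
    exact: continuous_ht_val.
  exact: cH.
have K (H H' : P4 -> P4) : (forall x, holed_torus_set x -> holed_torus_set (H x)) ->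
    (forall x, holed_torus_set x -> H' (H x) = x) ->
    cancel (fun x : HT => to_ht (H (set_val x))) (fun x : HT => to_ht (H' (set_val x))).
  move=> HH HK x; rewrite to_htK; last by apply: HH; exact: set_valP.
  by rewrite HK ?set_valK //; exact: set_valP.
exists (Homeomorphism (cH F cF HF) (cH G cG HG) (K F G HF GF) (K G F HG FG)) => x /=.
by rewrite to_htK //; apply: HF; exact: set_valP.
Qed.

Lemma continuous_cmul (X : topologicalType) (f g : X -> R * R) :
  continuous f -> continuous g -> continuous (fun x => cmul (f x) (g x)).
Proof.
move=> cf cg.
apply: continuous_pair => x.
  by apply: cvgB; apply: cvgM;
    [exact: (continuous_fst2 cf)|exact: (continuous_fst2 cg)|
     exact: (continuous_snd2 cf)|exact: (continuous_snd2 cg)].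
by apply: cvgD; apply: cvgM;
  [exact: (continuous_fst2 cf)|exact: (continuous_snd2 cg)|
   exact: (continuous_snd2 cf)|exact: (continuous_fst2 cg)].
Qed.

Lemma continuous_cconj (X : topologicalType) (f : X -> R * R) :
  continuous f -> continuous (fun x => cconj (f x)).
Proof.
move=> cf; apply: continuous_pair; first exact: continuous_fst2.
by move=> x; apply: cvgN; exact: (continuous_snd2 cf).
Qed.

Lemma continuous_idX (X : topologicalType) : continuous (fun x : X => x).
Proof. by move=> x; exact: cvg_id. Qed.

Lemma swap_exists : exists m : homeomorphism HT HT, forall x,
  set_val (m x) = ((set_val x).2, (set_val x).1).
Proof.
have cs : continuous (fun x : P4 => (x.2, x.1)).
  by apply: continuous_pair;
    [exact: continuous_snd2 (@continuous_idX _)|exact: continuous_fst2 (@continuous_idX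
      _)].
have hs (x : P4) : holed_torus_set x -> holed_torus_set (x.2, x.1).
  by case=> -[H1 H2] H; split=> //=; case: H; [right|left].
by apply: (@ht_homeo_exists (fun x => (x.2, x.1)) (fun x => (x.2, x.1))) => // -[].
Qed.

Lemma conj_exists : exists m : homeomorphism HT HT, forall x,
  set_val (m x) = (cconj (set_val x).1, (set_val x).2).
Proof.
have cs : continuous (fun x : P4 => (cconj x.1, x.2)).
  apply: continuous_pair; last exact: continuous_snd2 (@continuous_idX _).
  by apply: continuous_cconj; exact: continuous_fst2 (@continuous_idX _).
have hs (x : P4) : holed_torus_set x -> holed_torus_set (cconj x.1, x.2).
  by case=> -[H1 H2] H; split=> //=; split=> //; exact: circle_cconj.
have ks (x : P4) : (cconj (cconj x.1, x.2).1, (cconj x.1, x.2).2) = x.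
  by case: x => -[a b] v; rewrite /cconj /= opprK.
by apply: (@ht_homeo_exists (fun x => (cconj x.1, x.2)) (fun x => (cconj x.1, x.2))).
Qed.

(** Over the left half of the first circle the shear is the identity, and over the right half no
    point is removed; so the hole is respected. The inverse is the shear by the conjugate of c. *)
Lemma shear_exists (c : R * R -> R * R) : continuous c ->
  (forall u, circle u -> circle (c u)) -> (forall u, u.1 <= 0 -> c u = (1, 0)) ->
  exists m : homeomorphism HT HT, forall x,
    set_val (m x) = ((set_val x).1, cmul (c (set_val x).1) (set_val x).2).
Proof.
move=> cc Hc c1.
have sh (d : R * R -> R * R) : continuous d -> continuous (fun x : P4 =>
  (x.1, cmul (d x.1) x.2)).
  move=> cd; have f1 := continuous_fst2 (@continuous_idX P4).
  apply: continuous_pair => //; apply: continuous_cmul.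
    by move=> x; apply: (@continuous_comp _ _ _ (fun x : P4 => x.1) d);
      [exact: f1|exact: cd].
  exact: continuous_snd2 (@continuous_idX _).
have hs (d : R * R -> R * R) : (forall u, circle u -> circle (d u)) ->
  (forall u, u.1 <= 0 -> d u = (1, 0)) ->
    forall x : P4, holed_torus_set x -> holed_torus_set (x.1, cmul (d x.1) x.2).
  move=> Hd d1 [u v] [[/= H1 H2] H]; split.
    by split=> //=; apply: circle_cmul => //; exact: Hd.
  have [u0|u0] := leP 0 u.1; [by left|right].
  rewrite /= (d1 _ (ltW u0)) mul1r mul0r subr0.
  by case: H => //; rewrite leNgt u0.
have Hc' u : circle u -> circle (cconj (c u)) by move=> /Hc; exact: circle_cconj.
have c1' (u : R * R) : u.1 <= 0 -> cconj (c u) = (1, 0) by move=> /c1 ->;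
  rewrite /cconj /= oppr0.
apply: (@ht_homeo_exists (fun x => (x.1, cmul (c x.1) x.2)) (fun x =>
  (x.1, cmul (cconj (c x.1)) x.2))).
- exact: sh.
- by apply: (sh (fun u => cconj (c u))); exact: continuous_cconj.
- exact: hs.
- exact: (hs (fun u => cconj (c u))).
- move=> [u v] [[/= H1 H2] _]; congr pair.
  by rewrite cmulA cmulV ?[cmul (1, 0) _]cmulC ?cmulr1 //; exact: Hc.
- move=> [u v] [[/= H1 H2] _]; congr pair.
  by rewrite cmulA [cmul (c u) _]cmulC cmulV ?[cmul (1, 0) _]cmulC ?cmulr1 //; exact: Hc.
Qed.

Lemma turn_surj (u : R * R) : circle u -> exists x, turn x = u.
Proof.
case: u => a b; rewrite /circle /= => ab.
have p0 : 2 * pi != 0 :> R by rewrite mulf_neq0 ?pnatr_eq0 // gt_eqF // pi_gt0.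
have a1 : -1 <= a <= 1 by apply/andP; split; nra.
have s : Num.sqrt (1 - a ^+ 2) = `|b| by rewrite -ab addrC addKr sqrtr_sqr.
have [b0|b0] := leP 0 b.
  exists (acos a / (2 * pi)); rewrite /turn mulrC divfK // acosK ?in_itv //.
  by rewrite sin_acos // s ger0_norm.
exists (- (acos a / (2 * pi))); rewrite turnN /turn /= mulrC divfK // acosK ?in_itv //.
by rewrite sin_acos // s ltr0_norm // opprK.
Qed.

Lemma base_val : set_val (base R) = ((1, 0), (1, 0)).
Proof. by []. Qed.

(** A shear whose angle is proportional to the positive part of [u.1], normalized to be the angle th
    of v0 at u0. *)
Lemma rotation_exists (u0 v0 : R * R) : 0 < u0.1 -> circle v0 ->
  exists m : homeomorphism HT HT, forall x : HT, (set_val x).1 = u0 ->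
    set_val (m x) = (u0, cmul v0 (set_val x).2).
Proof.
move=> u00 /turn_surj[th <-].
have cm : continuous (fun u : R * R => th / u0.1 * Num.max 0 u.1 + 0).
  apply: continuous_affine_comp; apply: continuous_max_comp; first exact: continuous_cst.
  exact: continuous_fst2 (@continuous_idX _).
have [|||m mE] := @shear_exists (fun u => turn (th / u0.1 * Num.max 0 u.1 + 0)).
- exact: continuous_turn.
- by move=> u _; exact: turn_circle.
- by move=> u u1; rewrite (max_idPl u1) mulr0 addr0 turn0.
exists m => x xE; rewrite mE xE (max_idPr (ltW u00)) addr0 divfK // gt_eqF //.
Qed.

(** The base point (1, 1) goes to (1, u), by the swap to (u, 1), then to (u, v); the last rotation
    needs [0 < u.1]. The other interior points follow by a swap. *)
Lemma transport_base (x : HT) : holed_torus_interior x ->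
  exists m : homeomorphism HT HT, m (base R) = x.
Proof.
have [sw swE] := swap_exists.
have H (u v : R * R) : 0 < u.1 -> circle u -> circle v ->
    exists m : homeomorphism HT HT, set_val (m (base R)) = (u, v).
  move=> u0 cu cv; have [m1 m1E] := @rotation_exists (1, 0) u ltr01 cu.
  have [m2 m2E] := rotation_exists u0 cv.
  have E1 : set_val (sw (m1 (base R))) = (u, (1, 0)).
    by rewrite swE m1E base_val //= cmulr1.
  by exists (homeo_comp m2 (homeo_comp sw m1)); rewrite /= m2E E1 //= cmulr1.
have [[cu cv] _] : holed_torus_set (set_val x) by exact: set_valP.
case=> [u0|v0].
  have [m mE] := H _ _ u0 cu cv; exists m; apply: ht_inj.
  by rewrite mE -surjective_pairing.
have [m mE] := H _ _ v0 cv cu; exists (homeo_comp sw m); apply: ht_inj.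
by rewrite /= swE mE -surjective_pairing.
Qed.

(* On the circle this is u |-> u^4 over the first quadrant and constant elsewhere. *)
Definition twist_fun (u : R * R) : R * R :=
  let P := Num.max 0 u.1 * Num.max 0 u.2 in
  (1 - 8 * P ^+ 2, 4 * P * (u.1 ^+ 2 - u.2 ^+ 2)).

Lemma twist_fun_out (u : R * R) : u.1 <= 0 \/ u.2 <= 0 -> twist_fun u = (1, 0).
Proof.
by rewrite /twist_fun => -[] u0;
  rewrite (max_idPl u0) ?mul0r ?mulr0 ?expr0n !mulr0 ?mul0r subr0.
Qed.

Lemma twist_fun_in (u : R * R) : 0 <= u.1 -> 0 <= u.2 ->
  twist_fun u = (1 - 8 * (u.1 * u.2) ^+ 2, 4 * (u.1 * u.2) * (u.1 ^+ 2 - u.2 ^+ 2)).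
Proof. by rewrite /twist_fun => u1 u2; rewrite (max_idPr u1) (max_idPr u2). Qed.

Lemma twist_fun_turn (x : R) : 0 <= x <= 1 ->
  twist_fun (turn x) = turn (Num.min (4 * x) 1).
Proof.
move=> /andP[x0 x1]; have [x4|x4] := leP x 4^-1.
  rewrite twist_fun_in; last 2 first.
  - by apply: (@cos_turn_ge0 R x 0); rewrite subr0 ger0_norm.
  - by apply: sin_turn_ge0; apply/andP; split; lra.
  have -> : Num.min (4 * x) 1 = (x + x) + (x + x) by rewrite (min_idPl _); lra.
  rewrite !turnD; have := turn_circle x; rewrite /circle /cmul /=.
  move: (cos _) (sin _) => a b E; congr pair; last by ring.
  transitivity ((a ^+ 2 + b ^+ 2) ^+ 2 - 8 * (a * b) ^+ 2); last by ring.
  by rewrite E expr1n.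
rewrite (min_idPr _) ?turn1; last lra.
apply: twist_fun_out; have [x2|x2] := leP x 2^-1.
  by left; apply: cos_turn_le0; apply/andP; split; lra.
by right; apply: sin_turn_le0; apply/andP; split; lra.
Qed.

Lemma circle_twist_fun (u : R * R) : circle u -> circle (twist_fun u).
Proof.
move=> cu; have [u1|u1] := leP 0 u.1;
  last by rewrite twist_fun_out ?(ltW u1); [rewrite /circle /= expr1n expr0n addr0|left].
have [u2|u2] := leP 0 u.2;
  last by rewrite twist_fun_out ?(ltW u2); [rewrite /circle /= expr1n expr0n addr0|right].
rewrite twist_fun_in //; move: cu; rewrite /circle /= => E.
have E2 : u.1 ^+ 2 = 1 - u.2 ^+ 2 by rewrite -E; ring.
by rewrite !exprMn E2; ring.
Qed.

Lemma continuous_twist_fun : continuous twist_fun.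
Proof.
have c1 : continuous (fun u : R * R => u.1) by exact: continuous_fst2 (@continuous_idX _).
have c2 : continuous (fun u : R * R => u.2) by exact: continuous_snd2 (@continuous_idX _).
have m1 : continuous (fun u : R * R => Num.max 0 u.1).
  by apply: continuous_max_comp => //; exact: continuous_cst.
have m2 : continuous (fun u : R * R => Num.max 0 u.2).
  by apply: continuous_max_comp => //; exact: continuous_cst.
have cP : continuous (fun u : R * R => Num.max 0 u.1 * Num.max 0 u.2).
  by move=> u; apply: cvgM; [exact: m1|exact: m2].
apply: continuous_pair => u.
  by apply: cvgB; [exact: cvg_cst|apply: cvgM; [exact: cvg_cst|apply: cvgM; exact: cP]].
apply: cvgM; first by apply: cvgM; [exact: cvg_cst|exact: cP].
by apply: cvgB; apply: cvgM; (exact: c1 || exact: c2).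
Qed.

(** A Dehn twist supported over the first quadrant of the first circle, away from the hole: the
    image of this circle winds once around the second factor during its first quarter. *)
Lemma twist_exists : exists m : homeomorphism HT HT,
  (forall x : R, 0 <= x <= 1 -> m (chart x 0) = chart x (Num.min (4 * x) 1)) /\
  (forall y : R, m (chart 0 y) = chart 0 y).
Proof.
have [|||m mE] := @shear_exists twist_fun.
- exact: continuous_twist_fun.
- exact: circle_twist_fun.
- by move=> u u1; apply: twist_fun_out; left.
have g0 (x : R) : good x 0 by exact: (@good_intr R x 0).
have g0' (x : R) : good 0 x by exact: (@good_intl R 0 x).
exists m; split=> [x x01|y].
  rewrite -(set_valK (m _)) mE chart_val //= twist_fun_turn // turn0 cmulr1.
  by [].
rewrite -(set_valK (m _)) mE chart_val //= turn0 twist_fun_out; last by right.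
by rewrite cmulC cmulr1 /chart turn0.
Qed.

End Homeomorphisms.

(** * Markings *)

Section Markings.
Variables (R : realType) (S : topologicalType) (p : S).
Local Notation I := (unit_interval R).
Local Notation HT := (holed_torus R).
Local Notation G := (@pi1 R S p).

Definition marking (f g : loop R p) : Prop :=
  exists k : homeomorphism HT S, [/\ k (base R) = p,
    forall t, f t = k (chart (ucoord t) 0) & forall t, g t = k (chart 0 (ucoord t))].

(* Images of the standard generators under homeomorphisms; the twist, the swap of the two
   circle factors and the reflection of the first one act by Nielsen moves. *)
Definition marked (x y : G) : Prop :=
  exists f g, [/\ marking f g, x = loop_class f & y = loop_class g].

Lemma pi1_mulgE (f g : loop R p) :
  (loop_class f * loop_class g)%g = loop_class (concat f g) :> G.
Proof. exact: pi1_mulE. Qed.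

Lemma pi1_invgE (f : loop R p) : ((loop_class f)^-1)%g = loop_class (rev_loop f) :> G.
Proof. exact: pi1_invE. Qed.

Lemma loop_class_eq (f g : loop R p) : (forall t, f t = g t) ->
  loop_class f = loop_class g.
Proof. by move=> fg; apply/loop_classP; exact: loop_homotopic_eq. Qed.

Lemma standard_loops : exists la lb : loop R (base R),
  (forall t, la t = chart (ucoord t) 0) /\ (forall t, lb t = chart 0 (ucoord t)).
Proof.
have c0 : continuous (fun _ : I => 0 : R) by exact: continuous_cst.
have c := @continuous_ucoord R.
have [|||la laE] := chart_loop_exists c c0.
- by move=> t; exact: (@good_intr R _ 0).
- by rewrite ucoord0 chart00.
- by rewrite ucoord1 (chartz R 1 0).
have [|||lb lbE] := chart_loop_exists c0 c.
- by move=> t; exact: (@good_intl R 0).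
- by rewrite ucoord0 chart00.
- by rewrite ucoord1 (chartz R 0 1).
by exists la, lb.
Qed.

Lemma marking_exists (h : homeomorphism HT S) :
  (h @` @holed_torus_interior R) p -> exists f g, marking f g.
Proof.
move=> [x xi hx]; have [m mx] := transport_base xi.
have [la [lb [laE lbE]]] := standard_loops.
have kb : homeo_comp h m (base R) = p by rewrite /= mx hx.
have [f fE] := loop_map_exists la (homeo_cts (h := homeo_comp h m)) kb.
have [g gE] := loop_map_exists lb (homeo_cts (h := homeo_comp h m)) kb.
exists f, g, (homeo_comp h m); split=> // t; first by rewrite fE laE.
by rewrite gE lbE.
Qed.

Lemma marked_swap x y : marked x y -> marked y x.
Proof.
move=> [f [g [[k [kb fE gE]] -> ->]]]; exists g, f; split=> //.
have [m mE] := swap_exists R.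
have mc u v : good u v -> good v u -> m (chart u v) = chart v u.
  by move=> uv vu; apply: ht_inj; rewrite mE !chart_val.
have g1 (u : R) : good u 0 by exact: (@good_intr R u 0).
have g2 (u : R) : good 0 u by exact: (@good_intl R 0 u).
exists (homeo_comp k m); split=> [|t|t] /=.
- by rewrite -chart00 mc // chart00.
- by rewrite mc.
- by rewrite mc.
Qed.

Lemma marked_inv x y : marked x y -> marked (x^-1)%g y.
Proof.
move=> [f [g [[k [kb fE gE]] -> ->]]]; exists (rev_loop f), g; split=> //;
  last exact: pi1_invgE.
have [m mE] := conj_exists R.
have gN (u v : R) : good u v -> good (- u) v by rewrite /good turnN.
have mc u v : good u v -> m (chart u v) = chart (- u) v.
  by move=> uv; apply: ht_inj; rewrite mE !chart_val ?turnN //; exact: gN.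
have g1 (u : R) : good u 0 by exact: (@good_intr R u 0).
have g2 (u : R) : good 0 u by exact: (@good_intl R 0 u).
have [la [lb [laE lbE]]] := standard_loops.
have t01 (t : I) : 0 <= 1 - ucoord t <= 1.
  by have := ucoord_ge0 t; have := ucoord_le1 t => *; apply/andP; split; lra.
exists (homeo_comp k m); split=> [|t|t] /=.
- by rewrite -chart00 mc // oppr0 chart00.
- rewrite mc // (@loop_map_rev R _ _ _ _ k la) => [|s]; last by rewrite fE laE.
  rewrite rev_loopE (@loop_ext_chart R id (fun=> 0) la laE _ (t01 t)).
  by rewrite -(chartDz (- _) 0 1 0) addr0 addrC.
- by rewrite mc // oppr0.
Qed.

(** The homotopy from the lift of [concat lb la] to that of the twisted circle, read backwards. For
    t <= 1/4 the first coordinate is at most 1/4; for t >= 1/2 the second is 1. In between, the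
    second is within 1/4 of 1 if s <= 1/2, and the first within 1/4 of 0 if s >= 1/2. *)
Lemma twist_homotopy (s t : R) : 0 <= s <= 1 -> 0 <= t <= 1 ->
  good (t + s * (Num.max (2 * t + (-1)) 0 - t))
    (Num.min (4 * t + 0) 1 + s * (Num.min (2 * t + 0) 1 - Num.min (4 * t + 0) 1)).
Proof.
move=> /andP[s0 s1] /andP[t0 t1]; rewrite !addr0.
have near1 (a b : R) (k : int) : `|a - k%:~R| <= 4^-1 \/ `|b - k%:~R| <= 4^-1 -> good a b.
  by case=> H; [left|right]; exact: cos_turn_ge0 H.
have [t4|t4] := leP t 4^-1.
  rewrite (_ : Num.max _ _ = 0); last by apply/max_idPr; lra.
  by apply: (near1 _ _ 0); left; rewrite ler_norml; apply/andP; split; nra.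
rewrite (_ : Num.min (4 * t) 1 = 1); last by apply/min_idPr; lra.
have [t2|t2] := leP t 2^-1; last first.
  rewrite (_ : Num.min _ _ = 1); last by apply/min_idPr; lra.
  by apply: (near1 _ _ 1); right; rewrite subrr mulr0 addr0 subrr normr0 invr_ge0.
rewrite (_ : Num.max _ _ = 0); last by apply/max_idPr; lra.
rewrite (_ : Num.min _ _ = 2 * t); last by apply/min_idPl; lra.
have [s2|s2] := leP s 2^-1.
  apply: (near1 _ _ 1); right; rewrite ler_norml; apply/andP; split; nra.
apply: (near1 _ _ 0); left; rewrite ler_norml; apply/andP; split; nra.
Qed.

(** The twisted first circle winds around the second factor at its start, hence y stands on the
    left; the twist fixes the second circle pointwise. *)
Lemma marked_mul x y : marked x y -> marked (y * x)%g y.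
Proof.
move=> [f [g [[k [kb fE gE]] -> ->]]].
have [m [ma mb]] := twist_exists R.
have [la [lb [laE lbE]]] := standard_loops.
have t01 (t : I) : 0 <= ucoord t <= 1 by rewrite ucoord_ge0 ucoord_le1.
have cmin : continuous (fun t : I => Num.min (4 * ucoord t + 0) 1).
  by apply: continuous_min_comp; [exact: continuous_affine_ucoord|exact: continuous_cst].
have cmin2 : continuous (fun t : I => Num.min (2 * ucoord t + 0) 1).
  by apply: continuous_min_comp; [exact: continuous_affine_ucoord|exact: continuous_cst].
have cmax : continuous (fun t : I => Num.max (2 * ucoord t + (-1)) 0).
  by apply: continuous_max_comp; [exact: continuous_affine_ucoord|exact: continuous_cst].
have [lt ltE] : exists l : loop R (base R), forall t, l t = m (la t).
  by apply: loop_map_exists; [exact: homeo_cts|rewrite -chart00 mb].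
have [f' f'E] := loop_map_exists lt (homeo_cts (h := k)) kb.
exists f', g; split=> //.
  exists (homeo_comp k m); split=> [|t|t] /=.
  - by rewrite -chart00 mb chart00.
  - by rewrite f'E ltE laE.
  - by rewrite mb.
rewrite pi1_mulgE; apply/loop_classP.
apply: (@loop_map_homotopic R _ _ _ _ k (concat lb la) lt) => //.
- exact: homeo_cts.
- by apply: loop_map_concat => t; rewrite ?gE ?fE ?lbE ?laE.
apply: loop_homotopic_sym.
apply: (chart_loop_homotopic (@continuous_ucoord R) cmin cmax cmin2).
- by move=> t; rewrite ltE laE ma // addr0.
- move=> t; rewrite concatE addr0; case: ifPn => [t2|]; last rewrite -ltNge => t2.
    rewrite (@loop_ext_chart R (fun=> 0) id lb lbE);
      last by have := t01 t => /andP[? ?]; apply/andP; split; lra.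
    by congr chart; apply/esym; [apply/max_idPr|apply/min_idPl]; lra.
  rewrite (@loop_ext_chart R id (fun=> 0) la laE);
    last by have := t01 t => /andP[? ?]; apply/andP; split; lra.
  rewrite (_ : Num.max _ _ = 2 * ucoord t - 1); last by apply/max_idPl; lra.
  rewrite (_ : Num.min _ _ = 1); last by apply/min_idPr; lra.
  by rewrite -(chartDz _ 0 0 1) add0r addr0.
- by rewrite ucoord0 mulr0 add0r; apply/esym/max_idPr; lra.
- by rewrite ucoord0 !mulr0.
- rewrite ucoord1 mulr1 (_ : 2 + -1 = 1); last by ring.
  by apply/esym/max_idPl.
- by rewrite ucoord1 !mulr1 !addr0 !(min_idPr _) // ler1n.
by move=> s t s01; exact: twist_homotopy.
Qed.

(** By injectivity of k, a coincidence at s < t makes t - s a positive integer, which in [0, 1]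
    leaves only the two end points. *)
Lemma marked_simple x y : marked x y -> simple_loop x.
Proof.
move=> [f [g [[k [kb fE gE]] -> _]]]; exists f => // s t st.
rewrite !fE => /(can_inj (homeoK k)) /(congr1 set_val).
have g1 (u : R) : good u 0 by exact: (@good_intr R u 0).
rewrite !chart_val // => /(congr1 fst) /= E.
have : turn (ucoord t - ucoord s) = (1, 0).
  by rewrite turnD turnN -E -/(cconj _) cmulC cmulV //; exact: turn_circle.
move=> /turn_eq1[n nE].
have s0 := ucoord_ge0 s; have t1 := ucoord_le1 t.
have n0 : 0 < n by rewrite -(ltr_int R) -nE subr_gt0.
have n1 : 1 <= n%:~R :> R by rewrite ler1z; move: n0; rewrite -gtz0_ge1.
by split; apply: ucoord_inj; rewrite ?ucoord0 ?ucoord1; lra.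
Qed.

Lemma marked_generates x y : marked x y -> generates x y.
Proof.
move=> [f [g [[k [kb fE gE]] -> ->]]] H HG Hf Hg w.
have [la [lb [laE lbE]]] := standard_loops.
rewrite -(loop_class_repr w); set l := repr w.
have kpb : homeo_inv k p = base R by rewrite -kb homeoK.
have [l' l'E] := loop_map_exists l (homeo_inv_cts (h := k)) kpb.
(* Membership in H pulled back to the model; the image loop is specified by its values, so any loop
   with these values is allowed. *)
pose Q (l' : loop R (base R)) := forall l : loop R p, (forall t, l t = k (l' t)) ->
  loop_class l \in H.
have HM := group_closedM HG; have HV := group_closedV HG.
have up (l1 : loop R (base R)) := loop_map_exists l1 (homeo_cts (h := k)) kb.
suff : Q l' by apply=> t; rewrite l'E homeo_invK.
apply: (loop_generation (la := la) (lb := lb)) => //.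
- move=> f1 f2 f12 Q1 l2 l2E; have [l1 l1E] := up f1.
  have <- : loop_class l1 = loop_class l2; last exact: Q1.
  by apply/loop_classP; apply: loop_map_homotopic l1E l2E f12 => //; exact: homeo_cts.
- move=> l1 l1E; have -> : loop_class l1 = 1%g; last by case: HG.
  by apply: loop_class_eq => t; rewrite l1E.
- by move=> l1 l1E; rewrite (@loop_class_eq l1 f) // => t; rewrite l1E laE fE.
- by move=> l1 l1E; rewrite (@loop_class_eq l1 g) // => t; rewrite l1E lbE gE.
- move=> f1 f2 Q1 Q2 l1 l1E; have [l2 l2E] := up f1; have [l3 l3E] := up f2.
  rewrite (@loop_class_eq l1 (concat l2 l3)) => [|t];
    last by rewrite l1E (loop_map_concat l2E l3E).
  by rewrite -pi1_mulgE; apply: HM; [exact: Q1|exact: Q2].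
- move=> f1 Q1 l1 l1E; have [l2 l2E] := up f1.
  rewrite (@loop_class_eq l1 (rev_loop l2)) => [|t];
    last by rewrite l1E (loop_map_rev l2E).
  by rewrite -pi1_invgE; apply: HV; exact: Q1.
Qed.

End Markings.

Theorem theorem1p7 (R : realType) (S : topologicalType)
    (h : homeomorphism (holed_torus R) S) (p : S)
    (p_int : (h @` @holed_torus_interior R)%classic p)
    (rho : {multiplicative @pi1 R S p -> PSL2 R[i]}) :
  ~ elementary rho ->
  exists a b : @pi1 R S p,
    [/\ simple_loop a, simple_loop b, generates a b,
        loxodromic (rho a) & loxodromic (rho b)].
Proof.
move=> ne; have [f [g fg]] := marking_exists p_int.
pose P (A B : SL2 R[i]) := exists x y : @pi1 R S p,
  [/\ marked x y, rho x = PSL2_class A & rho y = PSL2_class B].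
have [|||||A [B [[x [y [xy xA yB]]] nA nB]]] := @loxodromic_pair_exists R P _ _ _ _
  (repr (rho (loop_class f))) (repr (rho (loop_class g))).
- by move=> A B [x [y [xy xA yB]]]; exists y, x; split=> //; exact: marked_swap.
- move=> A B [x [y [xy xA yB]]]; exists (x^-1)%g, y; split=> //; first exact: marked_inv.
  by rewrite multiplicativeV xA -PSL2_invE.
- move=> A B [x [y [xy xA yB]]]; exists (y * x)%g, y; split=> //; first exact: marked_mul.
  by rewrite gmulfM xA yB -PSL2_mulE.
- move=> A B [x [y [xy xA yB]]]; have gen := marked_generates xy.
  split=> [[u [v [pA pB]]]|[Q Qp [pA pB]]]; apply: ne.
    by apply: (preserves_pair_elementary gen (p := u) (q := v)); rewrite ?xA ?yB.
  by apply: (preserves_form_elementary gen Qp); rewrite ?xA ?yB.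
- exists (loop_class f), (loop_class g); rewrite !PSL2_class_repr; split=> //.
  by exists f, g.
exists x, y; split.
- exact: marked_simple xy.
- exact: marked_simple (marked_swap xy).
- exact: marked_generates.
- by rewrite xA; exact: lox_of_large_trace.
- by rewrite yB; exact: lox_of_large_trace.
Qed.
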